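(* For any $\omega \in \mathcal{M}$ and any integer $k \geq 3$ there exists a conformal Willmore immersion \[ f_{\omega,k}: \mathbb{C}/(\mathbb{Z}+\omega\mathbb{Z}) \to \mathbb{R}^4 \] which has exactly one point of density $k$ and satisfies $\mathcal{W}(f_{\omega,k}) = 4k\pi$.
   Context: $\mathcal{M} := \{a+ib : b>0,\ 0\le a\le 1/2,\ a^2+b^2\ge 1\}$; every two-dimensional torus is conformally equivalent to some $\mathbb{C}/(\mathbb{Z}+\omega\mathbb{Z})$ with $\omega\in\mathcal M$, equipped with the flat metric induced from $\mathbb{C}$. A conformal immersion of this torus is one whose pull-back metric is a positive multiple of the flat metric. The Willmore energy of an immersion $f:\Sigma\to\mathbb{R}^n$ is $\mathcal{W}(f)=\frac14\int_\Sigma |H|^2\,d\mu$, with $H$ the mean curvature vector and $\mu$ the induced area measure; a Willmore immersion is a critical point of $\mathcal W$. A point of density $k$ of an immersion $f$ is a point $x\in\mathbb{R}^4$ at which the image has density $k$, i.e. whose preimage $f^{-1}(x)$ consists of exactly $k$ points. *)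

(* Defs.v *)
From Stdlib Require Import Reals List.
From Coquelicot Require Import Coquelicot.
Open Scope R_scope.

(* A map C -> R^4 is encoded as f : nat -> R -> R -> R, where f i x y is the
   i-th coordinate (i = 0..3) of f at x + i y.  Only i < 4 is ever used. *)

Definition sum4 (h : nat -> R) : R := h 0%nat + h 1%nat + h 2%nat + h 3%nat.

Definition pdx (g : R -> R -> R) : R -> R -> R :=
  fun x y => Derive (fun t => g t y) x.
Definition pdy (g : R -> R -> R) : R -> R -> R :=
  fun x y => Derive (fun t => g x t) y.

Fixpoint iterD (l : list bool) (g : R -> R -> R) : R -> R -> R :=
  match l with
  | nil => g
  | b :: l' => (if b then pdx else pdy) (iterD l' g)
  end.

Definition smooth2 (g : R -> R -> R) : Prop :=
  forall (l : list bool) (x y : R),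
    ex_derive (fun t => iterD l g t y) x /\
    ex_derive (fun t => iterD l g x t) y /\
    continuous (fun p : R * R => iterD l g (fst p) (snd p)) (x, y).

Definition smooth_map (f : nat -> R -> R -> R) : Prop :=
  forall i, (i < 4)%nat -> smooth2 (f i).

(* invariance under the lattice Z + omega Z, omega = a + i b *)
Definition lattice_periodic (f : nat -> R -> R -> R) (a b : R) : Prop :=
  forall i x y, f i (x + 1) y = f i x y /\ f i (x + a) (y + b) = f i x y.

Definition g11 f x y := sum4 (fun i => pdx (f i) x y * pdx (f i) x y).
Definition g12 f x y := sum4 (fun i => pdx (f i) x y * pdy (f i) x y).
Definition g22 f x y := sum4 (fun i => pdy (f i) x y * pdy (f i) x y).
Definition detg f x y := g11 f x y * g22 f x y - g12 f x y ^ 2.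
Definition sqdet f x y := sqrt (detg f x y).

Definition conformal_immersion (f : nat -> R -> R -> R) : Prop :=
  forall x y, g12 f x y = 0 /\ g11 f x y = g22 f x y /\ 0 < g11 f x y.

(* Laplace-Beltrami of the i-th coordinate; for an immersion into Euclidean
   space this is the mean curvature vector H (trace of 2nd fundamental form) *)
Definition meancurv (f : nat -> R -> R -> R) (i : nat) (x y : R) : R :=
  let gi11 := fun x y => g22 f x y / detg f x y in
  let gi12 := fun x y => - g12 f x y / detg f x y in
  let gi22 := fun x y => g11 f x y / detg f x y in
  / sqdet f x y *
  ( pdx (fun x y => sqdet f x y *
           (gi11 x y * pdx (f i) x y + gi12 x y * pdy (f i) x y)) x y
  + pdy (fun x y => sqdet f x y *
           (gi12 x y * pdx (f i) x y + gi22 x y * pdy (f i) x y)) x y).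

(* Willmore energy W(f) = 1/4 int_T |H|^2 dmu, the integral over the torus
   C/(Z + omega Z) computed on the fundamental parallelogram
   {s + t omega | s,t in [0,1]} (Jacobian b). *)
Definition willmore (f : nat -> R -> R -> R) (a b : R) : R :=
  / 4 * RInt (fun t => RInt (fun s =>
          let x := s + t * a in let y := t * b in
          sum4 (fun i => meancurv f i x y ^ 2) * sqdet f x y * b) 0 1) 0 1.

Definition willmore_critical (f : nat -> R -> R -> R) (a b : R) : Prop :=
  forall phi : nat -> R -> R -> R,
    smooth_map phi -> lattice_periodic phi a b ->
    is_derive (fun tau => willmore (fun i x y => f i x y + tau * phi i x y) a b) 0 0.

(* number of torus points (s + t omega, s,t in [0,1)) mapped to p is k *)
Definition density (f : nat -> R -> R -> R) (a b : R) (p : nat -> R) (k : nat) : Prop :=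
  exists l : list (R * R), NoDup l /\ length l = k /\
    forall q : R * R, In q l <->
      (0 <= fst q < 1 /\ 0 <= snd q < 1 /\
       forall i, (i < 4)%nat -> f i (fst q + snd q * a) (snd q * b) = p i).

Definition in_M (a b : R) : Prop := 0 < b /\ 0 <= a <= 1/2 /\ 1 <= a ^ 2 + b ^ 2.

(* Main.v *)
(** Identify [R^4] with the quaternions.  For a regular map [f], one factor [G] of its Gauss map
    into [G(2,4) = S^2 x S^2] satisfies, pointwise,
      [|H|^2 dmu = 4 G^*(area of S^2) + |defect|^2],
    where the defect measures the failure of [G] to be conformal, with the fixed orientation, for
    the metric induced by [f].  The integral of [G^*(area)] is [4 pi] times the degree of [G] and
    has vanishing first variation, and the second term is quadratic in the defect; so every [f]
    with vanishing defect is Willmore critical, and its energy is the degree term.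

    The defect vanishes for [f = (s1 + s2 j)^-1 s0] with holomorphic [s0, s1, s2]: here [G] is the
    Hopf image of [s1 + s2 j], and [f] is automatically conformal.  If the [si] are sections of one
    line bundle of degree [k] over the torus, then [f] descends to the torus, and the degree term
    is the integral of the Laplacian of [ln (|s1|^2 + |s2|^2)], which is [4 pi k].  The map is an
    immersion as soon as [s1, s2] have no common zero and the Wronskians of [(s0, s1)] and
    [(s0, s2)] have none.

    The sections are products of [k] translates of the odd theta function [S1].  The sections [s0]
    and [s1] share [k - 2] zeros, so [s1 / s0] is an even function of degree two: by the addition
    formula a value of [f] other than [0] is attained at most twice, while [0] is attained
    exactly at the [k] simple zeros of [s0].  The section [s2 = s0 + x (A + lam B)] is a generic
    combination; all conditions on [x] and [lam] amount to avoiding finitely many values, because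
    they concern only the zeros of [s1] and of the first Wronskian.  That [S1] vanishes only on
    the lattice comes from a finite form of the Jacobi triple product. *)

Require Import Defs.
From Stdlib Require Import Reals Lra Lia ZArith List FinFun Classical FunctionalExtensionality.
From Coquelicot Require Import Coquelicot.
Open Scope R_scope.

(** * Smooth functions of two variables *)

(** Two demands pull against each other. Bounding the number of preimages wants the quotient of [s1]
    and [s0] to be as simple as possible, but this forces common zeros, and a Wronskian vanishing at
    them and at the half periods. The section [s2] repairs both and may be chosen freely, because
    the count of preimages never looks at it. What makes the repair checkable is that Wronskians are
    explicit: two products whose zeros differ in one pair with the same midpoint have a Wronskian
    that is again a product, by the addition formula. All zeros sit at rational lattice coordinates,
    so that each non-vanishing is the non-integrality of a fraction.

    For criticality the energy is not differentiated under the integral. The Gauss map is only shown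
    to be Lipschitz in the parameter at 0; this is enough, since the defect enters squared and the
    linear change of the area form is a divergence up to terms quadratic in the displacement on the
    sphere.

    The condition k >= 3 enters twice: three preimages of a second point of density k are compared,
    and at least one common zero of [s0] and [s1] must exist for the construction of [A]. *)

Definition cont2 (g : R -> R -> R) : Prop :=
  forall x y, continuous (fun p : R * R => g (fst p) (snd p)) (x, y).

Definition has_partials (g gx gy : R -> R -> R) : Prop :=
  forall x y, is_derive (fun t => g t y) x (gx x y) /\
              is_derive (fun t => g x t) y (gy x y).

(** Recursive counterpart of [smooth2] with the partials as witnesses: closure under products,
    inverses and roots then goes by induction on the order, for which words of derivatives are
    awkward. *)
Fixpoint smoothn (n : nat) (g : R -> R -> R) : Prop :=
  cont2 g /\
  match n with
  | O => True
  | S m => exists gx gy, has_partials g gx gy /\ smoothn m gx /\ smoothn m gy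
  end.

Lemma has_partials_eq (g gx gy : R -> R -> R) :
  has_partials g gx gy -> gx = pdx g /\ gy = pdy g.
Proof.
intros H; split; apply functional_extensionality; intros x;
  apply functional_extensionality; intros y; symmetry;
  apply is_derive_unique; apply H.
Qed.

Lemma smoothn_pred (n : nat) (g : R -> R -> R) : smoothn (S n) g -> smoothn n g.
Proof.
revert g; induction n as [|n IH]; intros g [Hc [gx [gy [Hp [Hx Hy]]]]].
- split; auto.
- split; auto. exists gx, gy. auto.
Qed.

Lemma smooth2_smoothn (g : R -> R -> R) :
  smooth2 g <-> (forall n, smoothn n g).
Proof.
(* [iterD] applies the head of the word last, while [smoothn] peels off the derivative taken first;
   appending at the end of the word reconciles the two orders. *)
assert (Hcomp : forall l b h, iterD l ((if b : bool then pdx else pdy) h) = iterD (l ++ b :: nil) h).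
{ induction l as [|c l IH]; intros b h; simpl; auto. now rewrite IH. }
split.
- intros H n. revert g H. induction n as [|n IH]; intros g H; split; auto.
  + intros x y; apply (H nil x y).
  + intros x y; apply (H nil x y).
  + exists (pdx g), (pdy g). split; [|split].
    * intros x y; split; apply Derive_correct; apply (H nil x y).
    * apply IH. intros l. rewrite (Hcomp l true g). apply H.
    * apply IH. intros l. rewrite (Hcomp l false g). apply H.
- intros H.
  assert (Hi : forall l n, smoothn n (iterD l g)).
  { induction l as [|b l IH]; intros n; [apply H|].
    destruct (IH (S n)) as [_ [gx [gy [Hp [Hx Hy]]]]].
    destruct (has_partials_eq _ _ _ Hp) as [-> ->] in Hx, Hy.
    destruct b; assumption. }
  intros l x y.
  destruct (Hi l 1%nat) as [Hc [gx [gy [Hp _]]]].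
  split; [|split]; [| |apply Hc].
  + exists (gx x y); apply Hp.
  + exists (gy x y); apply Hp.
Qed.

Lemma smooth2_cont (g : R -> R -> R) : smooth2 g -> cont2 g.
Proof. intros H x y; apply (H nil x y). Qed.

Lemma smooth2_partials (g : R -> R -> R) : smooth2 g -> has_partials g (pdx g) (pdy g).
Proof. intros H x y; split; apply Derive_correct; apply (H nil x y). Qed.

Lemma smooth2_pd (g : R -> R -> R) : smooth2 g -> smooth2 (pdx g) /\ smooth2 (pdy g).
Proof.
rewrite !smooth2_smoothn; intros H; split; intros n;
  destruct (H (S n)) as [_ [gx [gy [Hp [Hx Hy]]]]];
  destruct (has_partials_eq _ _ _ Hp) as [-> ->] in Hx, Hy; assumption.
Qed.

Lemma smooth2_dx (g : R -> R -> R) : smooth2 g -> smooth2 (pdx g).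
Proof. intros H; apply (smooth2_pd g H). Qed.

Lemma smooth2_dy (g : R -> R -> R) : smooth2 g -> smooth2 (pdy g).
Proof. intros H; apply (smooth2_pd g H). Qed.

Lemma smoothn_const (c : R) (n : nat) : smoothn n (fun _ _ => c).
Proof.
assert (Hc : forall d : R, cont2 (fun _ _ => d)) by (intros d x y; apply continuous_const).
revert c; induction n as [|n IH]; intros c; split; auto.
exists (fun _ _ => 0), (fun _ _ => 0); split; [|split]; auto.
intros x y; split; apply (is_derive_const c).
Qed.

Lemma smoothn_plus (n : nat) (g h : R -> R -> R) :
  smoothn n g -> smoothn n h -> smoothn n (fun x y => g x y + h x y).
Proof.
revert g h; induction n as [|n IH]; intros g h [Hg Dg] [Hh Dh]; split.
1,3: intros x y; apply (continuous_plus (fun p : R * R => g (fst p) (snd p))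
        (fun p : R * R => h (fst p) (snd p))); auto.
- auto.
- destruct Dg as [gx [gy [Pg [Gx Gy]]]], Dh as [hx [hy [Ph [Hx Hy]]]].
  exists (fun x y => gx x y + hx x y), (fun x y => gy x y + hy x y).
  split; [|split]; auto.
  intros x y; split.
  + apply (is_derive_plus (fun t => g t y) (fun t => h t y)); [apply Pg|apply Ph].
  + apply (is_derive_plus (fun t => g x t) (fun t => h x t)); [apply Pg|apply Ph].
Qed.

Lemma smoothn_mult (n : nat) (g h : R -> R -> R) :
  smoothn n g -> smoothn n h -> smoothn n (fun x y => g x y * h x y).
Proof.
revert g h; induction n as [|n IH]; intros g h Sg Sh; generalize Sg Sh;
  intros [Hg Dg] [Hh Dh]; split.
1,3: intros x y; apply (continuous_mult (fun p : R * R => g (fst p) (snd p))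
        (fun p : R * R => h (fst p) (snd p))); auto.
- auto.
- destruct Dg as [gx [gy [Pg [Gx Gy]]]], Dh as [hx [hy [Ph [Hx Hy]]]].
  apply smoothn_pred in Sg, Sh.
  exists (fun x y => gx x y * h x y + g x y * hx x y),
         (fun x y => gy x y * h x y + g x y * hy x y).
  split; [|split]; [|apply smoothn_plus; apply IH; auto ..].
  intros x y; split.
  + apply (is_derive_mult (fun t => g t y) (fun t => h t y)); [apply Pg|apply Ph|].
    intros; apply Rmult_comm.
  + apply (is_derive_mult (fun t => g x t) (fun t => h x t)); [apply Pg|apply Ph|].
    intros; apply Rmult_comm.
Qed.

Lemma smoothn_opp (n : nat) (g : R -> R -> R) :
  smoothn n g -> smoothn n (fun x y => - g x y).
Proof.
intros H.
replace (fun x y => - g x y) with (fun x y => -1 * g x y).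
- apply smoothn_mult; auto using smoothn_const.
- do 2 (apply functional_extensionality; intros ?); ring.
Qed.

(** The partials of [/ g] are polynomials in [/ g] and the partials of [g], so the induction
    hypothesis at lower order applies to [/ g] itself with [g] fixed. The square root is treated in
    the same way. *)
Lemma smoothn_inv (n : nat) (g : R -> R -> R) :
  (forall x y, g x y <> 0) -> smoothn n g -> smoothn n (fun x y => / g x y).
Proof.
intros Hnz; induction n as [|n IH]; intros Sg; generalize Sg; intros [Hg Dg]; split.
1,3: intros x y; apply (continuous_comp (fun p : R * R => g (fst p) (snd p)) Rinv);
     [apply Hg | apply continuous_Rinv, Hnz].
- auto.
- destruct Dg as [gx [gy [Pg [Gx Gy]]]].
  apply smoothn_pred in Sg.
  exists (fun x y => - gx x y * (/ g x y * / g x y)),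
         (fun x y => - gy x y * (/ g x y * / g x y)).
  split; [|split]; [|apply smoothn_mult; auto using smoothn_mult, smoothn_opp ..].
  intros x y; split.
  + replace (- gx x y * (/ g x y * / g x y)) with (- gx x y / (g x y) ^ 2) by (field; auto).
    apply (is_derive_inv (fun t => g t y)); [apply Pg|apply Hnz].
  + replace (- gy x y * (/ g x y * / g x y)) with (- gy x y / (g x y) ^ 2) by (field; auto).
    apply (is_derive_inv (fun t => g x t)); [apply Pg|apply Hnz].
Qed.

Lemma smoothn_sqrt (n : nat) (g : R -> R -> R) :
  (forall x y, 0 < g x y) -> smoothn n g -> smoothn n (fun x y => sqrt (g x y)).
Proof.
intros Hpos; induction n as [|n IH]; intros Sg; generalize Sg; intros [Hg Dg]; split.
1,3: intros x y; apply (continuous_comp (fun p : R * R => g (fst p) (snd p)) sqrt);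
     [apply Hg | apply continuous_sqrt].
- auto.
- destruct Dg as [gx [gy [Pg [Gx Gy]]]].
  apply smoothn_pred in Sg.
  assert (Hs : forall x y, sqrt (g x y) <> 0)
    by (intros x y; apply Rgt_not_eq, sqrt_lt_R0, Hpos).
  exists (fun x y => gx x y * (/ 2 * / sqrt (g x y))),
         (fun x y => gy x y * (/ 2 * / sqrt (g x y))).
  split; [|split].
  2,3: apply smoothn_mult; auto; apply smoothn_mult; [apply smoothn_const|];
       apply (smoothn_inv n (fun x y => sqrt (g x y))); auto.
  intros x y; split.
  + replace (gx x y * (/ 2 * / sqrt (g x y))) with (gx x y / (2 * sqrt (g x y)))
      by (field; auto).
    apply (is_derive_sqrt (fun t => g t y)); [apply Pg|apply Hpos].
  + replace (gy x y * (/ 2 * / sqrt (g x y))) with (gy x y / (2 * sqrt (g x y)))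
      by (field; auto).
    apply (is_derive_sqrt (fun t => g x t)); [apply Pg|apply Hpos].
Qed.

Lemma smooth2_const (c : R) : smooth2 (fun _ _ => c).
Proof. apply smooth2_smoothn; apply smoothn_const. Qed.

Lemma smooth2_plus (g h : R -> R -> R) :
  smooth2 g -> smooth2 h -> smooth2 (fun x y => g x y + h x y).
Proof. rewrite !smooth2_smoothn; intros; apply smoothn_plus; auto. Qed.

Lemma smooth2_mult (g h : R -> R -> R) :
  smooth2 g -> smooth2 h -> smooth2 (fun x y => g x y * h x y).
Proof. rewrite !smooth2_smoothn; intros; apply smoothn_mult; auto. Qed.

Lemma smooth2_opp (g : R -> R -> R) : smooth2 g -> smooth2 (fun x y => - g x y).
Proof. rewrite !smooth2_smoothn; intros; apply smoothn_opp; auto. Qed.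

Lemma smooth2_minus (g h : R -> R -> R) :
  smooth2 g -> smooth2 h -> smooth2 (fun x y => g x y - h x y).
Proof. intros; apply (smooth2_plus g (fun x y => - h x y)); auto using smooth2_opp. Qed.

Lemma smooth2_inv (g : R -> R -> R) :
  (forall x y, g x y <> 0) -> smooth2 g -> smooth2 (fun x y => / g x y).
Proof. rewrite !smooth2_smoothn; intros; apply smoothn_inv; auto. Qed.

Lemma smooth2_div (g h : R -> R -> R) :
  (forall x y, h x y <> 0) -> smooth2 g -> smooth2 h -> smooth2 (fun x y => g x y / h x y).
Proof. intros; apply (smooth2_mult g (fun x y => / h x y)); auto using smooth2_inv. Qed.

Lemma smooth2_sqrt (g : R -> R -> R) :
  (forall x y, 0 < g x y) -> smooth2 g -> smooth2 (fun x y => sqrt (g x y)).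
Proof. rewrite !smooth2_smoothn; intros; apply smoothn_sqrt; auto. Qed.

Lemma pd_ext_partials (g gx gy : R -> R -> R) (x y : R) :
  has_partials g gx gy -> pdx g x y = gx x y /\ pdy g x y = gy x y.
Proof. intros H; destruct (has_partials_eq _ _ _ H) as [-> ->]; auto. Qed.

Lemma partials_plus (g h gx gy hx hy : R -> R -> R) :
  has_partials g gx gy -> has_partials h hx hy ->
  has_partials (fun x y => g x y + h x y) (fun x y => gx x y + hx x y) (fun x y => gy x y + hy x y).
Proof.
intros Hg Hh x y; split.
- apply (is_derive_plus (fun t => g t y) (fun t => h t y)); [apply Hg|apply Hh].
- apply (is_derive_plus (fun t => g x t) (fun t => h x t)); [apply Hg|apply Hh].
Qed.

Lemma partials_mult (g h gx gy hx hy : R -> R -> R) :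
  has_partials g gx gy -> has_partials h hx hy ->
  has_partials (fun x y => g x y * h x y) (fun x y => gx x y * h x y + g x y * hx x y)
    (fun x y => gy x y * h x y + g x y * hy x y).
Proof.
intros Hg Hh x y; split.
- apply (is_derive_mult (fun t => g t y) (fun t => h t y)); [apply Hg|apply Hh|].
  intros; apply Rmult_comm.
- apply (is_derive_mult (fun t => g x t) (fun t => h x t)); [apply Hg|apply Hh|].
  intros; apply Rmult_comm.
Qed.

(** A quadratic remainder is the form in which both the first variation of the energy and the
    termwise differentiation of series are obtained. *)
Lemma is_derive_quadratic_bound (W : R -> R) (x l d C : R) : 0 < d -> 0 <= C ->
  (forall t, Rabs t < d -> Rabs (W (x + t) - W x - l * t) <= C * Rabs t ^ 2) -> is_derive W x l.
Proof.
intros Hd HC H; apply is_derive_Reals; intros eps Heps.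
assert (Hm : 0 < Rmin d (eps / (C + 1))).
{ apply Rmin_pos; auto; apply Rdiv_lt_0_compat; lra. }
exists (mkposreal _ Hm); intros h Hh Hlt; simpl in Hlt.
assert (T1 := Rlt_le_trans _ _ _ Hlt (Rmin_l _ _)).
assert (T2 := Rlt_le_trans _ _ _ Hlt (Rmin_r _ _)).
apply Rlt_div_r in T2; [|lra].
specialize (H h T1).
assert (Hp : 0 < Rabs h) by (apply Rabs_pos_lt; auto).
replace ((W (x + h) - W x) / h - l) with ((W (x + h) - W x - l * h) * / h) by (field; auto).
rewrite Rabs_mult, Rabs_inv.
apply Rle_lt_trans with (C * Rabs h ^ 2 * / Rabs h).
- apply Rmult_le_compat_r; auto; left; apply Rinv_0_lt_compat; auto.
- replace (C * Rabs h ^ 2 * / Rabs h) with (C * Rabs h) by (field; lra). nra.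
Qed.

(** * Integration over the torus *)

(** The same iterated integral over s + t omega, with Jacobian [b], as in [willmore], so that the
    energy unfolds to it by conversion. *)
Definition tint (a b : R) (h : R -> R -> R) : R :=
  RInt (fun t => RInt (fun s => h (s + t * a) (t * b) * b) 0 1) 0 1.

Lemma cont2_2d (g : R -> R -> R) (x y : R) : cont2 g -> continuity_2d_pt g x y.
Proof. intros H; apply continuity_2d_pt_filterlim, H. Qed.

Lemma cont2_comp (g u v : R -> R -> R) :
  cont2 g -> cont2 u -> cont2 v -> cont2 (fun x y => g (u x y) (v x y)).
Proof.
intros Hg Hu Hv x y.
apply (continuous_comp_2 (fun p : R * R => u (fst p) (snd p))
         (fun p : R * R => v (fst p) (snd p)) g).
- apply Hu.
- apply Hv.
- apply (Hg (u x y) (v x y)).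
Qed.

Lemma cont2_const (c : R) : cont2 (fun _ _ => c).
Proof. intros x y; apply continuous_const. Qed.

Lemma cont2_fst : cont2 (fun x _ => x).
Proof. intros x y; apply continuous_fst. Qed.

Lemma cont2_snd : cont2 (fun _ y => y).
Proof. intros x y; apply continuous_snd. Qed.

Lemma cont2_plus (g h : R -> R -> R) : cont2 g -> cont2 h -> cont2 (fun x y => g x y + h x y).
Proof.
intros Hg Hh x y; apply (continuous_plus (fun p : R * R => g (fst p) (snd p))
        (fun p : R * R => h (fst p) (snd p))); auto.
Qed.

Lemma cont2_mult (g h : R -> R -> R) : cont2 g -> cont2 h -> cont2 (fun x y => g x y * h x y).
Proof.
intros Hg Hh x y; apply (continuous_mult (fun p : R * R => g (fst p) (snd p))
        (fun p : R * R => h (fst p) (snd p))); auto.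
Qed.

Lemma cont2_slice_l (g : R -> R -> R) (x y : R) : cont2 g -> continuous (fun t => g t y) x.
Proof.
intros Hg.
apply (continuous_comp_2 (fun t : R => t) (fun _ : R => y) g).
- apply continuous_id.
- apply continuous_const.
- apply (Hg x y).
Qed.

Lemma cont2_slice_r (g : R -> R -> R) (x y : R) : cont2 g -> continuous (fun t => g x t) y.
Proof.
intros Hg.
apply (continuous_comp_2 (fun _ : R => x) (fun t : R => t) g).
- apply continuous_const.
- apply continuous_id.
- apply (Hg x y).
Qed.

Lemma cont2_skew (a b : R) (h : R -> R -> R) :
  cont2 h -> cont2 (fun t s => h (s + t * a) (t * b)).
Proof.
intros Hh; apply cont2_comp; auto.
- apply cont2_plus; [apply cont2_snd|apply cont2_mult; [apply cont2_fst|apply cont2_const]].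
- apply cont2_mult; [apply cont2_fst|apply cont2_const].
Qed.

Lemma ex_RInt_slice (g : R -> R -> R) (t p q : R) : cont2 g -> ex_RInt (fun s => g t s) p q.
Proof. intros Hg; apply (ex_RInt_continuous (V := R_CompleteNormedModule)); intros z _; apply cont2_slice_r, Hg. Qed.

Lemma continuous_RInt_param (g : R -> R -> R) (t : R) :
  cont2 g -> continuous (fun t => RInt (fun s => g t s) 0 1) t.
Proof.
intros Hg.
apply continuity_pt_filterlim.
intros eps Heps.
assert (He2 : 0 < eps / 2) by lra.
destruct (uniform_continuity_2d_1d' g 0 1 t
  (fun x _ => cont2_2d g t x Hg) (mkposreal _ He2)) as [d Hd].
exists d; split; [apply d|].
intros x [_ Hx]; unfold R_dist, dist in *; simpl in *.
change (R_dist x t) with (Rabs (x - t)) in Hx.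
change (Rabs (RInt (fun s => g x s) 0 1 - RInt (fun s => g t s) 0 1) < eps).
replace (RInt (fun s => g x s) 0 1 - RInt (fun s => g t s) 0 1)
  with (RInt (fun s => minus (g x s) (g t s)) 0 1)
  by (apply (RInt_minus (V := R_CompleteNormedModule) (fun s => g x s) (fun s => g t s)); auto using ex_RInt_slice).
apply Rle_lt_trans with ((1 - 0) * (eps / 2)); [|lra].
apply abs_RInt_le_const; [lra| |].
- apply (ex_RInt_minus (fun s => g x s) (fun s => g t s)); auto using ex_RInt_slice.
- intros s Hs. apply Rlt_le.
  apply Rabs_def2 in Hx.
  apply (Hd s t s x); try lra.
  rewrite Rminus_diag, Rabs_R0; apply d.
Qed.

Lemma tint_inner_continuous (a b t : R) (h : R -> R -> R) :
  cont2 h -> continuous (fun t => RInt (fun s => h (s + t * a) (t * b) * b) 0 1) t.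
Proof.
intros Hh.
apply (continuous_RInt_param (fun t s => h (s + t * a) (t * b) * b)).
apply cont2_mult; [apply cont2_skew, Hh|apply cont2_const].
Qed.

Lemma tint_inner_ex (a b t : R) (h : R -> R -> R) :
  cont2 h -> ex_RInt (fun s => h (s + t * a) (t * b) * b) 0 1.
Proof.
intros Hh.
apply (ex_RInt_slice (fun t s => h (s + t * a) (t * b) * b)).
apply cont2_mult; [apply cont2_skew, Hh|apply cont2_const].
Qed.

Lemma tint_outer_ex (a b : R) (h : R -> R -> R) :
  cont2 h -> ex_RInt (fun t => RInt (fun s => h (s + t * a) (t * b) * b) 0 1) 0 1.
Proof.
intros Hh; apply (ex_RInt_continuous (V := R_CompleteNormedModule)); intros t _; apply tint_inner_continuous, Hh.
Qed.

Lemma tint_plus (a b : R) (g h : R -> R -> R) :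
  cont2 g -> cont2 h -> tint a b (fun x y => g x y + h x y) = tint a b g + tint a b h.
Proof.
intros Hg Hh; unfold tint.
rewrite <- (RInt_plus (V := R_CompleteNormedModule)) by auto using tint_outer_ex.
apply RInt_ext; intros t _.
rewrite <- (RInt_plus (V := R_CompleteNormedModule)) by auto using tint_inner_ex.
apply RInt_ext; intros s _; simpl.
unfold plus; simpl; ring.
Qed.

Lemma tint_scal (a b c : R) (h : R -> R -> R) :
  cont2 h -> tint a b (fun x y => c * h x y) = c * tint a b h.
Proof.
intros Hh; unfold tint.
rewrite <- (RInt_scal (V := R_CompleteNormedModule)) by auto using tint_outer_ex.
apply RInt_ext; intros t _.
rewrite <- (RInt_scal (V := R_CompleteNormedModule)) by auto using tint_inner_ex.
apply RInt_ext; intros s _; simpl.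
unfold scal; simpl; unfold mult; simpl; ring.
Qed.

Lemma tint_bound (a b M : R) (h : R -> R -> R) :
  0 <= b -> cont2 h ->
  (forall s t, 0 <= s <= 1 -> 0 <= t <= 1 -> Rabs (h (s + t * a) (t * b)) <= M) ->
  Rabs (tint a b h) <= M * b.
Proof.
intros Hb Hh HM; unfold tint.
replace (M * b) with ((1 - 0) * (M * b)) by ring.
apply abs_RInt_le_const; [lra|auto using tint_outer_ex|].
intros t Ht.
replace (M * b) with ((1 - 0) * (M * b)) by ring.
apply abs_RInt_le_const; [lra|auto using tint_inner_ex|].
intros s Hs.
rewrite Rabs_mult, (Rabs_pos_eq b) by lra.
apply Rmult_le_compat_r; auto.
Qed.

Lemma smooth2_chain (g : R -> R -> R) (p q x y t : R) :
  smooth2 g ->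
  is_derive (fun t => g (x + t * p) (y + t * q)) t
    (p * pdx g (x + t * p) (y + t * q) + q * pdy g (x + t * p) (y + t * q)).
Proof.
intros Hg.
set (X := x + t * p); set (Y := y + t * q).
assert (Hd : differentiable_pt_lim g X Y (pdx g X Y) (pdy g X Y)).
{ apply filterdiff_differentiable_pt_lim.
  apply (is_derive_filterdiff g X Y (pdx g) (pdy g X Y)).
  - apply filter_forall; intros u; apply (smooth2_partials g Hg).
  - apply (smooth2_partials g Hg).
  - apply (smooth2_cont _ (smooth2_dx g Hg)). }
apply is_derive_Reals.
replace (p * pdx g X Y + q * pdy g X Y) with (pdx g X Y * p + pdy g X Y * q) by ring.
apply (derivable_pt_lim_comp_2d g (fun t => x + t * p) (fun t => y + t * q)); auto.
- apply is_derive_Reals; auto_derive; auto; ring.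
- apply is_derive_Reals; auto_derive; auto; ring.
Qed.

(* In the coordinates [x = s + t a], [y = t b] the divergence times the Jacobian [b] is
   [d/ds (b A - a B) + d/dt B]; the first summand integrates to zero by periodicity. *)
Lemma tint_divergence (a b : R) (A B : R -> R -> R) :
  smooth2 A -> smooth2 B ->
  (forall x y, A (x + 1) y = A x y) -> (forall x y, B (x + 1) y = B x y) ->
  tint a b (fun x y => pdx A x y + pdy B x y) =
  RInt (fun s => B (s + a) b) 0 1 - RInt (fun s => B s 0) 0 1.
Proof.
intros HA HB PA PB.
assert (cAx := smooth2_cont _ (smooth2_dx A HA)).
assert (cBx := smooth2_cont _ (smooth2_dx B HB)).
assert (cBy := smooth2_cont _ (smooth2_dy B HB)).
set (Bt := fun t s => a * pdx B (s + t * a) (t * b) + b * pdy B (s + t * a) (t * b)).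
assert (cBt : cont2 Bt).
{ apply cont2_plus; apply cont2_mult; try apply cont2_const; apply cont2_skew; auto. }
assert (dBt : forall t s, is_derive (fun t => B (s + t * a) (t * b)) t (Bt t s)).
{ intros t s.
  apply (is_derive_ext (fun t => B (s + t * a) (0 + t * b))).
  - intros u; rewrite Rplus_0_l; reflexivity.
  - assert (H := smooth2_chain B a b s 0 t HB).
    rewrite !Rplus_0_l in H; exact H. }
assert (E : forall t, RInt (fun s => (pdx A (s + t * a) (t * b) + pdy B (s + t * a) (t * b)) * b) 0 1
   = RInt (fun s => Bt t s) 0 1).
{ intros t.
  assert (Hs : is_RInt (fun s => b * pdx A (s + t * a) (t * b) - a * pdx B (s + t * a) (t * b)) 0 1 0).
  { replace 0 with (minus (b * A (1 + t * a) (t * b) - a * B (1 + t * a) (t * b))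
                      (b * A (0 + t * a) (t * b) - a * B (0 + t * a) (t * b))) at 2.
    - apply (is_RInt_derive (fun s => b * A (s + t * a) (t * b) - a * B (s + t * a) (t * b))).
      + intros s _.
        assert (Hsh : is_derive (fun s => s + t * a) s 1) by (auto_derive; auto).
        apply (is_derive_minus (fun s => b * A (s + t * a) (t * b)) (fun s => a * B (s + t * a) (t * b)));
        apply is_derive_scal.
        * replace (pdx A (s + t * a) (t * b)) with (1 * pdx A (s + t * a) (t * b)) by ring.
          apply (is_derive_comp (fun x => A x (t * b)) (fun s => s + t * a)); auto.
          apply (smooth2_partials A HA).
        * replace (pdx B (s + t * a) (t * b)) with (1 * pdx B (s + t * a) (t * b)) by ring.
          apply (is_derive_comp (fun x => B x (t * b)) (fun s => s + t * a)); auto.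
          apply (smooth2_partials B HB).
      + intros s _.
        apply (continuous_ext (fun s => b * pdx A (s + t * a) (t * b) + - a * pdx B (s + t * a) (t * b))).
        { intros u; simpl; ring. }
        apply (cont2_slice_r (fun t s => b * pdx A (s + t * a) (t * b) + - a * pdx B (s + t * a) (t * b)) t s).
        apply cont2_plus; apply cont2_mult; try apply cont2_const; apply cont2_skew; auto.
    - rewrite (Rplus_comm 1), PA, (PB (t * a)), Rplus_0_l; unfold minus, plus, opp; simpl; ring. }
  apply is_RInt_unique.
  apply (is_RInt_ext (fun s => plus (b * pdx A (s + t * a) (t * b) - a * pdx B (s + t * a) (t * b)) (Bt t s))).
  - intros s _; unfold Bt, plus; simpl; ring.
  - replace (RInt (fun s => Bt t s) 0 1) with (plus 0 (RInt (fun s => Bt t s) 0 1))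
      by (unfold plus; simpl; ring).
    apply (is_RInt_plus (V := R_NormedModule)); auto.
    apply (RInt_correct (V := R_CompleteNormedModule)), ex_RInt_slice, cBt. }
unfold tint.
rewrite (RInt_ext _ (fun t => RInt (fun s => Bt t s) 0 1)) by (intros; apply E).
apply is_RInt_unique.
replace (RInt (fun s => B (s + a) b) 0 1 - RInt (fun s => B s 0) 0 1)
  with (minus (RInt (fun s => B (s + 1 * a) (1 * b)) 0 1) (RInt (fun s => B (s + 0 * a) (0 * b)) 0 1)).
- apply (is_RInt_derive (fun t => RInt (fun s => B (s + t * a) (t * b)) 0 1)).
  + intros t _.
    assert (Db : forall u v, Derive (fun z => B (v + z * a) (z * b)) u = Bt u v)
      by (intros u v; apply is_derive_unique, dBt).
    rewrite (RInt_ext _ (fun s => Derive (fun u => B (s + u * a) (u * b)) t))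
      by (intros s _; symmetry; apply Db).
    apply (is_derive_RInt_param (fun u s => B (s + u * a) (u * b))).
    * apply filter_forall; intros u s _; exists (Bt u s); apply dBt.
    * intros s _. apply (continuity_2d_pt_ext Bt); [intros; symmetry; apply Db|].
      apply cont2_2d, cBt.
    * apply filter_forall; intros u.
      apply (ex_RInt_slice (fun t s => B (s + t * a) (t * b))), cont2_skew, smooth2_cont, HB.
  + intros t _. apply continuous_RInt_param, cBt.
- unfold minus, plus, opp; simpl; unfold Rminus.
  f_equal; [|f_equal]; apply RInt_ext; intros s _; f_equal; ring.
Qed.

(** Translation by omega carries the edge t = 0 to the edge t = 1, so the two boundary integrals
    cancel. In the energy computation [B] is periodic only up to a constant, and there the
    difference survives. *)
Lemma tint_divergence_periodic (a b : R) (A B : R -> R -> R) :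
  smooth2 A -> smooth2 B ->
  (forall x y, A (x + 1) y = A x y) -> (forall x y, B (x + 1) y = B x y) ->
  (forall x y, B (x + a) (y + b) = B x y) ->
  tint a b (fun x y => pdx A x y + pdy B x y) = 0.
Proof.
intros HA HB PA PB PB'.
rewrite tint_divergence by auto.
rewrite (RInt_ext (fun s => B (s + a) b) (fun s => B s 0)); [ring|].
intros s _; rewrite <- (PB' s 0), Rplus_0_l; reflexivity.
Qed.

Lemma cont2_bounded (g : R -> R -> R) (p q r s : R) :
  cont2 g -> exists M, 0 <= M /\ forall x y, p <= x <= q -> r <= y <= s -> Rabs (g x y) <= M.
Proof.
intros Hg.
destruct (uniform_continuity_2d g p q r s (fun x y _ _ => cont2_2d g x y Hg) (mkposreal 1 Rlt_0_1))
  as [d Hd]; simpl in Hd.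
set (L := Rabs (q - p) + Rabs (s - r)).
assert (HL : 0 <= L) by (unfold L; generalize (Rabs_pos (q - p)) (Rabs_pos (s - r)); lra).
(* The segment from the corner [(p, r)] to [(x, y)] is walked in [N] steps shorter than the modulus
   of uniform continuity for 1; each step changes [g] by less than 1, which gives the bound |g(p,
   r)| + N. *)
destruct (INR_unbounded (L / d)) as [N HN].
assert (Hd0 := cond_pos d).
assert (HN0 : 0 < INR N).
{ apply Rle_lt_trans with (2 := HN). apply Rdiv_le_0_compat; auto. }
assert (HNd : L / INR N < d).
{ apply Rlt_div_l in HN; auto. apply Rlt_div_l; auto. lra. }
exists (Rabs (g p r) + INR N); split.
{ generalize (Rabs_pos (g p r)); lra. }
intros x y Hx Hy.
set (X := fun i => p + INR i / INR N * (x - p)).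
set (Y := fun i => r + INR i / INR N * (y - r)).
assert (Hi : forall i, (i <= N)%nat -> Rabs (g (X i) (Y i)) <= Rabs (g p r) + INR i).
{ assert (Hin : forall i, (i <= N)%nat -> p <= X i <= q /\ r <= Y i <= s).
  { intros i Hi; apply le_INR in Hi.
    assert (Hr : 0 <= INR i / INR N <= 1).
    { split; [apply Rdiv_le_0_compat; auto using pos_INR|].
      apply Rle_div_l; auto; lra. }
    unfold X, Y; split; split; nra. }
  assert (Hstep : forall u v w, 0 <= w <= Rabs (v - u) -> Rabs (v - u) <= L -> w / INR N < d).
  { intros u v w [Hw1 Hw2] Hw3. apply Rle_lt_trans with (2 := HNd).
    apply Rmult_le_compat_r; [left; apply Rinv_0_lt_compat; auto|lra]. }
  induction i as [|i IH]; intros Hi.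
  - unfold X, Y; simpl. unfold Rdiv; rewrite !Rmult_0_l, !Rplus_0_r; lra.
  - assert (Hi' : (i <= N)%nat) by lia.
    specialize (IH Hi').
    assert (Hg1 : Rabs (g (X (S i)) (Y (S i)) - g (X i) (Y i)) < 1).
    { apply Hd; try apply Hin; auto.
      - replace (X (S i) - X i) with ((x - p) / INR N)
          by (unfold X; rewrite S_INR; field; lra).
        rewrite Rabs_pos_eq by (apply Rdiv_le_0_compat; lra).
        apply (Hstep p q).
        + rewrite Rabs_pos_eq; lra.
        + unfold L; generalize (Rabs_pos (s - r)); lra.
      - replace (Y (S i) - Y i) with ((y - r) / INR N)
          by (unfold Y; rewrite S_INR; field; lra).
        rewrite Rabs_pos_eq by (apply Rdiv_le_0_compat; lra).
        apply (Hstep r s).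
        + rewrite Rabs_pos_eq; lra.
        + unfold L; generalize (Rabs_pos (q - p)); lra. }
    rewrite S_INR.
    replace (g (X (S i)) (Y (S i)))
      with (g (X i) (Y i) + (g (X (S i)) (Y (S i)) - g (X i) (Y i))) by ring.
    apply Rle_trans with (1 := Rabs_triang _ _); lra. }
specialize (Hi N (le_n N)).
unfold X, Y in Hi. rewrite Rdiv_diag, !Rmult_1_l in Hi by lra.
replace (p + (x - p)) with x in Hi by ring.
replace (r + (y - r)) with y in Hi by ring.
exact Hi.
Qed.

Lemma pd_comm (g : R -> R -> R) (x y : R) : smooth2 g -> pdx (pdy g) x y = pdy (pdx g) x y.
Proof.
intros Hg.
assert (Hx := smooth2_dx g Hg); assert (Hy := smooth2_dy g Hg).
apply Schwarz.
- exists (mkposreal 1 Rlt_0_1); intros u v _ _; split; [|split; [|split]].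
  + apply (Hg nil u v).
  + apply (Hg nil u v).
  + apply (Hy nil u v).
  + apply (Hx nil u v).
- apply (cont2_2d (pdx (pdy g))), smooth2_cont, smooth2_dx, Hy.
- apply (cont2_2d (pdy (pdx g))), smooth2_cont, smooth2_dy, Hx.
Qed.

(** * The Gauss map *)

Lemma partials_ext (g gx gy gx' gy' : R -> R -> R) :
  has_partials g gx gy -> (forall x y, gx x y = gx' x y) -> (forall x y, gy x y = gy' x y) ->
  has_partials g gx' gy'.
Proof. intros H Hx Hy x y; rewrite <- Hx, <- Hy; apply H. Qed.

Lemma partials_opp (g gx gy : R -> R -> R) :
  has_partials g gx gy ->
  has_partials (fun x y => - g x y) (fun x y => - gx x y) (fun x y => - gy x y).
Proof.
intros Hg x y; split.
- apply (is_derive_opp (fun t => g t y)), Hg.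
- apply (is_derive_opp (fun t => g x t)), Hg.
Qed.

Lemma partials_minus (g h gx gy hx hy : R -> R -> R) :
  has_partials g gx gy -> has_partials h hx hy ->
  has_partials (fun x y => g x y - h x y) (fun x y => gx x y - hx x y) (fun x y => gy x y - hy x y).
Proof.
intros Hg Hh; apply (partials_plus g (fun x y => - h x y) gx gy
  (fun x y => - hx x y) (fun x y => - hy x y)); auto using partials_opp.
Qed.

Ltac smooth_arith :=
  repeat match goal with
  | |- smooth2 (fun x y => @?g x y + @?h x y) => apply (smooth2_plus g h)
  | |- smooth2 (fun x y => @?g x y - @?h x y) => apply (smooth2_minus g h)
  | |- smooth2 (fun x y => @?g x y * @?h x y) => apply (smooth2_mult g h)
  | |- smooth2 (fun x y => - @?g x y) => apply (smooth2_opp g)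
  | |- smooth2 (fun _ _ => ?c) => apply (smooth2_const c)
  end.

Ltac partials_arith :=
  repeat match goal with
  | |- has_partials (fun x y => @?g x y + @?h x y) _ _ => eapply (partials_plus g h)
  | |- has_partials (fun x y => @?g x y - @?h x y) _ _ => eapply (partials_minus g h)
  | |- has_partials (fun x y => @?g x y * @?h x y) _ _ => eapply (partials_mult g h)
  | |- has_partials (fun x y => - @?g x y) _ _ => eapply (partials_opp g)
  end.

(* Points of [R^4] are read as quaternions [u 0 + u 1 i + u 2 j + u 3 k], points of [R^3]
   as imaginary quaternions. *)
Definition lmul (g u : nat -> R) (i : nat) : R :=
  match i with
  | 0%nat => - (g 0%nat * u 1%nat) - g 1%nat * u 2%nat - g 2%nat * u 3%nat
  | 1%nat => g 0%nat * u 0%nat + g 1%nat * u 3%nat - g 2%nat * u 2%nat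
  | 2%nat => g 1%nat * u 0%nat + g 2%nat * u 1%nat - g 0%nat * u 3%nat
  | _ => g 2%nat * u 0%nat + g 0%nat * u 2%nat - g 1%nat * u 1%nat
  end.

(* [im_mul_conj v u] is the imaginary part of [v * conj u]. *)
Definition im_mul_conj (v u : nat -> R) (j : nat) : R :=
  match j with
  | 0%nat => v 1%nat * u 0%nat - v 0%nat * u 1%nat + v 3%nat * u 2%nat - v 2%nat * u 3%nat
  | 1%nat => v 2%nat * u 0%nat - v 0%nat * u 2%nat + v 1%nat * u 3%nat - v 3%nat * u 1%nat
  | _ => v 3%nat * u 0%nat - v 0%nat * u 3%nat + v 2%nat * u 1%nat - v 1%nat * u 2%nat
  end.

Definition dot3 (p q : nat -> R) : R :=
  p 0%nat * q 0%nat + p 1%nat * q 1%nat + p 2%nat * q 2%nat.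

Definition cross3 (p q : nat -> R) (j : nat) : R :=
  match j with
  | 0%nat => p 1%nat * q 2%nat - p 2%nat * q 1%nat
  | 1%nat => p 2%nat * q 0%nat - p 0%nat * q 2%nat
  | _ => p 0%nat * q 1%nat - p 1%nat * q 0%nat
  end.

Definition det3 (p q r : nat -> R) : R := dot3 (cross3 p q) r.

Definition dot4 (u v : nat -> R) : R := sum4 (fun i => u i * v i).

Definition tang_x (F : nat -> R -> R -> R) (x y : R) (i : nat) : R := pdx (F i) x y.
Definition tang_y (F : nat -> R -> R -> R) (x y : R) (i : nat) : R := pdy (F i) x y.

Definition plucker (F : nat -> R -> R -> R) (j : nat) (x y : R) : R :=
  im_mul_conj (tang_y F x y) (tang_x F x y) j.

(* One of the two factors of the Gauss map into [G(2,4) = S^2 x S^2]. *)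
Definition gauss (F : nat -> R -> R -> R) (j : nat) (x y : R) : R :=
  plucker F j x y / sqdet F x y.

Definition gaussv (F : nat -> R -> R -> R) (x y : R) (j : nat) : R := gauss F j x y.
Definition gaussx (F : nat -> R -> R -> R) (x y : R) (j : nat) : R := pdx (gauss F j) x y.
Definition gaussy (F : nat -> R -> R -> R) (x y : R) (j : nat) : R := pdy (gauss F j) x y.

Definition regular (F : nat -> R -> R -> R) : Prop :=
  smooth_map F /\ forall x y, 0 < detg F x y.

(** The quaternion [v * conj u] has norm |u| |v| and real part <u, v>, so its imaginary part carries
    exactly the Gram determinant. *)
Lemma gram_im_mul_conj (u v : nat -> R) :
  dot4 u u * dot4 v v - dot4 u v ^ 2 = dot3 (im_mul_conj v u) (im_mul_conj v u).
Proof. unfold dot4, sum4, dot3, im_mul_conj; ring. Qed.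

(** Write the imaginary part as v conj u - <u, v> and use conj u u = |u|^2. Divided by the area,
    left multiplication by it is the quarter turn in the oriented plane spanned by [u] and [v]. *)
Lemma lmul_im_mul_conj_l (u v : nat -> R) (i : nat) : (i < 4)%nat ->
  lmul (im_mul_conj v u) u i = dot4 u u * v i - dot4 u v * u i.
Proof.
intros Hi; destruct i as [|[|[|[|i]]]]; try lia; unfold dot4, sum4, lmul, im_mul_conj; ring.
Qed.

Lemma lmul_im_mul_conj_r (u v : nat -> R) (i : nat) : (i < 4)%nat ->
  lmul (im_mul_conj v u) v i = - (dot4 v v * u i - dot4 u v * v i).
Proof.
intros Hi; destruct i as [|[|[|[|i]]]]; try lia; unfold dot4, sum4, lmul, im_mul_conj; ring.
Qed.

Lemma g11_dot4 (F : nat -> R -> R -> R) (x y : R) :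
  g11 F x y = dot4 (tang_x F x y) (tang_x F x y).
Proof. reflexivity. Qed.

Lemma g12_dot4 (F : nat -> R -> R -> R) (x y : R) :
  g12 F x y = dot4 (tang_x F x y) (tang_y F x y).
Proof. reflexivity. Qed.

Lemma g22_dot4 (F : nat -> R -> R -> R) (x y : R) :
  g22 F x y = dot4 (tang_y F x y) (tang_y F x y).
Proof. reflexivity. Qed.

Lemma detg_plucker (F : nat -> R -> R -> R) (x y : R) :
  detg F x y = dot3 (fun j => plucker F j x y) (fun j => plucker F j x y).
Proof.
unfold detg, plucker; rewrite g11_dot4, g12_dot4, g22_dot4; apply gram_im_mul_conj.
Qed.

Lemma lmul_plucker_x (F : nat -> R -> R -> R) (x y : R) (i : nat) : (i < 4)%nat ->
  lmul (fun j => plucker F j x y) (tang_x F x y) i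
  = g11 F x y * tang_y F x y i - g12 F x y * tang_x F x y i.
Proof. unfold plucker; rewrite g11_dot4, g12_dot4; apply lmul_im_mul_conj_l. Qed.

Lemma lmul_plucker_y (F : nat -> R -> R -> R) (x y : R) (i : nat) : (i < 4)%nat ->
  lmul (fun j => plucker F j x y) (tang_y F x y) i
  = - (g22 F x y * tang_x F x y i - g12 F x y * tang_y F x y i).
Proof. unfold plucker; rewrite g22_dot4, g12_dot4; apply lmul_im_mul_conj_r. Qed.

Lemma smooth2_sum4 (h : nat -> R -> R -> R) :
  (forall i, (i < 4)%nat -> smooth2 (h i)) -> smooth2 (fun x y => sum4 (fun i => h i x y)).
Proof. intros H; unfold sum4; smooth_arith; apply H; lia. Qed.

Lemma smooth2_first_form (F : nat -> R -> R -> R) : smooth_map F ->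
  smooth2 (g11 F) /\ smooth2 (g12 F) /\ smooth2 (g22 F) /\ smooth2 (detg F).
Proof.
intros HF.
assert (H1 : smooth2 (g11 F)).
{ apply (smooth2_sum4 (fun i x y => pdx (F i) x y * pdx (F i) x y)); intros i Hi.
  apply smooth2_mult; apply smooth2_dx; auto. }
assert (H2 : smooth2 (g12 F)).
{ apply (smooth2_sum4 (fun i x y => pdx (F i) x y * pdy (F i) x y)); intros i Hi.
  apply smooth2_mult; auto using smooth2_dx, smooth2_dy. }
assert (H3 : smooth2 (g22 F)).
{ apply (smooth2_sum4 (fun i x y => pdy (F i) x y * pdy (F i) x y)); intros i Hi.
  apply smooth2_mult; apply smooth2_dy; auto. }
split; [|split; [|split]]; auto.
apply (smooth2_minus (fun x y => g11 F x y * g22 F x y) (fun x y => g12 F x y ^ 2)).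
- apply smooth2_mult; auto.
- simpl; smooth_arith; auto.
Qed.

Lemma smooth2_plucker (F : nat -> R -> R -> R) (j : nat) :
  smooth_map F -> smooth2 (plucker F j).
Proof.
intros HF; unfold plucker, im_mul_conj, tang_x, tang_y.
destruct j as [|[|j]];
  smooth_arith; match goal with
  | |- smooth2 (fun x y => pdx ?g x y) => apply (smooth2_dx g)
  | |- smooth2 (fun x y => pdy ?g x y) => apply (smooth2_dy g)
  end; apply HF; lia.
Qed.

Lemma sqdet_pos (F : nat -> R -> R -> R) (x y : R) : regular F -> 0 < sqdet F x y.
Proof. intros [_ H]; apply sqrt_lt_R0, H. Qed.

Lemma sqdet_sqr (F : nat -> R -> R -> R) (x y : R) :
  regular F -> sqdet F x y * sqdet F x y = detg F x y.
Proof. intros [_ H]; apply sqrt_sqrt, Rlt_le, H. Qed.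

Lemma smooth2_sqdet (F : nat -> R -> R -> R) : regular F -> smooth2 (sqdet F).
Proof.
intros [HF Hd]; apply (smooth2_sqrt (detg F)); auto.
apply smooth2_first_form, HF.
Qed.

Lemma smooth2_gauss (F : nat -> R -> R -> R) (j : nat) : regular F -> smooth2 (gauss F j).
Proof.
intros HF; apply smooth2_div.
- intros x y; apply Rgt_not_eq, sqdet_pos, HF.
- apply smooth2_plucker, HF.
- apply smooth2_sqdet, HF.
Qed.

Lemma gauss_unit (F : nat -> R -> R -> R) (x y : R) :
  regular F -> dot3 (gaussv F x y) (gaussv F x y) = 1.
Proof.
intros HF.
assert (H := sqdet_pos F x y HF).
assert (H2 := sqdet_sqr F x y HF).
rewrite detg_plucker in H2.
unfold gaussv, gauss, dot3 in *.
revert H H2; generalize (sqdet F x y) (plucker F 0 x y) (plucker F 1 x y) (plucker F 2 x y).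
intros r p0 p1 p2 H H2.
replace (p0 / r * (p0 / r) + p1 / r * (p1 / r) + p2 / r * (p2 / r))
  with ((p0 * p0 + p1 * p1 + p2 * p2) / (r * r)) by (field; lra).
rewrite <- H2; field; lra.
Qed.

Lemma partials_dot3 (p q px py qx qy : nat -> R -> R -> R) :
  (forall j, has_partials (p j) (px j) (py j)) ->
  (forall j, has_partials (q j) (qx j) (qy j)) ->
  has_partials (fun x y => dot3 (fun j => p j x y) (fun j => q j x y))
    (fun x y => dot3 (fun j => px j x y) (fun j => q j x y)
              + dot3 (fun j => p j x y) (fun j => qx j x y))
    (fun x y => dot3 (fun j => py j x y) (fun j => q j x y)
              + dot3 (fun j => p j x y) (fun j => qy j x y)).
Proof.
intros Hp Hq; unfold dot3.
eapply partials_ext.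
- partials_arith; auto.
- intros; simpl; ring.
- intros; simpl; ring.
Qed.

Lemma partials_det3 (p q r px py qx qy rx ry : nat -> R -> R -> R) :
  (forall j, has_partials (p j) (px j) (py j)) ->
  (forall j, has_partials (q j) (qx j) (qy j)) ->
  (forall j, has_partials (r j) (rx j) (ry j)) ->
  has_partials (fun x y => det3 (fun j => p j x y) (fun j => q j x y) (fun j => r j x y))
    (fun x y => det3 (fun j => px j x y) (fun j => q j x y) (fun j => r j x y)
              + det3 (fun j => p j x y) (fun j => qx j x y) (fun j => r j x y)
              + det3 (fun j => p j x y) (fun j => q j x y) (fun j => rx j x y))
    (fun x y => det3 (fun j => py j x y) (fun j => q j x y) (fun j => r j x y)
              + det3 (fun j => p j x y) (fun j => qy j x y) (fun j => r j x y)
              + det3 (fun j => p j x y) (fun j => q j x y) (fun j => ry j x y)).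
Proof.
intros Hp Hq Hr; unfold det3, dot3, cross3.
eapply partials_ext.
- partials_arith; auto.
- intros; simpl; ring.
- intros; simpl; ring.
Qed.

Lemma partials_lmul (p px py w wx wy : nat -> R -> R -> R) (i : nat) :
  (forall j, has_partials (p j) (px j) (py j)) ->
  (forall j, (j < 4)%nat -> has_partials (w j) (wx j) (wy j)) -> (i < 4)%nat ->
  has_partials (fun x y => lmul (fun j => p j x y) (fun j => w j x y) i)
    (fun x y => lmul (fun j => px j x y) (fun j => w j x y) i
              + lmul (fun j => p j x y) (fun j => wx j x y) i)
    (fun x y => lmul (fun j => py j x y) (fun j => w j x y) i
              + lmul (fun j => p j x y) (fun j => wy j x y) i).
Proof.
intros Hp Hw Hi.
assert (H0 := Hw 0%nat ltac:(lia)); assert (H1 := Hw 1%nat ltac:(lia));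
assert (H2 := Hw 2%nat ltac:(lia)); assert (H3 := Hw 3%nat ltac:(lia)).
assert (Q0 := Hp 0%nat); assert (Q1 := Hp 1%nat); assert (Q2 := Hp 2%nat).
clear Hp Hw.
destruct i as [|[|[|[|i]]]]; [..|lia]; unfold lmul; clear Hi.
all: eapply partials_ext.
all: try (partials_arith; eassumption).
all: intros; simpl; ring.
Qed.

Lemma gauss_partials (F : nat -> R -> R -> R) (j : nat) : regular F ->
  has_partials (gauss F j) (fun x y => gaussx F x y j) (fun x y => gaussy F x y j).
Proof. intros HF; apply smooth2_partials, smooth2_gauss, HF. Qed.

Lemma gauss_orth (F : nat -> R -> R -> R) (x y : R) : regular F ->
  dot3 (gaussv F x y) (gaussx F x y) = 0 /\ dot3 (gaussv F x y) (gaussy F x y) = 0.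
Proof.
intros HF.
assert (H := partials_dot3 _ _ _ _ _ _ (fun j => gauss_partials F j HF)
   (fun j => gauss_partials F j HF)).
assert (H1 : has_partials (fun x y => dot3 (fun j => gauss F j x y) (fun j => gauss F j x y))
   (fun _ _ => 0) (fun _ _ => 0)).
{ replace (fun x y => dot3 (fun j => gauss F j x y) (fun j => gauss F j x y))
    with (fun _ _ : R => 1).
  - intros u v; split; apply (is_derive_const 1).
  - do 2 (apply functional_extensionality; intros ?); symmetry; apply gauss_unit, HF. }
destruct (pd_ext_partials _ _ _ x y H) as [Ex Ey].
destruct (pd_ext_partials _ _ _ x y H1) as [Ex1 Ey1].
rewrite Ex1 in Ex; rewrite Ey1 in Ey.
unfold dot3, gaussv, gaussx, gaussy in *; split; lra.
Qed.

(* The two fluxes whose divergence is [sqdet * meancurv] are [G f_x] and [- G f_y]; since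
   [f_xy = f_yx], the second derivatives of [f] cancel. *)
Lemma meancurv_gauss (F : nat -> R -> R -> R) (x y : R) (i : nat) :
  regular F -> (i < 4)%nat ->
  meancurv F i x y =
  / sqdet F x y * (lmul (gaussy F x y) (tang_x F x y) i - lmul (gaussx F x y) (tang_y F x y) i).
Proof.
intros HF Hi.
assert (Hr : forall x y, sqdet F x y <> 0) by (intros; apply Rgt_not_eq, sqdet_pos, HF).
unfold meancurv; f_equal.
assert (Hl : forall c p u k, lmul (fun j => p j / c) u k = lmul p u k / c).
{ intros c p u k; unfold lmul, Rdiv; destruct k as [|[|[|k]]]; ring. }
assert (Ew : forall x y, detg F x y = sqdet F x y * sqdet F x y)
  by (intros; symmetry; apply sqdet_sqr, HF).
replace (fun x y => sqdet F x y *
   (g22 F x y / detg F x y * pdx (F i) x y + - g12 F x y / detg F x y * pdy (F i) x y))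
  with (fun x y => - lmul (fun j => gauss F j x y) (fun j => pdy (F j) x y) i).
2: { apply functional_extensionality; intros u; apply functional_extensionality; intros v.
     unfold gauss; rewrite Hl; fold (tang_y F u v).
     rewrite (lmul_plucker_y F u v i Hi), Ew; unfold tang_x, tang_y; field; apply Hr. }
replace (fun x y => sqdet F x y *
   (- g12 F x y / detg F x y * pdx (F i) x y + g11 F x y / detg F x y * pdy (F i) x y))
  with (fun x y => lmul (fun j => gauss F j x y) (fun j => pdx (F j) x y) i).
2: { apply functional_extensionality; intros u; apply functional_extensionality; intros v.
     unfold gauss; rewrite Hl; fold (tang_x F u v).
     rewrite (lmul_plucker_x F u v i Hi), Ew; unfold tang_x, tang_y; field; apply Hr. }
assert (Hy := partials_lmul _ _ _ _ _ _ i (fun j => gauss_partials F j HF)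
  (fun j Hj => smooth2_partials _ (smooth2_dy _ (proj1 HF j Hj))) Hi).
assert (Hx := partials_lmul _ _ _ _ _ _ i (fun j => gauss_partials F j HF)
  (fun j Hj => smooth2_partials _ (smooth2_dx _ (proj1 HF j Hj))) Hi).
apply partials_opp in Hy.
destruct (pd_ext_partials _ _ _ x y Hy) as [-> _].
destruct (pd_ext_partials _ _ _ x y Hx) as [_ ->].
assert (Hs : forall j, (j < 4)%nat -> pdx (pdy (F j)) x y = pdy (pdx (F j)) x y)
  by (intros j Hj; apply pd_comm, HF, Hj).
unfold gaussx, gaussy, tang_x, tang_y.
destruct i as [|[|[|[|i]]]]; try lia; unfold lmul; cbv beta; rewrite !Hs by lia; ring.
Qed.

(** In the induced metric the quarter turn J takes d/dx to (g11 d/dy - g12 d/dx) / [sqdet]. The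
    vector is [sqdet] times the difference of dG(J d/dx) and the cross product of G with dG(d/dx),
    hence measures the failure of the Cauchy-Riemann equation for the Gauss map into the round
    sphere. *)
Definition cr_defect (F : nat -> R -> R -> R) (x y : R) (j : nat) : R :=
  g11 F x y * gaussy F x y j - g12 F x y * gaussx F x y j
  - sqdet F x y * cross3 (gaussv F x y) (gaussx F x y) j.

(** Imaginary left factors scale norms, which gives the squares. The mixed term has a symmetric part
    <u, v> <a, b> and an alternating part, in which the imaginary part of v conj u meets the cross
    product of [a] and [b]. *)
Lemma lmul_norm (a b u v : nat -> R) :
  sum4 (fun i => (lmul b u i - lmul a v i) ^ 2) =
  dot4 u u * dot3 b b + dot4 v v * dot3 a a - 2 * dot4 u v * dot3 a b
  + 2 * det3 (im_mul_conj v u) a b.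
Proof. cbv [sum4 lmul dot4 dot3 det3 cross3 im_mul_conj]; ring. Qed.

Lemma g11_pos (F : nat -> R -> R -> R) (x y : R) : regular F -> 0 < g11 F x y.
Proof.
intros [_ H]; specialize (H x y).
assert (0 <= g11 F x y) by (unfold g11, sum4; nra).
assert (0 <= g22 F x y) by (unfold g22, sum4; nra).
unfold detg in H; nra.
Qed.

(** By [lmul_norm] the left-hand side is the Dirichlet density of the Gauss map plus twice its
    Jacobian. The Dirichlet density minus twice the Jacobian is a perfect square, as in the energy
    bound for maps to a sphere, and that square is the defect. *)
Lemma willmore_density (F : nat -> R -> R -> R) (x y : R) : regular F ->
  sum4 (fun i => meancurv F i x y ^ 2) * sqdet F x y =
  4 * det3 (gaussv F x y) (gaussx F x y) (gaussy F x y)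
  + dot3 (cr_defect F x y) (cr_defect F x y) / (g11 F x y * sqdet F x y).
Proof.
intros HF.
assert (Hr := sqdet_pos F x y HF).
assert (Hr2 := sqdet_sqr F x y HF).
assert (Hg := g11_pos F x y HF).
assert (Hu := gauss_unit F x y HF).
destruct (gauss_orth F x y HF) as [Ho _].
set (r := sqdet F x y) in *.
assert (E : sum4 (fun i => meancurv F i x y ^ 2) * r =
  sum4 (fun i => (lmul (gaussy F x y) (tang_x F x y) i - lmul (gaussx F x y) (tang_y F x y) i) ^ 2) / r).
{ unfold sum4; rewrite !(meancurv_gauss F x y) by (auto; lia).
  fold r; field; lra. }
rewrite E, lmul_norm.
assert (EP : det3 (im_mul_conj (tang_y F x y) (tang_x F x y)) (gaussx F x y) (gaussy F x y)
   = r * det3 (gaussv F x y) (gaussx F x y) (gaussy F x y)).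
{ assert (Ej : forall j, im_mul_conj (tang_y F x y) (tang_x F x y) j = r * gaussv F x y j).
  { intros j; unfold gaussv, gauss, plucker; fold r; field; lra. }
  unfold det3, dot3, cross3; rewrite !Ej; ring. }
rewrite EP.
rewrite <- g11_dot4, <- g12_dot4, <- g22_dot4.
assert (Ez : dot3 (cr_defect F x y) (cr_defect F x y) =
  g11 F x y * (g11 F x y * dot3 (gaussy F x y) (gaussy F x y)
     + g22 F x y * dot3 (gaussx F x y) (gaussx F x y)
     - 2 * g12 F x y * dot3 (gaussx F x y) (gaussy F x y)
     - 2 * (r * det3 (gaussv F x y) (gaussx F x y) (gaussy F x y)))).
{ unfold detg in Hr2.
  assert (E2 : g11 F x y * g22 F x y = r * r + g12 F x y ^ 2) by lra.
  transitivity (g11 F x y ^ 2 * dot3 (gaussy F x y) (gaussy F x y)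
     + g12 F x y ^ 2 * dot3 (gaussx F x y) (gaussx F x y)
     + r * r * (dot3 (gaussv F x y) (gaussv F x y) * dot3 (gaussx F x y) (gaussx F x y)
                - dot3 (gaussv F x y) (gaussx F x y) ^ 2)
     - 2 * g11 F x y * g12 F x y * dot3 (gaussx F x y) (gaussy F x y)
     - 2 * r * g11 F x y * det3 (gaussv F x y) (gaussx F x y) (gaussy F x y)).
  - unfold cr_defect; fold r; unfold det3, dot3, cross3; ring.
  - rewrite Hu, Ho. 
    replace (g11 F x y * (g11 F x y * dot3 (gaussy F x y) (gaussy F x y)
     + g22 F x y * dot3 (gaussx F x y) (gaussx F x y)
     - 2 * g12 F x y * dot3 (gaussx F x y) (gaussy F x y)
     - 2 * (r * det3 (gaussv F x y) (gaussx F x y) (gaussy F x y))))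
     with (g11 F x y ^ 2 * dot3 (gaussy F x y) (gaussy F x y)
     + (g11 F x y * g22 F x y) * dot3 (gaussx F x y) (gaussx F x y)
     - 2 * g11 F x y * g12 F x y * dot3 (gaussx F x y) (gaussy F x y)
     - 2 * g11 F x y * (r * det3 (gaussv F x y) (gaussx F x y) (gaussy F x y))) by ring.
    rewrite E2; ring. }
rewrite Ez; field; lra.
Qed.

(** * Periodic functions and uniform estimates *)

Definition periodic (a b : R) (g : R -> R -> R) : Prop :=
  forall x y, g (x + 1) y = g x y /\ g (x + a) (y + b) = g x y.

Lemma is_derive_shift (h : R -> R) (c x l : R) :
  is_derive h (x + c) l -> is_derive (fun t => h (t + c)) x l.
Proof.
intros H; replace l with (1 * l) by ring.
apply (is_derive_comp h (fun t => t + c)); auto.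
auto_derive; auto.
Qed.

Lemma periodic_pd (a b : R) (g : R -> R -> R) :
  smooth2 g -> periodic a b g -> periodic a b (pdx g) /\ periodic a b (pdy g).
Proof.
intros Hg Hp.
assert (H := smooth2_partials g Hg).
split; intros x y; split; symmetry; apply is_derive_unique.
- apply (is_derive_ext (fun t => g (t + 1) y)); [intros t; apply (Hp t y)|].
  exact (is_derive_shift (fun t => g t y) 1 x _ (proj1 (H (x + 1) y))).
- apply (is_derive_ext (fun t => g (t + a) (y + b))); [intros t; apply (Hp t y)|].
  exact (is_derive_shift (fun t => g t (y + b)) a x _ (proj1 (H (x + a) (y + b)))).
- apply (is_derive_ext (fun t => g (x + 1) t)); [intros t; apply (Hp x t)|].
  exact (proj2 (H (x + 1) y)).
- apply (is_derive_ext (fun t => g (x + a) (t + b))); [intros t; apply (Hp x t)|].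
  exact (is_derive_shift (fun t => g (x + a) t) b y _ (proj2 (H (x + a) (y + b)))).
Qed.

Lemma periodic_Z (a b : R) (g : R -> R -> R) (m n : Z) (x y : R) : periodic a b g ->
  g (x + IZR m + IZR n * a) (y + IZR n * b) = g x y.
Proof.
intros Hp.
assert (H1 : forall k x y, g (x + INR k) y = g x y).
{ induction k as [|k IH]; intros u v; [rewrite Rplus_0_r; auto|].
  rewrite S_INR, <- Rplus_assoc. rewrite (proj1 (Hp _ v)); apply IH. }
assert (H2 : forall k x y, g (x + INR k * a) (y + INR k * b) = g x y).
{ induction k as [|k IH]; intros u v; [simpl; rewrite !Rmult_0_l, !Rplus_0_r; auto|].
  rewrite S_INR.
  replace (u + (INR k + 1) * a) with (u + INR k * a + a) by ring.
  replace (v + (INR k + 1) * b) with (v + INR k * b + b) by ring.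
  rewrite (proj2 (Hp _ _)); apply IH. }
assert (H1' : forall m x y, g (x + IZR m) y = g x y).
{ intros k u v; destruct (Z_le_gt_dec 0 k).
  - rewrite <- (Z2Nat.id k), <- INR_IZR_INZ by auto; apply H1.
  - rewrite <- (H1 (Z.to_nat (- k)) (u + IZR k)). f_equal.
    rewrite INR_IZR_INZ, Z2Nat.id, opp_IZR by lia; ring. }
assert (H2' : forall m x y, g (x + IZR m * a) (y + IZR m * b) = g x y).
{ intros k u v; destruct (Z_le_gt_dec 0 k).
  - rewrite <- (Z2Nat.id k), <- INR_IZR_INZ by auto; apply H2.
  - rewrite <- (H2 (Z.to_nat (- k)) (u + IZR k * a)). 
    rewrite INR_IZR_INZ, Z2Nat.id, opp_IZR by lia; f_equal; ring. }
rewrite H2'; apply H1'.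
Qed.

Lemma lattice_reduce (a b x y : R) : 0 < b ->
  exists s t m n, 0 <= s < 1 /\ 0 <= t < 1 /\
    x = s + t * a + IZR m + IZR n * a /\ y = t * b + IZR n * b.
Proof.
intros Hb.
assert (Hfl : forall r, exists k, 0 <= r - IZR k < 1).
{ intros r; exists (Int_part r); destruct (base_Int_part r); lra. }
destruct (Hfl (y / b)) as [n Hn].
destruct (Hfl (x - (y / b) * a)) as [m Hm].
exists (x - (y / b) * a - IZR m), (y / b - IZR n), m, n.
repeat split; try lra; field; lra.
Qed.

(** The representative is chosen before the function, so one and the same point serves all periodic
    functions; this moves bounds from a compact piece to the whole plane. *)
Lemma periodic_rep (a b : R) (x y : R) : 0 < b ->
  exists s t, 0 <= s < 1 /\ 0 <= t < 1 /\
    forall g, periodic a b g -> g x y = g (s + t * a) (t * b).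
Proof.
intros Hb; destruct (lattice_reduce a b x y Hb) as (s & t & m & n & Hs & Ht & Ex & Ey).
exists s, t; split; [|split]; auto.
intros g Hg; rewrite Ex, Ey; apply periodic_Z, Hg.
Qed.

(** [K] is a set of base points and the constants are uniform over it, so that such bounds can be
    integrated over the torus. *)
Definition bigO (K : R -> R -> Prop) (n : nat) (h : R -> R -> R -> R) : Prop :=
  exists d C, 0 < d /\ 0 <= C /\ forall t x y, Rabs t < d -> K x y ->
    Rabs (h t x y) <= C * Rabs t ^ n.

Lemma bigO_plus K n g h : bigO K n g -> bigO K n h ->
  bigO K n (fun t x y => g t x y + h t x y).
Proof.
intros (d & C & Hd & HC & H) (d' & C' & Hd' & HC' & H').
exists (Rmin d d'), (C + C'); split; [apply Rmin_pos; auto|split; [lra|]].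
intros t x y Ht HK.
assert (T1 := H t x y (Rlt_le_trans _ _ _ Ht (Rmin_l _ _)) HK).
assert (T2 := H' t x y (Rlt_le_trans _ _ _ Ht (Rmin_r _ _)) HK).
apply Rle_trans with (1 := Rabs_triang _ _); lra.
Qed.

Lemma bigO_mult K m n g h : bigO K m g -> bigO K n h ->
  bigO K (m + n) (fun t x y => g t x y * h t x y).
Proof.
intros (d & C & Hd & HC & H) (d' & C' & Hd' & HC' & H').
exists (Rmin d d'), (C * C'); split; [apply Rmin_pos; auto|split; [nra|]].
intros t x y Ht HK.
assert (T1 := H t x y (Rlt_le_trans _ _ _ Ht (Rmin_l _ _)) HK).
assert (T2 := H' t x y (Rlt_le_trans _ _ _ Ht (Rmin_r _ _)) HK).
rewrite Rabs_mult, pow_add.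
replace (C * C' * (Rabs t ^ m * Rabs t ^ n)) with ((C * Rabs t ^ m) * (C' * Rabs t ^ n)) by ring.
apply Rmult_le_compat; auto using Rabs_pos.
Qed.

Lemma bigO_ext K n g h d : 0 < d ->
  (forall t x y, Rabs t < d -> K x y -> g t x y = h t x y) -> bigO K n g -> bigO K n h.
Proof.
intros Hd0 E (d' & C & Hd & HC & H).
exists (Rmin d d'), C; split; [apply Rmin_pos; auto|split; auto].
intros t x y Ht HK.
rewrite <- E; auto.
- apply H; auto. apply Rlt_le_trans with (1 := Ht), Rmin_r.
- apply Rlt_le_trans with (1 := Ht), Rmin_l.
Qed.

Lemma bigO_weaken K n h : bigO K (S n) h -> bigO K n h.
Proof.
intros (d & C & Hd & HC & H).
exists (Rmin d 1), C; split; [apply Rmin_pos; lra|split; auto].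
intros t x y Ht HK.
assert (T1 := H t x y (Rlt_le_trans _ _ _ Ht (Rmin_l _ _)) HK).
assert (T2 := Rlt_le_trans _ _ _ Ht (Rmin_r _ _)).
apply Rle_trans with (1 := T1), Rmult_le_compat_l; auto.
simpl. assert (0 <= Rabs t ^ n) by (apply pow_le, Rabs_pos). nra.
Qed.

Lemma bigO_scal K n c h : bigO K n h -> bigO K n (fun t x y => c * h t x y).
Proof.
intros H; apply (bigO_mult K 0 n (fun _ _ _ => c)); auto.
exists 1, (Rabs c); split; [lra|split; [apply Rabs_pos|]].
intros; simpl; lra.
Qed.

Lemma bigO_id K g : bigO K 0 g -> bigO K 1 (fun t x y => t * g t x y).
Proof.
intros H; apply (bigO_mult K 1 0 (fun t _ _ => t)); auto.
exists 1, 1; split; [lra|split; [lra|]]; intros; simpl; lra.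
Qed.

(** Lipschitz at t = 0, uniformly over [K]. Quadratic error terms come from products of two such
    first-order differences, and the class is closed under all the operations that build the Gauss
    map and its partials. *)
Definition lip (K : R -> R -> Prop) (h : R -> R -> R -> R) : Prop :=
  bigO K 0 (fun _ x y => h 0 x y) /\ bigO K 1 (fun t x y => h t x y - h 0 x y).

Lemma lip_bounded K h : lip K h -> bigO K 0 h.
Proof.
intros [H0 H1].
apply (bigO_ext K 0 (fun t x y => h 0 x y + (h t x y - h 0 x y)) h 1 Rlt_0_1).
- intros; ring.
- apply bigO_plus; auto. apply bigO_weaken; auto.
Qed.

Lemma lip_plus K g h : lip K g -> lip K h -> lip K (fun t x y => g t x y + h t x y).
Proof.
intros [G0 G1] [H0 H1]; split.
- apply (bigO_plus K 0 (fun _ x y => g 0 x y) (fun _ x y => h 0 x y)); auto.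
- apply (bigO_ext K 1 (fun t x y => (g t x y - g 0 x y) + (h t x y - h 0 x y)) _ 1 Rlt_0_1).
  + intros; ring.
  + apply bigO_plus; auto.
Qed.

Lemma lip_mult K g h : lip K g -> lip K h -> lip K (fun t x y => g t x y * h t x y).
Proof.
intros Hg Hh; generalize Hg Hh; intros [G0 G1] [H0 H1]; split.
- apply (bigO_mult K 0 0 (fun _ x y => g 0 x y) (fun _ x y => h 0 x y)); auto.
- apply (bigO_ext K 1 (fun t x y => (g t x y - g 0 x y) * h t x y
      + g 0 x y * (h t x y - h 0 x y)) _ 1 Rlt_0_1).
  + intros; ring.
  + apply bigO_plus.
    * apply (bigO_mult K 1 0); auto. apply lip_bounded, Hh.
    * apply (bigO_mult K 0 1 (fun _ x y => g 0 x y)); auto.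
Qed.

Lemma lip_const K c : lip K (fun _ _ _ => c).
Proof.
split.
- exists 1, (Rabs c); split; [lra|split; [apply Rabs_pos|]]; intros; simpl; lra.
- exists 1, 0; split; [lra|split; [lra|]]; intros; rewrite Rminus_diag, Rabs_R0; simpl; lra.
Qed.

Lemma lip_opp K h : lip K h -> lip K (fun t x y => - h t x y).
Proof.
intros H.
replace (fun t x y => - h t x y) with (fun t x y => -1 * h t x y).
- apply (lip_mult K (fun _ _ _ => -1)); auto using lip_const.
- do 3 (apply functional_extensionality; intros ?); ring.
Qed.

Lemma lip_minus K g h : lip K g -> lip K h -> lip K (fun t x y => g t x y - h t x y).
Proof. intros Hg Hh; apply (lip_plus K g (fun t x y => - h t x y)); auto using lip_opp. Qed.

Lemma lip_ext K g h d : 0 < d ->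
  (forall t x y, Rabs t < d -> K x y -> g t x y = h t x y) -> lip K g -> lip K h.
Proof.
intros Hd E [G0 G1].
assert (E0 : forall x y, K x y -> g 0 x y = h 0 x y)
  by (intros; apply E; auto; rewrite Rabs_R0; auto).
split.
- apply (bigO_ext K 0 (fun _ x y => g 0 x y) _ d); auto.
- apply (bigO_ext K 1 (fun t x y => g t x y - g 0 x y) _ d); auto.
  intros t x y Ht HK; rewrite E, E0; auto.
Qed.

Definition bounded_below (K : R -> R -> Prop) (h : R -> R -> R -> R) : Prop :=
  exists c, 0 < c /\ exists d, 0 < d /\ forall t x y, Rabs t < d -> K x y -> c <= h t x y.

Lemma lip_bounded_below K h c : 0 < c -> (forall x y, K x y -> c <= h 0 x y) -> lip K h ->
  bounded_below K h.
Proof.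
intros Hc H0 [_ (d & C & Hd & HC & H)].
exists (c / 2); split; [lra|].
exists (Rmin d (c / (2 * (C + 1)))); split.
- apply Rmin_pos; auto. apply Rdiv_lt_0_compat; lra.
- intros t x y Ht HK.
  assert (T := H t x y (Rlt_le_trans _ _ _ Ht (Rmin_l _ _)) HK).
  assert (T2 := Rlt_le_trans _ _ _ Ht (Rmin_r _ _)).
  apply Rlt_div_r in T2; [|lra].
  specialize (H0 x y HK); simpl in T; rewrite Rmult_1_r in T.
  assert (T3 := Rle_abs (- (h t x y - h 0 x y))); rewrite Rabs_Ropp in T3.
  assert (0 <= Rabs t) by apply Rabs_pos.
  nra.
Qed.

Lemma lip_inv K h : bounded_below K h -> lip K h -> lip K (fun t x y => / h t x y).
Proof.
intros (c & Hc & d & Hd & Hb) Hh; generalize Hh; intros [H0 H1].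
assert (B : bigO K 0 (fun t x y => / h t x y)).
{ exists d, (/ c); split; auto; split; [left; apply Rinv_0_lt_compat; auto|].
  intros t x y Ht HK; specialize (Hb t x y Ht HK); simpl; rewrite Rmult_1_r.
  rewrite Rabs_pos_eq by (left; apply Rinv_0_lt_compat; lra).
  apply Rinv_le_contravar; lra. }
assert (B0 : bigO K 0 (fun _ x y => / h 0 x y)).
{ destruct B as (d' & C & Hd' & HC & B).
  exists 1, C; split; [lra|split; auto].
  intros t x y _ HK. rewrite pow_O in *.
  specialize (B 0 x y); rewrite pow_O in B; apply B; auto; rewrite Rabs_R0; auto. }
split; auto.
apply (bigO_ext K 1 (fun t x y => (-1 * (h t x y - h 0 x y)) * (/ h t x y * / h 0 x y)) _ d Hd).
- intros t x y Ht HK.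
  assert (b1 := Hb t x y Ht HK).
  assert (b2 := Hb 0 x y ltac:(rewrite Rabs_R0; auto) HK).
  field; lra.
- apply (bigO_mult K 1 0).
  + apply bigO_scal; auto.
  + apply (bigO_mult K 0 0 (fun t x y => / h t x y) (fun _ x y => / h 0 x y)); auto.
Qed.

Lemma lip_sqrt K h : bounded_below K h -> lip K h -> lip K (fun t x y => sqrt (h t x y)).
Proof.
intros (c & Hc & d & Hd & Hb) Hh; generalize Hh; intros [H0 H1].
split.
- destruct H0 as (d' & C & Hd' & HC & B).
  exists d', (1 + C); split; auto; split; [lra|].
  intros t x y Ht HK; simpl; rewrite Rmult_1_r.
  specialize (B t x y Ht HK); simpl in B; rewrite Rmult_1_r in B.
  assert (b := Hb 0 x y ltac:(rewrite Rabs_R0; auto) HK).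
  rewrite Rabs_pos_eq by apply sqrt_pos. rewrite Rabs_pos_eq in B by lra.
  assert (Hs := sqrt_sqrt (h 0 x y) ltac:(lra)).
  assert (0 <= sqrt (h 0 x y)) by apply sqrt_pos. nra.
- assert (Hpos : forall u, c <= u -> 0 < sqrt u) by (intros; apply sqrt_lt_R0; lra).
  (* Conjugate factor: the difference of the roots is the difference of the radicands over the sum
     of the roots, and that sum is at least sqrt c. *)
  apply (bigO_ext K 1 (fun t x y => (h t x y - h 0 x y) * / (sqrt (h t x y) + sqrt (h 0 x y))) _ d Hd).
  + intros t x y Ht HK.
    assert (b1 := Hb t x y Ht HK).
    assert (b2 := Hb 0 x y ltac:(rewrite Rabs_R0; auto) HK).
    assert (p1 := Hpos _ b1); assert (p2 := Hpos _ b2).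
    rewrite <- (sqrt_sqrt (h t x y)) at 1 by lra.
    rewrite <- (sqrt_sqrt (h 0 x y)) at 1 by lra.
    field; lra.
  + apply (bigO_mult K 1 0); auto.
    exists d, (/ sqrt c); split; auto; split; [left; apply Rinv_0_lt_compat, Hpos; lra|].
    intros t x y Ht HK; simpl; rewrite Rmult_1_r.
    assert (b1 := Hb t x y Ht HK).
    assert (p2 := sqrt_pos (h 0 x y)).
    assert (p1 := Hpos c (Rle_refl c)).
    assert (p3 := sqrt_le_1_alt _ _ b1).
    rewrite Rabs_pos_eq by (left; apply Rinv_0_lt_compat; lra).
    apply Rinv_le_contravar; lra.
Qed.

Lemma lip_affine K g h : bigO K 0 (fun _ => g) -> bigO K 0 (fun _ => h) ->
  lip K (fun t x y => g x y + t * h x y).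
Proof.
intros Hg Hh; split.
- apply (bigO_ext K 0 (fun _ => g) _ 1 Rlt_0_1); auto; intros; ring.
- apply (bigO_ext K 1 (fun t x y => t * h x y) _ 1 Rlt_0_1); [intros; ring|].
  apply (bigO_id K (fun _ => h)); auto.
Qed.

Ltac lip_arith :=
  repeat match goal with
  | |- lip ?K (fun t x y => @?g t x y + @?h t x y) => apply (lip_plus K g h)
  | |- lip ?K (fun t x y => @?g t x y - @?h t x y) => apply (lip_minus K g h)
  | |- lip ?K (fun t x y => @?g t x y * @?h t x y) => apply (lip_mult K g h)
  | |- lip ?K (fun t x y => - @?g t x y) => apply (lip_opp K g)
  end.

Lemma lip_dot3 K (p q : R -> R -> R -> nat -> R) :
  (forall j, lip K (fun t x y => p t x y j)) -> (forall j, lip K (fun t x y => q t x y j)) ->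
  lip K (fun t x y => dot3 (p t x y) (q t x y)).
Proof. intros; unfold dot3; lip_arith; auto. Qed.

Lemma partials_im_mul_conj (v vx vy u ux uy : nat -> R -> R -> R) (j : nat) :
  (forall i, (i < 4)%nat -> has_partials (v i) (vx i) (vy i)) ->
  (forall i, (i < 4)%nat -> has_partials (u i) (ux i) (uy i)) ->
  has_partials (fun x y => im_mul_conj (fun i => v i x y) (fun i => u i x y) j)
    (fun x y => im_mul_conj (fun i => vx i x y) (fun i => u i x y) j
              + im_mul_conj (fun i => v i x y) (fun i => ux i x y) j)
    (fun x y => im_mul_conj (fun i => vy i x y) (fun i => u i x y) j
              + im_mul_conj (fun i => v i x y) (fun i => uy i x y) j).
Proof.
intros Hv Hu.
assert (H0 := Hv 0%nat ltac:(lia)); assert (H1 := Hv 1%nat ltac:(lia));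
assert (H2 := Hv 2%nat ltac:(lia)); assert (H3 := Hv 3%nat ltac:(lia)).
assert (Q0 := Hu 0%nat ltac:(lia)); assert (Q1 := Hu 1%nat ltac:(lia));
assert (Q2 := Hu 2%nat ltac:(lia)); assert (Q3 := Hu 3%nat ltac:(lia)).
clear Hv Hu.
destruct j as [|[|j]]; unfold im_mul_conj.
all: eapply partials_ext.
all: try (partials_arith; eassumption).
all: intros; simpl; ring.
Qed.

Definition pluckerx (F : nat -> R -> R -> R) (x y : R) (j : nat) : R :=
  im_mul_conj (fun i => pdx (pdy (F i)) x y) (fun i => pdx (F i) x y) j
  + im_mul_conj (fun i => pdy (F i) x y) (fun i => pdx (pdx (F i)) x y) j.

Definition pluckery (F : nat -> R -> R -> R) (x y : R) (j : nat) : R :=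
  im_mul_conj (fun i => pdy (pdy (F i)) x y) (fun i => pdx (F i) x y) j
  + im_mul_conj (fun i => pdy (F i) x y) (fun i => pdy (pdx (F i)) x y) j.

Lemma partials_plucker (F : nat -> R -> R -> R) (j : nat) : smooth_map F ->
  has_partials (plucker F j) (fun x y => pluckerx F x y j) (fun x y => pluckery F x y j).
Proof.
intros HF.
apply (partials_im_mul_conj (fun i => pdy (F i)) (fun i => pdx (pdy (F i))) (fun i => pdy (pdy (F i)))
  (fun i => pdx (F i)) (fun i => pdx (pdx (F i))) (fun i => pdy (pdx (F i)))).
- intros i Hi; apply smooth2_partials, smooth2_dy, HF, Hi.
- intros i Hi; apply smooth2_partials, smooth2_dx, HF, Hi.
Qed.

Lemma partials_inv (g gx gy : R -> R -> R) : (forall x y, g x y <> 0) ->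
  has_partials g gx gy ->
  has_partials (fun x y => / g x y) (fun x y => - gx x y * (/ g x y * / g x y))
    (fun x y => - gy x y * (/ g x y * / g x y)).
Proof.
intros Hnz Hg x y; split.
- replace (- gx x y * (/ g x y * / g x y)) with (- gx x y / (g x y) ^ 2) by (field; auto).
  exact (is_derive_inv (fun t => g t y) x _ (proj1 (Hg x y)) (Hnz x y)).
- replace (- gy x y * (/ g x y * / g x y)) with (- gy x y / (g x y) ^ 2) by (field; auto).
  exact (is_derive_inv (fun t => g x t) y _ (proj2 (Hg x y)) (Hnz x y)).
Qed.

Lemma partials_sqrt (g gx gy : R -> R -> R) : (forall x y, 0 < g x y) ->
  has_partials g gx gy ->
  has_partials (fun x y => sqrt (g x y)) (fun x y => gx x y * (/ 2 * / sqrt (g x y)))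
    (fun x y => gy x y * (/ 2 * / sqrt (g x y))).
Proof.
intros Hpos Hg x y.
assert (Hs : sqrt (g x y) <> 0) by (apply Rgt_not_eq, sqrt_lt_R0, Hpos).
split.
- replace (gx x y * (/ 2 * / sqrt (g x y))) with (gx x y / (2 * sqrt (g x y))) by (field; auto).
  exact (is_derive_sqrt (fun t => g t y) x _ (proj1 (Hg x y)) (Hpos x y)).
- replace (gy x y * (/ 2 * / sqrt (g x y))) with (gy x y / (2 * sqrt (g x y))) by (field; auto).
  exact (is_derive_sqrt (fun t => g x t) y _ (proj2 (Hg x y)) (Hpos x y)).
Qed.

Definition pluckerv (F : nat -> R -> R -> R) (x y : R) (j : nat) : R := plucker F j x y.

(** This is the derivative of P / |P|, as [sqdet] is the norm of the Plucker vector P. The formula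
    involves only first and second partials of [F], which are affine in the parameter of a
    variation, so the Lipschitz calculus applies to it. *)
Lemma gauss_derivatives (F : nat -> R -> R -> R) (x y : R) (j : nat) : regular F ->
  gaussx F x y j = pluckerx F x y j * / sqdet F x y
    - pluckerv F x y j * dot3 (pluckerv F x y) (pluckerx F x y)
      * (/ sqdet F x y * / sqdet F x y * / sqdet F x y)
  /\
  gaussy F x y j = pluckery F x y j * / sqdet F x y
    - pluckerv F x y j * dot3 (pluckerv F x y) (pluckery F x y)
      * (/ sqdet F x y * / sqdet F x y * / sqdet F x y).
Proof.
intros HF.
assert (Hr : forall x y, sqdet F x y <> 0) by (intros; apply Rgt_not_eq, sqdet_pos, HF).
assert (HP := fun j => partials_plucker F j (proj1 HF)).
assert (HD := partials_dot3 _ _ _ _ _ _ HP HP).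
assert (ED : (fun x y => dot3 (fun j => plucker F j x y) (fun j => plucker F j x y)) = detg F).
{ do 2 (apply functional_extensionality; intros ?); symmetry; apply detg_plucker. }
rewrite ED in HD.
assert (HS := partials_sqrt (detg F) _ _ (proj2 HF) HD).
fold (sqdet F) in HS.
change (fun x y => sqrt (detg F x y)) with (sqdet F) in HS.
assert (HG := partials_mult _ _ _ _ _ _ (HP j) (partials_inv _ _ _ Hr HS)
   : has_partials (gauss F j) _ _).
destruct (pd_ext_partials _ _ _ x y HG) as [Ex Ey].
unfold gaussx, gaussy; rewrite Ex, Ey; cbv beta.
change (sqrt (detg F x y)) with (sqdet F x y).
assert (H1 := Hr x y).
clear - H1.
unfold pluckerv, dot3.
split;
[ generalize (pluckerx F x y j) (pluckerx F x y 0) (pluckerx F x y 1) (pluckerx F x y 2)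
| generalize (pluckery F x y j) (pluckery F x y 0) (pluckery F x y 1) (pluckery F x y 2) ];
revert H1;
generalize (sqdet F x y) (plucker F j x y) (plucker F 0 x y) (plucker F 1 x y) (plucker F 2 x y);
intros; field; auto.
Qed.

Definition fam (f phi : nat -> R -> R -> R) (t : R) : nat -> R -> R -> R :=
  fun i x y => f i x y + t * phi i x y.

Lemma fam_0 f phi : fam f phi 0 = f.
Proof. unfold fam; do 3 (apply functional_extensionality; intros ?); ring. Qed.

Lemma pd_affine (g h : R -> R -> R) (t : R) : smooth2 g -> smooth2 h ->
  pdx (fun x y => g x y + t * h x y) = (fun x y => pdx g x y + t * pdx h x y) /\
  pdy (fun x y => g x y + t * h x y) = (fun x y => pdy g x y + t * pdy h x y).
Proof.
intros Hg Hh.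
assert (H : has_partials (fun x y => g x y + t * h x y) (fun x y => pdx g x y + t * pdx h x y)
  (fun x y => pdy g x y + t * pdy h x y)).
{ apply (partials_plus g (fun x y => t * h x y)); [apply smooth2_partials, Hg|].
  eapply partials_ext.
  - apply (partials_mult (fun _ _ => t) h (fun _ _ => 0) (fun _ _ => 0)).
    + intros x y; split; apply (is_derive_const t).
    + apply smooth2_partials, Hh.
  - intros; simpl; ring.
  - intros; simpl; ring. }
destruct (has_partials_eq _ _ _ H) as [-> ->]; auto.
Qed.

Lemma smooth_fam f phi t : smooth_map f -> smooth_map phi -> smooth_map (fam f phi t).
Proof.
intros Hf Hp i Hi; apply (smooth2_plus (f i) (fun x y => t * phi i x y)); [apply Hf, Hi|].
apply (smooth2_mult (fun _ _ => t)); [apply smooth2_const|apply Hp, Hi].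
Qed.

(** A rectangle containing the fundamental parallelogram: s + t a <= 2 for 0 <= a <= 1. The
    compactness bound [cont2_bounded] is stated for rectangles. *)
Definition rect (b : R) (x y : R) : Prop := 0 <= x <= 2 /\ 0 <= y <= b.

Lemma cont2_bigO b g : cont2 g -> bigO (rect b) 0 (fun _ => g).
Proof.
intros Hg; destruct (cont2_bounded g 0 2 0 b Hg) as [M [HM H]].
exists 1, M; split; [lra|split; auto].
intros t x y _ [Hx Hy]; simpl; rewrite Rmult_1_r; auto.
Qed.

Lemma lip_smooth_affine b g h : smooth2 g -> smooth2 h ->
  lip (rect b) (fun t x y => g x y + t * h x y).
Proof. intros; apply lip_affine; apply cont2_bigO, smooth2_cont; auto. Qed.

Lemma lip_jets b f phi i : smooth_map f -> smooth_map phi -> (i < 4)%nat ->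
  lip (rect b) (fun t x y => pdx (fam f phi t i) x y) /\
  lip (rect b) (fun t x y => pdy (fam f phi t i) x y) /\
  lip (rect b) (fun t x y => pdx (pdx (fam f phi t i)) x y) /\
  lip (rect b) (fun t x y => pdy (pdx (fam f phi t i)) x y) /\
  lip (rect b) (fun t x y => pdx (pdy (fam f phi t i)) x y) /\
  lip (rect b) (fun t x y => pdy (pdy (fam f phi t i)) x y).
Proof.
intros Hf Hp Hi; specialize (Hf i Hi); specialize (Hp i Hi).
assert (E := fun t => pd_affine (f i) (phi i) t Hf Hp).
change (forall t, pdx (fam f phi t i) = (fun x y => pdx (f i) x y + t * pdx (phi i) x y) /\
   pdy (fam f phi t i) = (fun x y => pdy (f i) x y + t * pdy (phi i) x y)) in E.
assert (fx := smooth2_dx _ Hf); assert (fy := smooth2_dy _ Hf).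
assert (px := smooth2_dx _ Hp); assert (py := smooth2_dy _ Hp).
assert (Ex := fun t => pd_affine _ _ t fx px).
assert (Ey := fun t => pd_affine _ _ t fy py).
split; [|split; [|split; [|split; [|split]]]].
- apply (lip_ext _ (fun t x y => pdx (f i) x y + t * pdx (phi i) x y) _ 1 Rlt_0_1).
  + intros t x y _ _; rewrite (proj1 (E t)); auto.
  + apply lip_smooth_affine; auto.
- apply (lip_ext _ (fun t x y => pdy (f i) x y + t * pdy (phi i) x y) _ 1 Rlt_0_1).
  + intros t x y _ _; rewrite (proj2 (E t)); auto.
  + apply lip_smooth_affine; auto.
- apply (lip_ext _ (fun t x y => pdx (pdx (f i)) x y + t * pdx (pdx (phi i)) x y) _ 1 Rlt_0_1).
  + intros t x y _ _; rewrite (proj1 (E t)), (proj1 (Ex t)); auto.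
  + apply lip_smooth_affine; auto using smooth2_dx, smooth2_dy.
- apply (lip_ext _ (fun t x y => pdy (pdx (f i)) x y + t * pdy (pdx (phi i)) x y) _ 1 Rlt_0_1).
  + intros t x y _ _; rewrite (proj1 (E t)), (proj2 (Ex t)); auto.
  + apply lip_smooth_affine; auto using smooth2_dx, smooth2_dy.
- apply (lip_ext _ (fun t x y => pdx (pdy (f i)) x y + t * pdx (pdy (phi i)) x y) _ 1 Rlt_0_1).
  + intros t x y _ _; rewrite (proj2 (E t)), (proj1 (Ey t)); auto.
  + apply lip_smooth_affine; auto using smooth2_dx, smooth2_dy.
- apply (lip_ext _ (fun t x y => pdy (pdy (f i)) x y + t * pdy (pdy (phi i)) x y) _ 1 Rlt_0_1).
  + intros t x y _ _; rewrite (proj2 (E t)), (proj2 (Ey t)); auto.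
  + apply lip_smooth_affine; auto using smooth2_dx, smooth2_dy.
Qed.

Lemma lip_im_mul_conj K (v u : nat -> R -> R -> R -> R) (j : nat) :
  (forall i, (i < 4)%nat -> lip K (v i)) -> (forall i, (i < 4)%nat -> lip K (u i)) ->
  lip K (fun t x y => im_mul_conj (fun i => v i t x y) (fun i => u i t x y) j).
Proof.
intros Hv Hu.
destruct j as [|[|j]]; unfold im_mul_conj; lip_arith;
  match goal with
  | |- lip _ (fun t x y => v _ t x y) => apply Hv; lia
  | |- lip _ (fun t x y => u _ t x y) => apply Hu; lia
  end.
Qed.

Lemma lip_plucker b f phi j : smooth_map f -> smooth_map phi ->
  lip (rect b) (fun t x y => pluckerv (fam f phi t) x y j) /\
  lip (rect b) (fun t x y => pluckerx (fam f phi t) x y j) /\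
  lip (rect b) (fun t x y => pluckery (fam f phi t) x y j).
Proof.
intros Hf Hp.
assert (J := fun i Hi => lip_jets b f phi i Hf Hp Hi).
assert (Jx : forall i, (i < 4)%nat -> lip (rect b) (fun t x y => pdx (fam f phi t i) x y))
  by (intros i Hi; apply (J i Hi)).
assert (Jy : forall i, (i < 4)%nat -> lip (rect b) (fun t x y => pdy (fam f phi t i) x y))
  by (intros i Hi; apply (J i Hi)).
split; [|split].
- apply (lip_im_mul_conj _ (fun i t x y => pdy (fam f phi t i) x y)
    (fun i t x y => pdx (fam f phi t i) x y)); auto.
- unfold pluckerx.
  apply (lip_plus (rect b)
    (fun t x y => im_mul_conj (fun i => pdx (pdy (fam f phi t i)) x y) (fun i => pdx (fam f phi t i) x y) j)
    (fun t x y => im_mul_conj (fun i => pdy (fam f phi t i) x y) (fun i => pdx (pdx (fam f phi t i)) x y) j)).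
  + apply (lip_im_mul_conj _ (fun i t x y => pdx (pdy (fam f phi t i)) x y)
     (fun i t x y => pdx (fam f phi t i) x y)); auto; intros i Hi; apply (J i Hi).
  + apply (lip_im_mul_conj _ (fun i t x y => pdy (fam f phi t i) x y)
     (fun i t x y => pdx (pdx (fam f phi t i)) x y)); auto; intros i Hi; apply (J i Hi).
- unfold pluckery.
  apply (lip_plus (rect b)
    (fun t x y => im_mul_conj (fun i => pdy (pdy (fam f phi t i)) x y) (fun i => pdx (fam f phi t i) x y) j)
    (fun t x y => im_mul_conj (fun i => pdy (fam f phi t i) x y) (fun i => pdy (pdx (fam f phi t i)) x y) j)).
  + apply (lip_im_mul_conj _ (fun i t x y => pdy (pdy (fam f phi t i)) x y)
     (fun i t x y => pdx (fam f phi t i) x y)); auto; intros i Hi; apply (J i Hi).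
  + apply (lip_im_mul_conj _ (fun i t x y => pdy (fam f phi t i) x y)
     (fun i t x y => pdy (pdx (fam f phi t i)) x y)); auto; intros i Hi; apply (J i Hi).
Qed.

Lemma periodic_first_form (a b : R) (F : nat -> R -> R -> R) :
  smooth_map F -> (forall i, (i < 4)%nat -> periodic a b (F i)) ->
  periodic a b (detg F) /\ forall j, periodic a b (plucker F j).
Proof.
intros HF HP.
assert (Px : forall i, (i < 4)%nat -> periodic a b (pdx (F i)))
  by (intros i Hi; apply (periodic_pd a b (F i)); auto).
assert (Py : forall i, (i < 4)%nat -> periodic a b (pdy (F i)))
  by (intros i Hi; apply (periodic_pd a b (F i)); auto).
assert (E : forall j, periodic a b (plucker F j)).
{ assert (X0 := Px 0%nat ltac:(lia)); assert (X1 := Px 1%nat ltac:(lia));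
  assert (X2 := Px 2%nat ltac:(lia)); assert (X3 := Px 3%nat ltac:(lia)).
  assert (Y0 := Py 0%nat ltac:(lia)); assert (Y1 := Py 1%nat ltac:(lia));
  assert (Y2 := Py 2%nat ltac:(lia)); assert (Y3 := Py 3%nat ltac:(lia)).
  intros j x y; unfold plucker, im_mul_conj, tang_x, tang_y; split; destruct j as [|[|j]].
  1-3: rewrite (proj1 (X0 x y)), (proj1 (X1 x y)), (proj1 (X2 x y)), (proj1 (X3 x y)),
    (proj1 (Y0 x y)), (proj1 (Y1 x y)), (proj1 (Y2 x y)), (proj1 (Y3 x y)); reflexivity.
  all: rewrite (proj2 (X0 x y)), (proj2 (X1 x y)), (proj2 (X2 x y)), (proj2 (X3 x y)),
    (proj2 (Y0 x y)), (proj2 (Y1 x y)), (proj2 (Y2 x y)), (proj2 (Y3 x y)); reflexivity. }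
split; auto.
intros x y; rewrite !detg_plucker; unfold dot3.
rewrite !(proj1 (E _ x y)), !(proj2 (E _ x y)); auto.
Qed.

Lemma periodic_gauss (a b : R) (F : nat -> R -> R -> R) (j : nat) :
  smooth_map F -> (forall i, (i < 4)%nat -> periodic a b (F i)) -> periodic a b (gauss F j).
Proof.
intros HF HP; destruct (periodic_first_form a b F HF HP) as [Hd Hp].
intros x y; unfold gauss, sqdet.
rewrite (proj1 (Hd x y)), (proj2 (Hd x y)), (proj1 (Hp j x y)), (proj2 (Hp j x y)); auto.
Qed.

(** * The first variation *)

Lemma bigO_det3 K m n k (p q r : R -> R -> R -> nat -> R) :
  (forall j, bigO K m (fun t x y => p t x y j)) ->
  (forall j, bigO K n (fun t x y => q t x y j)) ->
  (forall j, bigO K k (fun t x y => r t x y j)) ->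
  bigO K (m + n + k) (fun t x y => det3 (p t x y) (q t x y) (r t x y)).
Proof.
intros Hp Hq Hr.
assert (Ht : forall i j l, bigO K (m + n + k) (fun t x y => p t x y i * q t x y j * r t x y l)).
{ intros i j l; apply (bigO_mult K (m + n) k (fun t x y => p t x y i * q t x y j)); auto.
  apply (bigO_mult K m n (fun t x y => p t x y i)); auto. }
assert (Hs : forall i j l i' j' l', bigO K (m + n + k)
  (fun t x y => p t x y i * q t x y j * r t x y l + -1 * (p t x y i' * q t x y j' * r t x y l'))).
{ intros. apply (bigO_plus K (m+n+k) (fun t x y => p t x y i * q t x y j * r t x y l)); auto.
  apply bigO_scal, Ht. }
assert (H3 := bigO_plus K (m+n+k) _ _ (bigO_plus K (m+n+k) _ _ (Hs 1 2 0 2 1 0)%nat (Hs 2 0 1 0 2 1)%nat)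
   (Hs 0 1 2 1 0 2)%nat).
refine (bigO_ext K (m+n+k) _ _ 1 Rlt_0_1 _ H3).
intros t x y _ _; unfold det3, dot3, cross3; ring.
Qed.

Lemma bigO_dot3 K m n (p q : R -> R -> R -> nat -> R) :
  (forall j, bigO K m (fun t x y => p t x y j)) ->
  (forall j, bigO K n (fun t x y => q t x y j)) ->
  bigO K (m + n) (fun t x y => dot3 (p t x y) (q t x y)).
Proof.
intros Hp Hq; unfold dot3.
assert (Ht : forall i, bigO K (m + n) (fun t x y => p t x y i * q t x y i))
  by (intros i; apply (bigO_mult K m n (fun t x y => p t x y i)); auto).
apply (bigO_plus K (m + n) (fun t x y => p t x y 0%nat * q t x y 0%nat + p t x y 1%nat * q t x y 1%nat)); auto.
apply (bigO_plus K (m + n) (fun t x y => p t x y 0%nat * q t x y 0%nat)); auto.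
Qed.

(** The linear part of the varied area form is the divergence of (det(g, k, gy), det(g, gx, k)),
    with the mixed partials cancelling, plus 3 det(k, gx, gy). Since [g] and g + k both lie on the
    sphere, the cross product of [gx] and [gy] is parallel to [g] while <g, k> = - |k|^2 / 2: the
    extra term is quadratic, with constant -3/2. *)
Lemma det3_first_variation (g gx gy gxy k kx ky : nat -> R) :
  dot3 g g = 1 -> dot3 g gx = 0 -> dot3 g gy = 0 ->
  dot3 (fun j => g j + k j) (fun j => g j + k j) = 1 ->
  det3 (fun j => g j + k j) (fun j => gx j + kx j) (fun j => gy j + ky j) =
  det3 g gx gy
  + ((det3 gx k gy + det3 g kx gy + det3 g k gxy) + (det3 gy gx k + det3 g gxy k + det3 g gx ky))
  + (- (3 / 2) * (dot3 k k * det3 g gx gy)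
     + det3 k kx gy + det3 k gx ky + det3 g kx ky + det3 k kx ky).
Proof.
intros H1 H2 H3 H4.
assert (Hk : dot3 g k = - / 2 * dot3 k k).
{ replace (dot3 (fun j => g j + k j) (fun j => g j + k j))
    with (dot3 g g + 2 * dot3 g k + dot3 k k) in H4 by (unfold dot3; ring). lra. }
(* Cramer's rule expands det(k, gx, gy) g in [k], [gx], [gy]; pairing with [g] leaves one term by
   orthogonality. *)
assert (Hd : dot3 g g * det3 k gx gy = dot3 g k * det3 g gx gy
   + dot3 g gx * det3 k g gy + dot3 g gy * det3 k gx g) by (unfold det3, dot3, cross3; ring).
rewrite H1, H2, H3, Hk in Hd.
replace (det3 (fun j => g j + k j) (fun j => gx j + kx j) (fun j => gy j + ky j))
  with (det3 g gx gy
  + ((det3 gx k gy + det3 g kx gy + det3 g k gxy) + (det3 gy gx k + det3 g gxy k + det3 g gx ky))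
  + (3 * (1 * det3 k gx gy)
     + det3 k kx gy + det3 k gx ky + det3 g kx ky + det3 k kx ky))
  by (unfold det3, dot3, cross3; ring).
rewrite Hd; lra.
Qed.

Lemma rect_skew (a b s t : R) : 0 <= a <= 1 -> 0 <= b -> 0 <= s <= 1 -> 0 <= t <= 1 ->
  rect b (s + t * a) (t * b).
Proof. intros; split; nra. Qed.

Lemma lip_detg b f phi : smooth_map f -> smooth_map phi ->
  lip (rect b) (fun t x y => detg (fam f phi t) x y).
Proof.
intros Hf Hp.
apply (lip_ext _ (fun t x y => dot3 (pluckerv (fam f phi t) x y) (pluckerv (fam f phi t) x y)) _ 1 Rlt_0_1).
- intros; rewrite detg_plucker; reflexivity.
- apply lip_dot3; intros j; apply (lip_plucker b f phi j Hf Hp).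
Qed.

Lemma lip_first_form b f phi : smooth_map f -> smooth_map phi ->
  lip (rect b) (fun t x y => g11 (fam f phi t) x y) /\
  lip (rect b) (fun t x y => g12 (fam f phi t) x y).
Proof.
intros Hf Hp; unfold g11, g12, sum4.
assert (J := fun i Hi => lip_jets b f phi i Hf Hp Hi).
split; lip_arith; match goal with
 | |- lip _ (fun t x y => pdx (fam _ _ t ?i) x y) => apply (J i ltac:(lia))
 | |- lip _ (fun t x y => pdy (fam _ _ t ?i) x y) => apply (J i ltac:(lia))
 end.
Qed.

Lemma continuous_pos_below b g : cont2 g -> (forall x y, 0 < g x y) ->
  exists c, 0 < c /\ forall x y, rect b x y -> c <= g x y.
Proof.
intros Hg Hpos.
assert (Hi : cont2 (fun x y => / g x y)).
{ intros x y; apply (continuous_comp (fun p : R * R => g (fst p) (snd p)) Rinv); [apply Hg|].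
  apply continuous_Rinv, Rgt_not_eq, Hpos. }
destruct (cont2_bounded _ 0 2 0 b Hi) as [M [HM H]].
exists (/ (M + 1)); split; [apply Rinv_0_lt_compat; lra|].
intros x y [Hx Hy]; specialize (H x y Hx Hy); specialize (Hpos x y).
rewrite Rabs_pos_eq in H by (left; apply Rinv_0_lt_compat; auto).
rewrite <- (Rinv_inv (g x y)).
apply Rinv_le_contravar; [apply Rinv_0_lt_compat; auto|lra].
Qed.

(** On the rectangle [detg] has a positive lower bound, which survives small parameters; periodicity
    spreads it over the plane. *)
Lemma regular_near a b f phi : 0 <= a <= 1 -> 0 < b -> regular f -> smooth_map phi ->
  (forall i, (i < 4)%nat -> periodic a b (f i)) ->
  (forall i, (i < 4)%nat -> periodic a b (phi i)) ->
  exists d, 0 < d /\ forall t, Rabs t < d -> regular (fam f phi t).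
Proof.
intros Ha Hb Hf Hp Pf Pp.
destruct (continuous_pos_below b (detg f)) as [c [Hc Hc']].
{ exact (smooth2_cont _ (proj2 (proj2 (proj2 (smooth2_first_form f (proj1 Hf)))))). }
{ apply Hf. }
assert (Hl := lip_detg b f phi (proj1 Hf) Hp).
assert (Hl0 : forall x y, rect b x y -> c <= detg (fam f phi 0) x y)
  by (intros x y Hxy; rewrite fam_0; auto).
destruct (lip_bounded_below _ _ c Hc Hl0 Hl) as (c' & Hc0 & d & Hd & H).
exists d; split; auto.
intros t Ht; split; [apply smooth_fam; [apply Hf|apply Hp]|].
intros x y.
assert (Pt : forall i, (i < 4)%nat -> periodic a b (fam f phi t i)).
{ intros i Hi u v; unfold fam.
  rewrite (proj1 (Pf i Hi u v)), (proj2 (Pf i Hi u v)),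
    (proj1 (Pp i Hi u v)), (proj2 (Pp i Hi u v)); auto. }
destruct (periodic_rep a b x y Hb) as (s & r & Hs & Hr & E).
rewrite (E (detg (fam f phi t))).
- apply Rlt_le_trans with (1 := Hc0), H; auto.
  apply rect_skew; lra.
- apply periodic_first_form; auto; apply smooth_fam; auto; apply Hf.
Qed.

Lemma lip_gauss a b f phi : 0 <= a <= 1 -> 0 < b -> regular f -> smooth_map phi ->
  (forall i, (i < 4)%nat -> periodic a b (f i)) ->
  (forall i, (i < 4)%nat -> periodic a b (phi i)) ->
  lip (rect b) (fun t x y => sqdet (fam f phi t) x y) /\
  bounded_below (rect b) (fun t x y => sqdet (fam f phi t) x y) /\
  forall j,
  lip (rect b) (fun t x y => gaussv (fam f phi t) x y j) /\
  lip (rect b) (fun t x y => gaussx (fam f phi t) x y j) /\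
  lip (rect b) (fun t x y => gaussy (fam f phi t) x y j).
Proof.
intros Ha Hb Hf Hp Pf Pp.
destruct (regular_near a b f phi Ha Hb Hf Hp Pf Pp) as [d [Hd Hreg]].
destruct (continuous_pos_below b (detg f)) as [c [Hc Hc']].
{ exact (smooth2_cont _ (proj2 (proj2 (proj2 (smooth2_first_form f (proj1 Hf)))))). }
{ apply Hf. }
assert (Hl := lip_detg b f phi (proj1 Hf) Hp).
assert (Hbb : bounded_below (rect b) (fun t x y => detg (fam f phi t) x y)).
{ apply (lip_bounded_below _ _ c Hc); auto. intros x y Hxy; rewrite fam_0; auto. }
assert (Hs : lip (rect b) (fun t x y => sqdet (fam f phi t) x y)) by (apply lip_sqrt; auto).
assert (Hsb : bounded_below (rect b) (fun t x y => sqdet (fam f phi t) x y)).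
{ destruct Hbb as (c1 & Hc1 & d1 & Hd1 & H1).
  exists (sqrt c1); split; [apply sqrt_lt_R0; auto|].
  exists d1; split; auto; intros t x y Ht HK; apply sqrt_le_1_alt, H1; auto. }
assert (Hi := lip_inv _ _ Hsb Hs).
assert (HP := fun j => lip_plucker b f phi j (proj1 Hf) Hp).
split; [|split]; auto.
intros j; split; [|split].
- apply (lip_mult (rect b) (fun t x y => pluckerv (fam f phi t) x y j)); auto; apply HP.
- apply (lip_ext _ (fun t x y => pluckerx (fam f phi t) x y j * / sqdet (fam f phi t) x y
    - pluckerv (fam f phi t) x y j * dot3 (pluckerv (fam f phi t) x y) (pluckerx (fam f phi t) x y)
      * (/ sqdet (fam f phi t) x y * / sqdet (fam f phi t) x y * / sqdet (fam f phi t) x y)) _ d Hd).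
  + intros t x y Ht _; exact (eq_sym (proj1 (gauss_derivatives _ x y j (Hreg t Ht)))).
  + lip_arith; match goal with
    | |- lip _ (fun t x y => pluckerv _ _ _ ?i) => exact (proj1 (HP i))
    | |- lip _ (fun t x y => pluckerx _ _ _ ?i) => exact (proj1 (proj2 (HP i)))
    | |- lip _ (fun t x y => pluckery _ _ _ ?i) => exact (proj2 (proj2 (HP i)))
    | |- lip _ (fun t x y => / sqdet _ _ _) => exact Hi
    | |- _ => apply lip_dot3; intros i; apply (HP i)
    end.
- apply (lip_ext _ (fun t x y => pluckery (fam f phi t) x y j * / sqdet (fam f phi t) x y
    - pluckerv (fam f phi t) x y j * dot3 (pluckerv (fam f phi t) x y) (pluckery (fam f phi t) x y)
      * (/ sqdet (fam f phi t) x y * / sqdet (fam f phi t) x y * / sqdet (fam f phi t) x y)) _ d Hd).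
  + intros t x y Ht _; exact (eq_sym (proj2 (gauss_derivatives _ x y j (Hreg t Ht)))).
  + lip_arith; match goal with
    | |- lip _ (fun t x y => pluckerv _ _ _ ?i) => exact (proj1 (HP i))
    | |- lip _ (fun t x y => pluckerx _ _ _ ?i) => exact (proj1 (proj2 (HP i)))
    | |- lip _ (fun t x y => pluckery _ _ _ ?i) => exact (proj2 (proj2 (HP i)))
    | |- lip _ (fun t x y => / sqdet _ _ _) => exact Hi
    | |- _ => apply lip_dot3; intros i; apply (HP i)
    end.
Qed.

Definition gauss_area (F : nat -> R -> R -> R) (x y : R) : R :=
  det3 (gaussv F x y) (gaussx F x y) (gaussy F x y).

Definition defect_density (F : nat -> R -> R -> R) (x y : R) : R :=
  dot3 (cr_defect F x y) (cr_defect F x y) * (/ g11 F x y * / sqdet F x y).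

Lemma smooth2_det3 (p q r : nat -> R -> R -> R) :
  (forall j, smooth2 (p j)) -> (forall j, smooth2 (q j)) -> (forall j, smooth2 (r j)) ->
  smooth2 (fun x y => det3 (fun j => p j x y) (fun j => q j x y) (fun j => r j x y)).
Proof. intros; unfold det3, dot3, cross3; smooth_arith; auto. Qed.

Lemma smooth2_gauss_area F : regular F -> smooth2 (gauss_area F).
Proof.
intros HF; apply (smooth2_det3 (gauss F) (fun j => pdx (gauss F j)) (fun j => pdy (gauss F j)));
  intros j; auto using smooth2_dx, smooth2_dy, smooth2_gauss.
Qed.

Lemma smooth2_defect_density F : regular F -> smooth2 (defect_density F).
Proof.
intros HF.
destruct (smooth2_first_form F (proj1 HF)) as (H11 & H12 & _ & _).
assert (Hs := smooth2_sqdet F HF).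
assert (G := fun j => smooth2_gauss F j HF).
assert (Gx := fun j => smooth2_dx _ (G j)).
assert (Gy := fun j => smooth2_dy _ (G j)).
assert (I1 : smooth2 (fun x y => / g11 F x y))
  by (apply smooth2_inv; auto; intros; apply Rgt_not_eq, g11_pos, HF).
assert (I2 : smooth2 (fun x y => / sqdet F x y))
  by (apply smooth2_inv; auto; intros; apply Rgt_not_eq, sqdet_pos, HF).
unfold defect_density, dot3, cr_defect, cross3, gaussv, gaussx, gaussy.
smooth_arith; auto.
Qed.

Lemma willmore_split a b F : regular F ->
  willmore F a b = tint a b (gauss_area F) + / 4 * tint a b (defect_density F).
Proof.
intros HF.
assert (c1 := smooth2_cont _ (smooth2_gauss_area F HF)).
assert (c2 := smooth2_cont _ (smooth2_defect_density F HF)).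
assert (E : willmore F a b =
   / 4 * tint a b (fun x y => sum4 (fun i => meancurv F i x y ^ 2) * sqdet F x y)) by reflexivity.
assert (E2 : (fun x y => sum4 (fun i => meancurv F i x y ^ 2) * sqdet F x y) =
   (fun x y => 4 * gauss_area F x y + defect_density F x y)).
{ apply functional_extensionality; intros x; apply functional_extensionality; intros y.
  rewrite (willmore_density F x y HF); unfold gauss_area, defect_density.
  unfold Rdiv; rewrite Rinv_mult; reflexivity. }
rewrite E, E2, tint_plus, tint_scal; auto.
- field.
- apply cont2_mult; auto using cont2_const.
Qed.

Theorem willmore_critical_of_defect0 a b f phi : 0 <= a <= 1 -> 0 < b -> regular f -> smooth_map phi ->
  (forall i, (i < 4)%nat -> periodic a b (f i)) ->
  (forall i, (i < 4)%nat -> periodic a b (phi i)) ->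
  (forall x y j, cr_defect f x y j = 0) ->
  is_derive (fun t => willmore (fam f phi t) a b) 0 0.
Proof.
intros Ha Hb Hf Hp Pf Pp Hcr.
destruct (regular_near a b f phi Ha Hb Hf Hp Pf Pp) as [d [Hd Hreg]].
destruct (lip_gauss a b f phi Ha Hb Hf Hp Pf Pp) as (Ls & Bs & LG).
destruct (lip_first_form b f phi (proj1 Hf) Hp) as [L11 L12].
assert (B11 : bounded_below (rect b) (fun t x y => g11 (fam f phi t) x y)).
{ destruct (continuous_pos_below b (g11 f)) as [c [Hc Hc']].
  - exact (smooth2_cont _ (proj1 (smooth2_first_form f (proj1 Hf)))).
  - intros; apply g11_pos, Hf.
  - apply (lip_bounded_below _ _ c Hc); auto. intros x y Hxy; rewrite fam_0; auto. }
assert (Lcr : forall j, lip (rect b) (fun t x y => cr_defect (fam f phi t) x y j)).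
{ intros j; unfold cr_defect, cross3; destruct j as [|[|j]]; lip_arith;
  match goal with
  | |- lip _ (fun t x y => g11 _ _ _) => exact L11
  | |- lip _ (fun t x y => g12 _ _ _) => exact L12
  | |- lip _ (fun t x y => sqdet _ _ _) => exact Ls
  | |- lip _ (fun t x y => gaussv _ _ _ ?i) => exact (proj1 (LG i))
  | |- lip _ (fun t x y => gaussx _ _ _ ?i) => exact (proj1 (proj2 (LG i)))
  | |- lip _ (fun t x y => gaussy _ _ _ ?i) => exact (proj2 (proj2 (LG i)))
  end. }
assert (O1 : forall j, bigO (rect b) 1 (fun t x y => cr_defect (fam f phi t) x y j)).
{ intros j; destruct (Lcr j) as [_ H].
  refine (bigO_ext _ 1 _ _ 1 Rlt_0_1 _ H).
  intros t x y _ _; cbv beta; rewrite fam_0, Hcr; ring. }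
(* The defect vanishes at t = 0, so it is O(t), and its density is quadratic in it: this summand of
   the energy has derivative 0. *)
assert (O2 : bigO (rect b) 2 (fun t x y => defect_density (fam f phi t) x y)).
{ apply (bigO_mult (rect b) 2 0 (fun t x y => dot3 (cr_defect (fam f phi t) x y) (cr_defect (fam f phi t) x y))).
  - apply (bigO_dot3 (rect b) 1 1); auto.
  - apply lip_bounded, lip_mult; apply lip_inv; auto. }
set (k := fun t x y j => gaussv (fam f phi t) x y j - gaussv f x y j).
set (kx := fun t x y j => gaussx (fam f phi t) x y j - gaussx f x y j).
set (ky := fun t x y j => gaussy (fam f phi t) x y j - gaussy f x y j).
assert (Ok : forall j, bigO (rect b) 1 (fun t x y => k t x y j)).
{ intros j; destruct (LG j) as [[_ H] _].
  refine (bigO_ext _ 1 _ _ 1 Rlt_0_1 _ H); intros; cbv beta; rewrite fam_0; reflexivity. }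
assert (Okx : forall j, bigO (rect b) 1 (fun t x y => kx t x y j)).
{ intros j; destruct (LG j) as [_ [[_ H] _]].
  refine (bigO_ext _ 1 _ _ 1 Rlt_0_1 _ H); intros; cbv beta; rewrite fam_0; reflexivity. }
assert (Oky : forall j, bigO (rect b) 1 (fun t x y => ky t x y j)).
{ intros j; destruct (LG j) as [_ [_ [_ H]]].
  refine (bigO_ext _ 1 _ _ 1 Rlt_0_1 _ H); intros; cbv beta; rewrite fam_0; reflexivity. }
assert (G0 := fun j => smooth2_gauss f j Hf).
assert (G0x := fun j => smooth2_dx _ (G0 j)).
assert (G0y := fun j => smooth2_dy _ (G0 j)).
assert (Og : forall j, bigO (rect b) 0 (fun _ x y => gaussv f x y j))
  by (intros j; apply cont2_bigO, smooth2_cont, G0).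
assert (Ogx : forall j, bigO (rect b) 0 (fun _ x y => gaussx f x y j))
  by (intros j; apply cont2_bigO, smooth2_cont, G0x).
assert (Ogy : forall j, bigO (rect b) 0 (fun _ x y => gaussy f x y j))
  by (intros j; apply cont2_bigO, smooth2_cont, G0y).
(* The remainder of [det3_first_variation] for the Gauss maps at 0 and t; each of its summands
   contains at least two factors among [k], [kx], [ky]. *)
set (rem := fun t x y =>
  - (3 / 2) * (dot3 (k t x y) (k t x y) * det3 (gaussv f x y) (gaussx f x y) (gaussy f x y))
  + det3 (k t x y) (kx t x y) (gaussy f x y) + det3 (k t x y) (gaussx f x y) (ky t x y)
  + det3 (gaussv f x y) (kx t x y) (ky t x y) + det3 (k t x y) (kx t x y) (ky t x y)).
assert (Orem : bigO (rect b) 2 rem).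
{ unfold rem; repeat match goal with
  | |- bigO ?K ?n (fun t x y => @?g t x y + @?h t x y) => apply (bigO_plus K n g h)
  end.
  - apply bigO_scal.
    apply (bigO_mult (rect b) 2 0 (fun t x y => dot3 (k t x y) (k t x y))).
    + apply (bigO_dot3 (rect b) 1 1); auto.
    + apply (bigO_det3 (rect b) 0 0 0 (fun _ => gaussv f) (fun _ => gaussx f) (fun _ => gaussy f)); auto.
  - apply (bigO_det3 (rect b) 1 1 0 k kx (fun _ => gaussy f)); auto.
  - apply (bigO_det3 (rect b) 1 0 1 k (fun _ => gaussx f) ky); auto.
  - apply (bigO_det3 (rect b) 0 1 1 (fun _ => gaussv f) kx ky); auto.
  - apply bigO_weaken, (bigO_det3 (rect b) 1 1 1 k kx ky); auto. }
destruct O2 as (d2 & C2 & Hd2 & HC2 & O2), Orem as (d3 & C3 & Hd3 & HC3 & Orem).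
apply is_derive_quadratic_bound with (d := Rmin d (Rmin d2 d3)) (C := (C3 + C2) * b);
  [repeat apply Rmin_pos; auto | nra |].
intros t Ht; rewrite Rplus_0_l, Rmult_0_l, Rminus_0_r.
assert (Ht1 : Rabs t < d) by (apply Rlt_le_trans with (1 := Ht), Rmin_l).
assert (Ht2 : Rabs t < d2)
  by (apply Rlt_le_trans with (1 := Ht), Rle_trans with (2 := Rmin_l _ d3), Rmin_r).
assert (Ht3 : Rabs t < d3)
  by (apply Rlt_le_trans with (1 := Ht), Rle_trans with (2 := Rmin_r d2 _), Rmin_r).
assert (Rt := Hreg t Ht1).
rewrite (willmore_split a b _ Rt), fam_0, (willmore_split a b _ Hf).
assert (Z : tint a b (defect_density f) = 0).
{ replace (defect_density f) with (fun _ _ : R => 0 * 0).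
  - rewrite (tint_scal a b 0 (fun _ _ => 0)); [ring|apply cont2_const].
  - do 2 (apply functional_extensionality; intros ?).
    unfold defect_density, dot3; rewrite !Hcr; ring. }
rewrite Z.
assert (Gt := fun j => smooth2_gauss _ j Rt).
assert (Gtx := fun j => smooth2_dx _ (Gt j)).
assert (Gty := fun j => smooth2_dy _ (Gt j)).
(* The flux whose divergence is the linear part of the varied area form. It is periodic because both
   Gauss maps are, so its divergence integrates to 0. *)
set (A := fun x y => det3 (gaussv f x y) (k t x y) (gaussy f x y)).
set (B := fun x y => det3 (gaussv f x y) (gaussx f x y) (k t x y)).
assert (Sk : forall j, smooth2 (fun x y => k t x y j))
  by (intros j; apply (smooth2_minus (gauss (fam f phi t) j) (gauss f j)); auto).
assert (SA : smooth2 A)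
  by (apply (smooth2_det3 (gauss f) (fun j x y => k t x y j) (fun j => pdy (gauss f j))); auto).
assert (SB : smooth2 B)
  by (apply (smooth2_det3 (gauss f) (fun j => pdx (gauss f j)) (fun j x y => k t x y j)); auto).
assert (pk : forall j, has_partials (fun x y => k t x y j) (fun x y => kx t x y j) (fun x y => ky t x y j)).
{ intros j; apply (partials_minus (gauss (fam f phi t) j) (gauss f j)); apply gauss_partials; auto. }
assert (pA := partials_det3 _ _ _ _ _ _ _ _ _ (fun j => gauss_partials f j Hf) pk
   (fun j => smooth2_partials _ (G0y j))).
assert (pB := partials_det3 _ _ _ _ _ _ _ _ _ (fun j => gauss_partials f j Hf)
   (fun j => smooth2_partials _ (G0x j)) pk).
assert (Earea : forall x y, gauss_area (fam f phi t) x y =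
   gauss_area f x y + (pdx A x y + pdy B x y) + rem t x y).
{ intros x y.
  destruct (gauss_orth f x y Hf) as [o1 o2].
  assert (V := det3_first_variation (gaussv f x y) (gaussx f x y) (gaussy f x y)
    (fun j => pdy (pdx (gauss f j)) x y) (k t x y) (kx t x y) (ky t x y)
    (gauss_unit f x y Hf) o1 o2).
  assert (Ev : (fun j => gaussv f x y j + k t x y j) = gaussv (fam f phi t) x y)
    by (apply functional_extensionality; intros j; unfold k; ring).
  assert (Evx : (fun j => gaussx f x y j + kx t x y j) = gaussx (fam f phi t) x y)
    by (apply functional_extensionality; intros j; unfold kx; ring).
  assert (Evy : (fun j => gaussy f x y j + ky t x y j) = gaussy (fam f phi t) x y)
    by (apply functional_extensionality; intros j; unfold ky; ring).
  rewrite Ev, Evx, Evy in V.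
  specialize (V (gauss_unit _ x y Rt)).
  unfold gauss_area; rewrite V; unfold rem.
  rewrite (proj1 (pd_ext_partials A _ _ x y pA)), (proj2 (pd_ext_partials B _ _ x y pB)).
  assert (Ec : (fun j => pdx (pdy (gauss f j)) x y) = (fun j => pdy (pdx (gauss f j)) x y))
    by (apply functional_extensionality; intros j; apply pd_comm, G0).
  cbv beta; rewrite Ec; reflexivity. }
assert (Crem : cont2 (rem t)).
{ assert (E : rem t = fun x y => gauss_area (fam f phi t) x y - gauss_area f x y - (pdx A x y + pdy B x y)).
  { do 2 (apply functional_extensionality; intros ?); rewrite Earea; ring. }
  rewrite E; apply smooth2_cont; smooth_arith;
    auto using smooth2_gauss_area, smooth2_dx, smooth2_dy. }
assert (CD : cont2 (fun x y => pdx A x y + pdy B x y)).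
{ apply cont2_plus; apply smooth2_cont; auto using smooth2_dx, smooth2_dy. }
assert (PG := fun j => periodic_gauss a b f j (proj1 Hf) Pf).
assert (Pt : forall i, (i < 4)%nat -> periodic a b (fam f phi t i)).
{ intros i Hi u v; unfold fam.
  rewrite (proj1 (Pf i Hi u v)), (proj2 (Pf i Hi u v)),
    (proj1 (Pp i Hi u v)), (proj2 (Pp i Hi u v)); auto. }
assert (PGt := fun j => periodic_gauss a b _ j (proj1 Rt) Pt).
assert (PGx := fun j => proj1 (periodic_pd a b _ (G0 j) (PG j))).
assert (PGy := fun j => proj2 (periodic_pd a b _ (G0 j) (PG j))).
assert (Pdet : forall p q r : nat -> R -> R -> R, (forall j, periodic a b (p j)) ->
   (forall j, periodic a b (q j)) -> (forall j, periodic a b (r j)) ->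
   periodic a b (fun x y => det3 (fun j => p j x y) (fun j => q j x y) (fun j => r j x y))).
{ intros p q r H1 H2 H3 x y; unfold det3, dot3, cross3; split.
  - rewrite !(proj1 (H1 _ x y)), !(proj1 (H2 _ x y)), !(proj1 (H3 _ x y)); auto.
  - rewrite !(proj2 (H1 _ x y)), !(proj2 (H2 _ x y)), !(proj2 (H3 _ x y)); auto. }
assert (Pk : forall j, periodic a b (fun x y => k t x y j)).
{ intros j x y; unfold k, gaussv.
  rewrite (proj1 (PG j x y)), (proj2 (PG j x y)), (proj1 (PGt j x y)), (proj2 (PGt j x y)); auto. }
assert (PA : periodic a b A)
  by (apply (Pdet (gauss f) (fun j x y => k t x y j) (fun j => pdy (gauss f j))); auto).
assert (PB : periodic a b B)
  by (apply (Pdet (gauss f) (fun j => pdx (gauss f j)) (fun j x y => k t x y j)); auto).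
assert (ED : tint a b (fun x y => pdx A x y + pdy B x y) = 0).
{ apply tint_divergence_periodic; auto; intros x y; first [apply PA | apply PB]. }
assert (EA : tint a b (gauss_area (fam f phi t)) = tint a b (gauss_area f) + tint a b (rem t)).
{ replace (gauss_area (fam f phi t)) with
    (fun x y => gauss_area f x y + (pdx A x y + pdy B x y) + rem t x y)
    by (do 2 (apply functional_extensionality; intros ?); symmetry; apply Earea).
  assert (Cf := smooth2_cont _ (smooth2_gauss_area f Hf)).
  rewrite (tint_plus a b (fun x y => gauss_area f x y + (pdx A x y + pdy B x y)));
    [|apply cont2_plus; auto|auto].
  rewrite (tint_plus a b (gauss_area f)) by auto.
  rewrite ED; ring. }
rewrite EA.
assert (Hrem : Rabs (tint a b (rem t)) <= C3 * Rabs t ^ 2 * b).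
{ apply tint_bound; [lra|auto|].
  intros s r Hs Hr; apply Orem; auto; apply rect_skew; lra. }
assert (Hdef : Rabs (tint a b (defect_density (fam f phi t))) <= C2 * Rabs t ^ 2 * b).
{ apply tint_bound; [lra|apply smooth2_cont, smooth2_defect_density, Rt|].
  intros s r Hs Hr; apply O2; auto; apply rect_skew; lra. }
replace (tint a b (gauss_area f) + tint a b (rem t) + / 4 * tint a b (defect_density (fam f phi t)) -
   (tint a b (gauss_area f) + / 4 * 0))
  with (tint a b (rem t) + / 4 * tint a b (defect_density (fam f phi t))) by ring.
apply Rle_trans with (1 := Rabs_triang _ _).
rewrite Rabs_mult, (Rabs_pos_eq (/ 4)) by lra.
assert (0 <= Rabs (tint a b (defect_density (fam f phi t)))) by apply Rabs_pos.
lra.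
Qed.

(** * Surfaces from holomorphic sections *)

Definition re_of (s : C -> C) (x y : R) : R := Re (s (x, y)).
Definition im_of (s : C -> C) (x y : R) : R := Im (s (x, y)).

(** The Cauchy-Riemann equations in the form s_x = s', s_y = i s', on the whole plane. The
    derivative is a separate function, which may be given whatever expression is convenient. *)
Definition holo (s ds : C -> C) : Prop :=
  has_partials (re_of s) (re_of ds) (fun x y => - im_of ds x y) /\
  has_partials (im_of s) (im_of ds) (re_of ds).

Definition csmooth (s : C -> C) : Prop := smooth2 (re_of s) /\ smooth2 (im_of s).

Lemma csmooth_derivative (s ds : C -> C) : csmooth s -> holo s ds -> csmooth ds.
Proof.
intros [S1 S2] [H1 H2]; split.
- rewrite (proj1 (has_partials_eq _ _ _ H1)); apply smooth2_dx, S1.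
- rewrite (proj1 (has_partials_eq _ _ _ H2)); apply smooth2_dx, S2.
Qed.

(** Symmetry of second partials carries the Cauchy-Riemann equations over to [ds]. Only existence
    matters, as the second derivatives of the sections cancel in the Laplacian of ln [surf_den]. *)
Lemma holo_derivative (s ds : C -> C) : csmooth s -> holo s ds ->
  exists dds, holo ds dds.
Proof.
intros Hs Hh; destruct (csmooth_derivative s ds Hs Hh) as [D1 D2].
destruct Hs as [S1 S2], Hh as [H1 H2].
destruct (has_partials_eq _ _ _ H1) as [E1x E1y].
destruct (has_partials_eq _ _ _ H2) as [E2x E2y].
exists (fun z => (pdx (re_of ds) (fst z) (snd z), pdx (im_of ds) (fst z) (snd z))).
split.
- apply (partials_ext _ _ _ _ _ (smooth2_partials _ D1)); [reflexivity|].
  intros x y; unfold im_of at 1; simpl.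
  rewrite E1x, <- pd_comm, <- E1y by auto.
  assert (H := partials_opp _ _ _ (smooth2_partials _ D2)).
  apply (pd_ext_partials _ _ _ x y H).
- apply (partials_ext _ _ _ _ _ (smooth2_partials _ D2)); [reflexivity|].
  intros x y; unfold re_of at 1; simpl.
  rewrite E2x, <- pd_comm, <- E2y by auto; reflexivity.
Qed.

(* [f = s^-1 * s0] for the quaternion [s = s1 + s2 j]. *)
Definition surf_num (s : nat -> C -> C) (i : nat) (x y : R) : R :=
  match i with
  | 0%nat => re_of (s 1%nat) x y * re_of (s 0%nat) x y + im_of (s 1%nat) x y * im_of (s 0%nat) x y
  | 1%nat => re_of (s 1%nat) x y * im_of (s 0%nat) x y - im_of (s 1%nat) x y * re_of (s 0%nat) x y
  | 2%nat => - (re_of (s 2%nat) x y * re_of (s 0%nat) x y + im_of (s 2%nat) x y * im_of (s 0%nat) x y)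
  | _ => re_of (s 2%nat) x y * im_of (s 0%nat) x y - im_of (s 2%nat) x y * re_of (s 0%nat) x y
  end.

Definition surf_den (s : nat -> C -> C) (x y : R) : R :=
  re_of (s 1%nat) x y * re_of (s 1%nat) x y + im_of (s 1%nat) x y * im_of (s 1%nat) x y
  + re_of (s 2%nat) x y * re_of (s 2%nat) x y + im_of (s 2%nat) x y * im_of (s 2%nat) x y.

Definition surf (s : nat -> C -> C) (i : nat) (x y : R) : R :=
  surf_num s i x y * / surf_den s x y.

(* The Hopf image [s^-1 i s] of the quaternion [s = s1 + s2 j]. *)
Definition hopf_num (s : nat -> C -> C) (j : nat) (x y : R) : R :=
  match j with
  | 0%nat => re_of (s 1%nat) x y * re_of (s 1%nat) x y + im_of (s 1%nat) x y * im_of (s 1%nat) x y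
     - (re_of (s 2%nat) x y * re_of (s 2%nat) x y + im_of (s 2%nat) x y * im_of (s 2%nat) x y)
  | 1%nat => 2 * (im_of (s 1%nat) x y * re_of (s 2%nat) x y - re_of (s 1%nat) x y * im_of (s 2%nat) x y)
  | _ => 2 * (re_of (s 1%nat) x y * re_of (s 2%nat) x y + im_of (s 1%nat) x y * im_of (s 2%nat) x y)
  end.

Definition hopf (s : nat -> C -> C) (j : nat) (x y : R) : R := hopf_num s j x y * / surf_den s x y.

Definition wronskian (s ds : nat -> C -> C) (i : nat) (z : C) : C :=
  (s 0%nat z * ds i z - ds 0%nat z * s i z)%C.

Lemma partials_const (c : R) : has_partials (fun _ _ => c) (fun _ _ => 0) (fun _ _ => 0).
Proof. intros x y; split; apply (is_derive_const c). Qed.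

Ltac gen_atoms s ds x y :=
  unfold re_of, im_of;
  generalize (Re (s 0%nat (x, y))) (Im (s 0%nat (x, y))) (Re (s 1%nat (x, y))) (Im (s 1%nat (x, y)))
    (Re (s 2%nat (x, y))) (Im (s 2%nat (x, y)))
    (Re (ds 0%nat (x, y))) (Im (ds 0%nat (x, y))) (Re (ds 1%nat (x, y))) (Im (ds 1%nat (x, y)))
    (Re (ds 2%nat (x, y))) (Im (ds 2%nat (x, y))).

Ltac atom_partials :=
  match goal with
  | H : forall i, holo (?s i) _ |- has_partials (fun x y => re_of (?s ?i) x y) _ _ =>
     exact (proj1 (H i))
  | H : forall i, holo (?s i) _ |- has_partials (fun x y => im_of (?s ?i) x y) _ _ =>
     exact (proj2 (H i))
  | |- has_partials (fun _ _ => ?c) _ _ => exact (partials_const c)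
  end.

(* [f_y = G f_x] with [G] the Hopf image: [f_x = s^-1 (s0' - s' s^-1 s0)], and [d/dy] multiplies
   the derivatives of [s] and [s0] by [i] on the left. *)
Lemma surf_cauchy_riemann (s ds : nat -> C -> C) (x y : R) (i : nat) :
  (forall i, holo (s i) (ds i)) -> (forall x y, surf_den s x y <> 0) -> (i < 4)%nat ->
  tang_y (surf s) x y i = lmul (fun j => hopf s j x y) (tang_x (surf s) x y) i.
Proof.
intros Hh Hd Hi.
eassert (HD : has_partials (surf_den s) _ _)
  by (unfold surf_den; partials_arith; atom_partials).
assert (HI := partials_inv _ _ _ Hd HD).
eassert (H0 : has_partials (surf_num s 0) _ _) by (unfold surf_num; partials_arith; atom_partials).
eassert (H1 : has_partials (surf_num s 1) _ _) by (unfold surf_num; partials_arith; atom_partials).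
eassert (H2 : has_partials (surf_num s 2) _ _) by (unfold surf_num; partials_arith; atom_partials).
eassert (H3 : has_partials (surf_num s 3) _ _) by (unfold surf_num; partials_arith; atom_partials).
destruct (pd_ext_partials (surf s 0) _ _ x y (partials_mult _ _ _ _ _ _ H0 HI)) as [E0x E0y].
destruct (pd_ext_partials (surf s 1) _ _ x y (partials_mult _ _ _ _ _ _ H1 HI)) as [E1x E1y].
destruct (pd_ext_partials (surf s 2) _ _ x y (partials_mult _ _ _ _ _ _ H2 HI)) as [E2x E2y].
destruct (pd_ext_partials (surf s 3) _ _ x y (partials_mult _ _ _ _ _ _ H3 HI)) as [E3x E3y].
assert (Hr := Hd x y).
(* The denominator stays an atom [r] while fractions are cleared; it is then replaced by its
   polynomial expression through this equation, and a polynomial identity remains. *)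
assert (Er : surf_den s x y = surf_den s x y) by reflexivity.
unfold surf_den in Er at 2; revert Hr Er.
unfold tang_x, tang_y, lmul.
destruct i as [|[|[|[|i]]]]; [..|lia]; rewrite ?E0x, ?E1x, ?E2x, ?E3x, ?E0y, ?E1y, ?E2y, ?E3y;
unfold hopf, hopf_num, surf_num; generalize (surf_den s x y); clear;
gen_atoms s ds x y; intros p0 q0 p1 q1 p2 q2 a0 b0 a1 b1 a2 b2 r Hr Er;
field_simplify_eq; auto; rewrite Er; ring.
Qed.

(** Where s0 <> 0, the inverse of f is s1/s0 + (s2/s0) j, whose x-derivative is (W1 + W2 j) / s0^2
    with W1, W2 the Wronskians. Inversion gives |f_x| = |f|^2 |(f^-1)_x| with |f| = |s0| / |s|, and
    s0 drops out. The proof checks the resulting identity algebraically, zeros of s0 included. *)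
Lemma surf_metric (s ds : nat -> C -> C) (x y : R) :
  (forall i, holo (s i) (ds i)) -> (forall x y, surf_den s x y <> 0) ->
  g11 (surf s) x y * surf_den s x y ^ 2 =
  Cmod (wronskian s ds 1 (x, y)) ^ 2 + Cmod (wronskian s ds 2 (x, y)) ^ 2.
Proof.
intros Hh Hd.
eassert (HD : has_partials (surf_den s) _ _)
  by (unfold surf_den; partials_arith; atom_partials).
assert (HI := partials_inv _ _ _ Hd HD).
eassert (H0 : has_partials (surf_num s 0) _ _) by (unfold surf_num; partials_arith; atom_partials).
eassert (H1 : has_partials (surf_num s 1) _ _) by (unfold surf_num; partials_arith; atom_partials).
eassert (H2 : has_partials (surf_num s 2) _ _) by (unfold surf_num; partials_arith; atom_partials).
eassert (H3 : has_partials (surf_num s 3) _ _) by (unfold surf_num; partials_arith; atom_partials).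
destruct (pd_ext_partials (surf s 0) _ _ x y (partials_mult _ _ _ _ _ _ H0 HI)) as [E0x _].
destruct (pd_ext_partials (surf s 1) _ _ x y (partials_mult _ _ _ _ _ _ H1 HI)) as [E1x _].
destruct (pd_ext_partials (surf s 2) _ _ x y (partials_mult _ _ _ _ _ _ H2 HI)) as [E2x _].
destruct (pd_ext_partials (surf s 3) _ _ x y (partials_mult _ _ _ _ _ _ H3 HI)) as [E3x _].
assert (Hr := Hd x y).
assert (Er : surf_den s x y = surf_den s x y) by reflexivity.
unfold surf_den in Er at 2; revert Hr Er.
rewrite !Cmod2_alt; unfold wronskian.
assert (EC : forall u v w z : C,
   Re (u * v - w * z)%C = Re u * Re v - Im u * Im v - (Re w * Re z - Im w * Im z) /\
   Im (u * v - w * z)%C = Re u * Im v + Im u * Re v - (Re w * Im z + Im w * Re z)).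
{ intros [] [] [] []; simpl; split; ring. }
rewrite !(proj1 (EC _ _ _ _)), !(proj2 (EC _ _ _ _)).
unfold g11, sum4; rewrite E0x, E1x, E2x, E3x.
unfold surf_num; generalize (surf_den s x y); clear;
gen_atoms s ds x y; intros p0 q0 p1 q1 p2 q2 a0 b0 a1 b1 a2 b2 r Hr Er.
field_simplify_eq; auto; rewrite Er; ring.
Qed.

Lemma hopf_unit (s : nat -> C -> C) (x y : R) : surf_den s x y <> 0 ->
  dot3 (fun j => hopf s j x y) (fun j => hopf s j x y) = 1.
Proof.
intros Hr.
assert (Er : surf_den s x y = surf_den s x y) by reflexivity.
unfold surf_den in Er at 2; revert Hr Er.
unfold dot3, hopf, hopf_num; generalize (surf_den s x y).
unfold re_of, im_of;
generalize (Re (s 1%nat (x, y))) (Im (s 1%nat (x, y))) (Re (s 2%nat (x, y))) (Im (s 2%nat (x, y))).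
intros p1 q1 p2 q2 r Hr Er.
field_simplify_eq; auto; rewrite Er; ring.
Qed.

Lemma lmul_orth (g u : nat -> R) : dot4 u (lmul g u) = 0.
Proof. cbv [dot4 sum4 lmul]; ring. Qed.

Lemma lmul_isometry (g u : nat -> R) : dot4 (lmul g u) (lmul g u) = dot3 g g * dot4 u u.
Proof. cbv [dot4 sum4 lmul dot3]; ring. Qed.

Lemma im_mul_conj_lmul (g u : nat -> R) (j : nat) : (j < 3)%nat ->
  im_mul_conj (lmul g u) u j = dot4 u u * g j.
Proof.
intros Hj; destruct j as [|[|[|j]]]; [..|lia]; cbv [dot4 sum4 lmul im_mul_conj]; ring.
Qed.

Definition section_triple (s ds : nat -> C -> C) : Prop :=
  (forall i, csmooth (s i)) /\ (forall i, holo (s i) (ds i)) /\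
  (forall z, s 1%nat z <> 0 \/ s 2%nat z <> 0) /\
  (forall z, wronskian s ds 1 z <> 0 \/ wronskian s ds 2 z <> 0).

Lemma surf_den_pos s ds x y : section_triple s ds -> 0 < surf_den s x y.
Proof.
intros (_ & _ & H & _).
assert (E : surf_den s x y = Cmod (s 1%nat (x, y)) ^ 2 + Cmod (s 2%nat (x, y)) ^ 2)
  by (rewrite !Cmod2_alt; unfold surf_den, re_of, im_of; ring).
rewrite E; destruct (H (x, y)) as [H1|H1]; apply Cmod_gt_0 in H1;
 assert (0 <= Cmod (s 1%nat (x, y))) by apply Cmod_ge_0;
 assert (0 <= Cmod (s 2%nat (x, y))) by apply Cmod_ge_0; nra.
Qed.

Lemma smooth_surf s ds : section_triple s ds -> smooth_map (surf s).
Proof.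
intros H i Hi.
assert (Hd : forall x y, surf_den s x y <> 0)
  by (intros; apply Rgt_not_eq, (surf_den_pos s ds x y H)).
destruct H as (Hs & _).
assert (Sr := fun i => proj1 (Hs i)).
assert (Si := fun i => proj2 (Hs i)).
apply (smooth2_mult (surf_num s i) (fun x y => / surf_den s x y)).
- unfold surf_num; destruct i as [|[|[|i]]]; smooth_arith; auto.
- apply smooth2_inv; auto; unfold surf_den; smooth_arith; auto.
Qed.

(** Left multiplication by a unit imaginary quaternion is an isometry that makes every vector
    orthogonal to its image, so f_y = G f_x is already conformality; the same relation identifies
    this factor of the Gauss map with the Hopf image. *)
Lemma surf_first_form s ds x y : section_triple s ds ->
  0 < g11 (surf s) x y /\ g12 (surf s) x y = 0 /\ g22 (surf s) x y = g11 (surf s) x y /\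
  forall j, (j < 3)%nat -> plucker (surf s) j x y = g11 (surf s) x y * hopf s j x y.
Proof.
intros H; generalize H; intros (Hs & Hh & _ & HW).
assert (Hd : forall x y, surf_den s x y <> 0)
  by (intros; apply Rgt_not_eq, (surf_den_pos s ds _ _ H)).
assert (E := fun i => surf_cauchy_riemann s ds x y i Hh Hd).
split; [|split; [|split]].
- assert (M := surf_metric s ds x y Hh Hd).
  assert (Hp := surf_den_pos s ds x y H).
  assert (0 < g11 (surf s) x y * surf_den s x y ^ 2).
  { rewrite M; destruct (HW (x, y)) as [H1|H1]; apply Cmod_gt_0 in H1;
    assert (0 <= Cmod (wronskian s ds 1 (x, y))) by apply Cmod_ge_0;
    assert (0 <= Cmod (wronskian s ds 2 (x, y))) by apply Cmod_ge_0; nra. }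
  assert (0 < surf_den s x y ^ 2) by nra.
  apply Rmult_lt_reg_r with (surf_den s x y ^ 2); lra.
- rewrite g12_dot4, <- (lmul_orth (fun j => hopf s j x y) (tang_x (surf s) x y)).
  unfold dot4, sum4; rewrite !E by lia; reflexivity.
- rewrite g22_dot4, g11_dot4.
  transitivity (1 * dot4 (tang_x (surf s) x y) (tang_x (surf s) x y)); [|ring].
  rewrite <- (hopf_unit s x y (Hd x y)), <- lmul_isometry.
  unfold dot4, sum4; rewrite !E by lia; reflexivity.
- intros j Hj; rewrite g11_dot4, <- (im_mul_conj_lmul (fun j => hopf s j x y)) by auto.
  unfold plucker, im_mul_conj; rewrite !E by lia; reflexivity.
Qed.

Lemma surf_sqdet s ds x y : section_triple s ds ->
  detg (surf s) x y = g11 (surf s) x y ^ 2 /\ sqdet (surf s) x y = g11 (surf s) x y.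
Proof.
intros H; destruct (surf_first_form s ds x y H) as (H1 & H2 & H3 & _).
assert (E : detg (surf s) x y = g11 (surf s) x y ^ 2) by (unfold detg; rewrite H2, H3; ring).
split; auto.
unfold sqdet; rewrite E; apply sqrt_pow2; lra.
Qed.

Lemma surf_regular s ds : section_triple s ds -> regular (surf s).
Proof.
intros H; split; [exact (smooth_surf s ds H)|].
intros x y; rewrite (proj1 (surf_sqdet s ds x y H)).
apply pow_lt, (surf_first_form s ds x y H).
Qed.

Lemma surf_gauss s ds j : section_triple s ds -> gauss (surf s) j = hopf s j.
Proof.
intros H; apply functional_extensionality; intros x; apply functional_extensionality; intros y.
destruct (surf_first_form s ds x y H) as (H1 & _ & _ & H4).
assert (E : plucker (surf s) j x y = g11 (surf s) x y * hopf s j x y).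
{ destruct j as [|[|j]].
  - apply H4; lia.
  - apply H4; lia.
  - exact (H4 2%nat ltac:(lia)). }
unfold gauss; rewrite E, (proj2 (surf_sqdet s ds x y H)); field; lra.
Qed.

(** For a conformal parametrisation the defect vanishes exactly when G_y is the cross product of G
    and G_x; this is the Cauchy-Riemann equation of the holomorphic curve [s1 : s2], read on the
    sphere. *)
Lemma surf_defect s ds x y j : section_triple s ds -> cr_defect (surf s) x y j = 0.
Proof.
intros H; generalize H; intros (_ & Hh & _ & _).
assert (Hd : forall x y, surf_den s x y <> 0)
  by (intros; apply Rgt_not_eq, (surf_den_pos s ds _ _ H)).
destruct (surf_first_form s ds x y H) as (_ & H2 & _ & _).
unfold cr_defect; rewrite H2, (proj2 (surf_sqdet s ds x y H)).
enough (E : gaussy (surf s) x y j = cross3 (gaussv (surf s) x y) (gaussx (surf s) x y) j)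
  by (rewrite E; ring).
eassert (HD : has_partials (surf_den s) _ _)
  by (unfold surf_den; partials_arith; atom_partials).
assert (HI := partials_inv _ _ _ Hd HD).
eassert (N0 : has_partials (hopf_num s 0) _ _) by (unfold hopf_num; partials_arith; atom_partials).
eassert (N1 : has_partials (hopf_num s 1) _ _) by (unfold hopf_num; partials_arith; atom_partials).
eassert (N2 : has_partials (hopf_num s 2) _ _) by (unfold hopf_num; partials_arith; atom_partials).
destruct (pd_ext_partials (hopf s 0) _ _ x y (partials_mult _ _ _ _ _ _ N0 HI)) as [E0x E0y].
destruct (pd_ext_partials (hopf s 1) _ _ x y (partials_mult _ _ _ _ _ _ N1 HI)) as [E1x E1y].
destruct (pd_ext_partials (hopf s 2) _ _ x y (partials_mult _ _ _ _ _ _ N2 HI)) as [E2x E2y].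
assert (Hr := Hd x y).
assert (Er : surf_den s x y = surf_den s x y) by reflexivity.
unfold surf_den in Er at 2; revert Hr Er.
unfold gaussx, gaussy, gaussv; 
assert (Ej : pdy (gauss (surf s) j) x y = match j with 0%nat => pdy (hopf s 0) x y
   | 1%nat => pdy (hopf s 1) x y | _ => pdy (hopf s 2) x y end).
{ rewrite (surf_gauss s ds j H); destruct j as [|[|j]]; reflexivity. }
rewrite Ej; clear Ej.
unfold cross3; rewrite !(surf_gauss s ds _ H).
rewrite E0x, E1x, E2x, E0y, E1y, E2y.
unfold hopf, hopf_num; generalize (surf_den s x y); clear;
gen_atoms s ds x y; intros p0 q0 p1 q1 p2 q2 a0 b0 a1 b1 a2 b2 r Hr Er.
destruct j as [|[|j]]; field_simplify_eq; auto; rewrite Er; ring.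
Qed.

(** The x-derivative of ln [surf_den], and likewise [logden_y] with s_y = i s' substituted. No
    logarithm occurs, and one further derivative gives the Laplacian. *)
Definition logden_x (s ds : nat -> C -> C) (x y : R) : R :=
  2 * (re_of (s 1%nat) x y * re_of (ds 1%nat) x y + im_of (s 1%nat) x y * im_of (ds 1%nat) x y
     + re_of (s 2%nat) x y * re_of (ds 2%nat) x y + im_of (s 2%nat) x y * im_of (ds 2%nat) x y)
  * / surf_den s x y.

Definition logden_y (s ds : nat -> C -> C) (x y : R) : R :=
  2 * (im_of (s 1%nat) x y * re_of (ds 1%nat) x y - re_of (s 1%nat) x y * im_of (ds 1%nat) x y
     + im_of (s 2%nat) x y * re_of (ds 2%nat) x y - re_of (s 2%nat) x y * im_of (ds 2%nat) x y)
  * / surf_den s x y.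

(* The Hopf image pulls the area form of the sphere back to the Laplacian of [ln (surf_den s)]. *)
Lemma surf_area s ds x y : section_triple s ds ->
  gauss_area (surf s) x y = pdx (logden_x s ds) x y + pdy (logden_y s ds) x y.
Proof.
intros H; generalize H; intros (Hs & Hh & _ & _).
assert (Hd : forall x y, surf_den s x y <> 0)
  by (intros; apply Rgt_not_eq, (surf_den_pos s ds _ _ H)).
eassert (HD : has_partials (surf_den s) _ _)
  by (unfold surf_den; partials_arith; atom_partials).
assert (HI := partials_inv _ _ _ Hd HD).
eassert (N0 : has_partials (hopf_num s 0) _ _) by (unfold hopf_num; partials_arith; atom_partials).
eassert (N1 : has_partials (hopf_num s 1) _ _) by (unfold hopf_num; partials_arith; atom_partials).
eassert (N2 : has_partials (hopf_num s 2) _ _) by (unfold hopf_num; partials_arith; atom_partials).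
destruct (pd_ext_partials (hopf s 0) _ _ x y (partials_mult _ _ _ _ _ _ N0 HI)) as [E0x E0y].
destruct (pd_ext_partials (hopf s 1) _ _ x y (partials_mult _ _ _ _ _ _ N1 HI)) as [E1x E1y].
destruct (pd_ext_partials (hopf s 2) _ _ x y (partials_mult _ _ _ _ _ _ N2 HI)) as [E2x E2y].
destruct (holo_derivative _ _ (Hs 1%nat) (Hh 1%nat)) as [t1 [R1 I1]].
destruct (holo_derivative _ _ (Hs 2%nat) (Hh 2%nat)) as [t2 [R2 I2]].
eassert (LX : has_partials (logden_x s ds) _ _).
{ unfold logden_x; partials_arith; first [exact HI | exact R1 | exact R2 | exact I1 | exact I2 | atom_partials]. }
eassert (LY : has_partials (logden_y s ds) _ _).
{ unfold logden_y; partials_arith; first [exact HI | exact R1 | exact R2 | exact I1 | exact I2 | atom_partials]. }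
rewrite (proj1 (pd_ext_partials _ _ _ x y LX)), (proj2 (pd_ext_partials _ _ _ x y LY)).
assert (Hr := Hd x y).
assert (Er : surf_den s x y = surf_den s x y) by reflexivity.
unfold surf_den in Er at 2; revert Hr Er.
unfold gauss_area, det3, dot3, cross3, gaussx, gaussy, gaussv.
rewrite !(surf_gauss s ds _ H).
rewrite E0x, E1x, E2x, E0y, E1y, E2y.
unfold hopf, hopf_num; generalize (surf_den s x y); clear;
gen_atoms s ds x y; generalize (Re (t1 (x, y))) (Im (t1 (x, y))) (Re (t2 (x, y))) (Im (t2 (x, y)));
intros c1 d1 c2 d2 p0 q0 p1 q1 p2 q2 a0 b0 a1 b1 a2 b2 r Hr Er.
field_simplify_eq; auto; rewrite Er; ring.
Qed.

(** All sections share the multipliers, so quotients descend to the torus. The degree k is encoded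
    in the growth rate 4 pi k of ln |m|^2 in y. *)
Definition quasi_periodic (a b : R) (k : nat) (s : nat -> C -> C) : Prop :=
  (exists e : C, Cmod e = 1 /\ forall i x y, s i (x + 1, y) = (e * s i (x, y))%C) /\
  (exists (m : C -> C) (c : R), (forall x y, Cmod (m (x, y)) ^ 2 = exp (c + 4 * PI * INR k * y)) /\
     forall i x y, s i (x + a, y + b) = (m (x, y) * s i (x, y))%C).

Lemma surf_den_scale (s : nat -> C -> C) (u : C) (x y x' y' : R) :
  (forall i, s i (x', y') = (u * s i (x, y))%C) ->
  surf_den s x' y' = Cmod u ^ 2 * surf_den s x y.
Proof.
intros H; unfold surf_den, re_of, im_of; rewrite !H, Cmod2_alt.
destruct u as [u v], (s 1%nat (x, y)) as [p1 q1], (s 2%nat (x, y)) as [p2 q2]; simpl; ring.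
Qed.

(** (u s)^-1 (u s0) = s^-1 s0: a common complex factor acts on the left and cancels. *)
Lemma surf_scale (s : nat -> C -> C) (u : C) (x y x' y' : R) (i : nat) :
  (forall i, s i (x', y') = (u * s i (x, y))%C) -> Cmod u <> 0 -> surf_den s x y <> 0 ->
  surf s i x' y' = surf s i x y.
Proof.
intros H Hu Hd.
assert (E : surf_num s i x' y' = Cmod u ^ 2 * surf_num s i x y).
{ unfold surf_num, re_of, im_of; rewrite !H, Cmod2_alt.
  destruct u as [u v], (s 0%nat (x, y)) as [p0 q0], (s 1%nat (x, y)) as [p1 q1],
    (s 2%nat (x, y)) as [p2 q2]; destruct i as [|[|[|i]]]; simpl; ring. }
unfold surf; rewrite E, (surf_den_scale s u x y x' y' H); field; auto.
Qed.

Lemma surf_periodic a b k s ds : section_triple s ds -> quasi_periodic a b k s ->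
  lattice_periodic (surf s) a b.
Proof.
intros Hs [(e & He & H1) (m & c & Hm & H2)] i x y.
assert (Hd := Rgt_not_eq _ _ (surf_den_pos s ds x y Hs)).
split.
- apply (surf_scale s e); auto; lra.
- apply (surf_scale s (m (x, y))); auto.
  intros E; specialize (Hm x y); rewrite E in Hm.
  assert (0 < exp (c + 4 * PI * INR k * y)) by apply exp_pos. lra.
Qed.

Lemma surf_logden s ds : section_triple s ds ->
  has_partials (surf_den s) (fun x y => logden_x s ds x y * surf_den s x y)
    (fun x y => logden_y s ds x y * surf_den s x y) /\
  smooth2 (logden_x s ds) /\ smooth2 (logden_y s ds).
Proof.
intros H; generalize H; intros (Hs & Hh & _ & _).
assert (Hd : forall x y, surf_den s x y <> 0)
  by (intros; apply Rgt_not_eq, (surf_den_pos s ds _ _ H)).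
assert (Hds := fun i => csmooth_derivative _ _ (Hs i) (Hh i)).
assert (Sr := fun i => proj1 (Hs i)); assert (Si := fun i => proj2 (Hs i)).
assert (Dr := fun i => proj1 (Hds i)); assert (Di := fun i => proj2 (Hds i)).
assert (Sd : smooth2 (fun x y => / surf_den s x y))
  by (apply smooth2_inv; auto; unfold surf_den; smooth_arith; auto).
split; [|split].
- eassert (HD : has_partials (surf_den s) _ _)
    by (unfold surf_den; partials_arith; atom_partials).
  apply (partials_ext _ _ _ _ _ HD); intros x y; unfold logden_x, logden_y; field; auto.
- unfold logden_x; smooth_arith; auto.
- unfold logden_y; smooth_arith; auto.
Qed.

Theorem surf_spec a b k s ds : 0 <= a <= 1 -> 0 < b ->
  section_triple s ds -> quasi_periodic a b k s ->
  smooth_map (surf s) /\ lattice_periodic (surf s) a b /\ conformal_immersion (surf s) /\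
  willmore_critical (surf s) a b /\ willmore (surf s) a b = 4 * INR k * PI.
Proof.
intros Ha Hb Hs Hq.
assert (Hreg := surf_regular s ds Hs).
assert (Hper := surf_periodic a b k s ds Hs Hq).
split; [exact (proj1 Hreg)|split; [exact Hper|split; [|split]]].
- intros x y; destruct (surf_first_form s ds x y Hs) as (H1 & H2 & H3 & _); auto.
- intros phi Hphi Pphi.
  apply (willmore_critical_of_defect0 a b (surf s) phi); auto.
  + intros i _ x y; apply Hper.
  + intros i _ x y; apply Pphi.
  + intros x y j; apply (surf_defect s ds x y j Hs).
- destruct (surf_logden s ds Hs) as (HD & SX & SY).
  rewrite (willmore_split a b _ Hreg).
  assert (Z : tint a b (defect_density (surf s)) = 0).
  { replace (defect_density (surf s)) with (fun _ _ : R => 0 * 0).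
    - rewrite (tint_scal a b 0 (fun _ _ => 0)); [ring|apply cont2_const].
    - do 2 (apply functional_extensionality; intros ?).
      unfold defect_density, dot3; rewrite !(surf_defect s ds _ _ _ Hs); ring. }
  rewrite Z.
  replace (gauss_area (surf s)) with (fun x y => pdx (logden_x s ds) x y + pdy (logden_y s ds) x y)
    by (do 2 (apply functional_extensionality; intros ?); symmetry; apply surf_area, Hs).
  destruct Hq as [(e & He & H1) (m & c & Hm & H2)].
  assert (Hpos := fun x y => surf_den_pos s ds x y Hs).
  assert (D1 : forall x y, surf_den s (x + 1) y = surf_den s x y).
  { intros x y; rewrite (surf_den_scale s e x y); auto; rewrite He; ring. }
  assert (D2 : forall x y, surf_den s (x + a) (y + b) = exp (c + 4 * PI * INR k * y) * surf_den s x y).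
  { intros x y; rewrite (surf_den_scale s (m (x, y)) x y), Hm; auto. }
  assert (PX : forall x y, logden_x s ds (x + 1) y = logden_x s ds x y).
  { intros x y.
    assert (d1 := is_derive_shift (fun t => surf_den s t y) 1 x _ (proj1 (HD (x + 1) y))).
    apply (is_derive_ext _ (fun t => surf_den s t y)) in d1; [|intros t; apply D1].
    apply is_derive_unique in d1.
    rewrite (is_derive_unique _ _ _ (proj1 (HD x y))), D1 in d1.
    apply Rmult_eq_reg_r in d1; auto. apply Rgt_not_eq, Hpos. }
  assert (PY : forall x y, logden_y s ds (x + 1) y = logden_y s ds x y).
  { intros x y.
    assert (d1 := proj2 (HD (x + 1) y)).
    apply (is_derive_ext _ (fun t => surf_den s x t)) in d1; [|intros t; apply D1].
    apply is_derive_unique in d1.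
    rewrite (is_derive_unique _ _ _ (proj2 (HD x y))), D1 in d1.
    apply Rmult_eq_reg_r in d1; auto. apply Rgt_not_eq, Hpos. }
  (* Logarithmic derivative of the rule [D2]: the factor |m|^2 contributes its constant rate 4 pi k.
     Integrated along the edge of length 1, this jump is the whole energy. *)
  assert (QY : forall x y, logden_y s ds (x + a) (y + b) = logden_y s ds x y + 4 * PI * INR k).
  { intros x y.
    assert (d1 := is_derive_shift (fun t => surf_den s (x + a) t) b y _ (proj2 (HD (x + a) (y + b)))).
    apply (is_derive_ext _ (fun t => exp (c + 4 * PI * INR k * t) * surf_den s x t)) in d1;
      [|intros t; apply D2].
    assert (d2 : is_derive (fun t => exp (c + 4 * PI * INR k * t)) y
       (4 * PI * INR k * exp (c + 4 * PI * INR k * y))) by (auto_derive; auto; ring).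
    assert (d3 := is_derive_mult _ _ y _ _ d2 (proj2 (HD x y)) Rmult_comm
      : is_derive (fun t => exp (c + 4 * PI * INR k * t) * surf_den s x t) y _).
    apply is_derive_unique in d1; apply is_derive_unique in d3.
    rewrite d1 in d3; rewrite D2 in d3.
    unfold plus, mult in d3; simpl in d3.
    assert (E0 := exp_pos (c + 4 * PI * INR k * y)).
    assert (E1 := Hpos x y).
    apply Rmult_eq_reg_r with (exp (c + 4 * PI * INR k * y) * surf_den s x y); [|nra].
    lra. }
  rewrite tint_divergence by auto.
  rewrite (RInt_ext (fun s0 => logden_y s ds (s0 + a) b)
     (fun s0 => plus (logden_y s ds s0 0) (4 * PI * INR k))).
  2: { intros u _; rewrite <- (Rplus_0_l b) at 1; apply QY. }
  rewrite (RInt_plus (V := R_CompleteNormedModule) (fun s0 => logden_y s ds s0 0)).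
  + rewrite (RInt_const (V := R_CompleteNormedModule)).
    unfold plus, scal; simpl; unfold mult; simpl; ring.
  + apply (ex_RInt_continuous (V := R_CompleteNormedModule)); intros z _.
    apply (cont2_slice_l (logden_y s ds)), smooth2_cont, SY.
  + apply (ex_RInt_const (V := R_CompleteNormedModule)).
Qed.

(** * Complex exponential series *)

Definition cexp (z : C) : C := (exp (Re z) * cos (Im z), exp (Re z) * sin (Im z)).

Lemma cexp_plus (z w : C) : cexp (z + w)%C = (cexp z * cexp w)%C.
Proof.
destruct z as [x y], w as [u v]; unfold cexp, Cplus, Cmult; simpl.
rewrite exp_plus, cos_plus, sin_plus; f_equal; ring.
Qed.

Lemma cexp_0 : cexp 0%C = 1%C.
Proof. unfold cexp; simpl; rewrite exp_0, cos_0, sin_0; apply injective_projections; simpl; ring. Qed.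

Lemma Cmod_cexp (z : C) : Cmod (cexp z) = exp (Re z).
Proof.
assert (H : Cmod (cexp z) ^ 2 = exp (Re z) ^ 2).
{ rewrite Cmod2_alt; unfold cexp; simpl.
  assert (S := sin2_cos2 (Im z)); unfold Rsqr in S.
  transitivity (exp (fst z) * exp (fst z) * (sin (Im z) * sin (Im z) + cos (Im z) * cos (Im z))).
  - unfold Im, Re; ring.
  - rewrite S; unfold Re; ring. }
assert (H1 := Cmod_ge_0 (cexp z)). assert (H2 := exp_pos (Re z)).
rewrite <- (Rabs_pos_eq (Cmod (cexp z))), <- (Rabs_pos_eq (exp (Re z))) by lra.
rewrite <- !sqrt_Rsqr_abs; f_equal; unfold Rsqr; lra.
Qed.

Lemma cexp_neq0 (z : C) : cexp z <> 0%C.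
Proof. apply Cmod_gt_0; rewrite Cmod_cexp; apply exp_pos. Qed.

(** The modulus gives the real part; cos y = 1 forces sin (y / 2) = 0 by the half-angle formula,
    hence the period 2 pi. *)
Lemma cexp_eq1 (z : C) : cexp z = 1%C -> Re z = 0 /\ exists k : Z, Im z = 2 * PI * IZR k.
Proof.
intros H.
assert (H1 : exp (Re z) = 1) by (rewrite <- Cmod_cexp, H, Cmod_1; auto).
split.
- apply exp_inv; rewrite H1, exp_0; auto.
- unfold cexp in H; rewrite H1, !Rmult_1_l in H.
  assert (Hc : cos (Im z) = 1) by (injection H; auto).
  assert (E : cos (2 * (Im z / 2)) = 1) by (rewrite <- Hc; f_equal; field).
  rewrite cos_2a_sin in E.
  assert (S0 : sin (Im z / 2) = 0) by nra.
  apply sin_eq_0_0 in S0; destruct S0 as [k Hk]; exists k; lra.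
Qed.

Lemma sin_bound_abs (y : R) : Rabs (sin y) <= Rabs y.
Proof.
destruct (MVT_gen sin 0 y cos) as [c [_ H]].
- intros; auto_derive; auto; ring.
- intros x _; apply continuity_sin.
- rewrite sin_0, !Rminus_0_r in H; rewrite H, Rabs_mult.
  assert (Rabs (cos c) <= 1) by (apply Rabs_le, COS_bound).
  assert (0 <= Rabs y) by apply Rabs_pos; nra.
Qed.

Lemma one_minus_cos (y : R) : cos y - 1 = - (2 * (sin (y / 2) * sin (y / 2))).
Proof. replace y with (2 * (y / 2)) at 1 by field; rewrite cos_2a_sin; ring. Qed.

Lemma cos_bound_abs (y : R) : Rabs (cos y - 1) <= Rabs y.
Proof.
rewrite one_minus_cos, Rabs_Ropp, !Rabs_mult, (Rabs_pos_eq 2) by lra.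
assert (H := sin_bound_abs (y / 2)).
assert (H1 : Rabs (sin (y / 2)) <= 1) by (apply Rabs_le, SIN_bound).
assert (E : Rabs (y / 2) = Rabs y / 2) by (unfold Rdiv; rewrite Rabs_mult, (Rabs_pos_eq (/ 2)) by lra; auto).
rewrite E in H; assert (0 <= Rabs (sin (y / 2))) by apply Rabs_pos; nra.
Qed.

Lemma cos_bound_sqr (y : R) : Rabs (cos y - 1) <= Rabs y ^ 2.
Proof.
rewrite one_minus_cos, Rabs_Ropp, !Rabs_mult, (Rabs_pos_eq 2) by lra.
assert (H := sin_bound_abs (y / 2)).
assert (E : Rabs (y / 2) = Rabs y / 2) by (unfold Rdiv; rewrite Rabs_mult, (Rabs_pos_eq (/ 2)) by lra; auto).
rewrite E in H; assert (0 <= Rabs (sin (y / 2))) by apply Rabs_pos; nra.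
Qed.

Lemma Rabs_between (x c : R) : Rmin 0 x <= c <= Rmax 0 x -> Rabs c <= Rabs x.
Proof.
intros H; unfold Rmin, Rmax in H; destruct (Rle_dec 0 x);
 unfold Rabs; destruct (Rcase_abs c), (Rcase_abs x); lra.
Qed.

Lemma sin_bound_sqr (y : R) : Rabs (sin y - y) <= Rabs y ^ 2.
Proof.
destruct (MVT_gen (fun t => sin t - t) 0 y (fun t => cos t - 1)) as [c [Hc H]].
- intros; auto_derive; auto; ring.
- intros x _; apply continuity_pt_minus; [apply continuity_sin|apply continuity_pt_id].
- rewrite sin_0, !Rminus_0_r in H; rewrite H, Rabs_mult.
  apply Rabs_between in Hc; assert (T := cos_bound_abs c).
  assert (0 <= Rabs y) by apply Rabs_pos; nra.
Qed.

Lemma exp_bound_abs (x : R) : Rabs (exp x - 1) <= Rabs x * exp (Rabs x).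
Proof.
destruct (MVT_gen exp 0 x exp) as [c [Hc H]].
- intros; auto_derive; auto; ring.
- intros t _; apply derivable_continuous_pt, derivable_pt_exp.
- rewrite exp_0, Rminus_0_r in H; rewrite H, Rabs_mult, Rmult_comm.
  apply Rabs_between in Hc.
  apply Rmult_le_compat_l; [apply Rabs_pos|].
  rewrite Rabs_pos_eq by (left; apply exp_pos).
  destruct (Req_dec c (Rabs x)) as [->|Hn]; [lra|].
  left; apply exp_increasing; assert (c <= Rabs c) by apply Rle_abs; lra.
Qed.

Lemma exp_le (x y : R) : x <= y -> exp x <= exp y.
Proof. intros [H| ->]; [left; apply exp_increasing; auto|lra]. Qed.

Lemma exp_bound_sqr (x : R) : Rabs (exp x - 1 - x) <= Rabs x ^ 2 * exp (Rabs x).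
Proof.
destruct (MVT_gen (fun t => exp t - t) 0 x (fun t => exp t - 1)) as [c [Hc H]].
- intros; auto_derive; auto; ring.
- intros t _; apply continuity_pt_minus;
   [apply derivable_continuous_pt, derivable_pt_exp|apply continuity_pt_id].
- rewrite exp_0, !Rminus_0_r in H.
  replace (exp x - 1 - x) with (exp x - x - 1) by ring.
  rewrite H, Rabs_mult; apply Rabs_between in Hc.
  assert (T := exp_bound_abs c).
  assert (T2 := exp_le _ _ Hc).
  assert (0 <= Rabs c) by apply Rabs_pos. assert (0 < exp (Rabs c)) by apply exp_pos.
  assert (Rabs c * exp (Rabs c) <= Rabs x * exp (Rabs x)) by (apply Rmult_le_compat; lra).
  nra.
Qed.

Lemma Cmod_le_sum (z : C) : Cmod z <= Rabs (Re z) + Rabs (Im z).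
Proof.
assert (H := Cmod2_alt z). assert (H0 := Cmod_ge_0 z).
assert (H1 := Rabs_pos (Re z)). assert (H2 := Rabs_pos (Im z)).
rewrite <- (pow2_abs (Re z)), <- (pow2_abs (Im z)) in H. nra.
Qed.

Lemma im_le_Cmod (z : C) : Rabs (Im z) <= Cmod z.
Proof. apply Rle_trans with (2 := Rmax_Cmod z), Rmax_r. Qed.

(** Real and imaginary parts each split into two terms of size at most r^2 e^r, with r the modulus;
    hence the factor 4. *)
Lemma cexp_taylor (h : C) :
  Cmod (cexp h - 1 - h)%C <= 4 * Cmod h ^ 2 * exp (Cmod h).
Proof.
apply Rle_trans with (1 := Cmod_le_sum _).
assert (Hx := re_le_Cmod h). assert (Hy := im_le_Cmod h).
unfold cexp; destruct h as [x y]; simpl in *.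
set (r := Cmod (x, y)) in *.
assert (E1 : exp x * cos y + - (1) + - x = exp x * (cos y - 1) + (exp x - 1 - x)) by ring.
assert (E2 : exp x * sin y + - 0 + - y = (exp x - 1) * sin y + (sin y - y)) by ring.
rewrite E1, E2.
assert (T1 := Rabs_triang (exp x * (cos y - 1)) (exp x - 1 - x)).
assert (T2 := Rabs_triang ((exp x - 1) * sin y) (sin y - y)).
rewrite Rabs_mult in T1; rewrite Rabs_mult in T2.
rewrite (Rabs_pos_eq (exp x)) in T1 by (left; apply exp_pos).
assert (B1 := cos_bound_sqr y). assert (B2 := exp_bound_sqr x).
assert (B3 := exp_bound_abs x). assert (B4 := sin_bound_abs y). assert (B5 := sin_bound_sqr y).
assert (X0 := Rabs_pos x). assert (Y0 := Rabs_pos y).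
assert (M1 : exp x <= exp r) by (apply exp_le; assert (x <= Rabs x) by apply Rle_abs; lra).
assert (M2 : exp (Rabs x) <= exp r) by (apply exp_le; lra).
assert (M3 : 1 <= exp r) by (rewrite <- exp_0; apply exp_le; lra).
assert (P1 := exp_pos x). assert (P2 := exp_pos (Rabs x)).
assert (Hx2 : Rabs x ^ 2 <= r ^ 2) by (apply pow_incr; lra).
assert (Hy2 : Rabs y ^ 2 <= r ^ 2) by (apply pow_incr; lra).
assert (Q1 : exp x * Rabs (cos y - 1) <= exp r * r ^ 2).
{ apply Rmult_le_compat; try lra; apply Rabs_pos. }
assert (Q2 : Rabs (exp x - 1 - x) <= exp r * r ^ 2).
{ apply Rle_trans with (1 := B2); rewrite Rmult_comm; apply Rmult_le_compat; try lra; apply pow_le; lra. }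
assert (Q3 : Rabs (exp x - 1) * Rabs (sin y) <= exp r * r ^ 2).
{ apply Rle_trans with ((r * exp r) * r); [|simpl; lra].
  apply Rmult_le_compat; try apply Rabs_pos; try lra.
  apply Rle_trans with (1 := B3); apply Rmult_le_compat; lra. }
assert (Q4 : Rabs (sin y - y) <= exp r * r ^ 2).
{ apply Rle_trans with (1 := B5). assert (0 <= r ^ 2) by (apply pow_le; lra). nra. }
lra.
Qed.

(** * Geometrically convergent complex series over the naturals and over the integers *)

Definition Cser (u : nat -> C) : C := (Series (fun n => Re (u n)), Series (fun n => Im (u n))).

Fixpoint Cpart (u : nat -> C) (N : nat) : C :=
  match N with O => 0%C | S k => (Cpart u k + u k)%C end.

Lemma geom_exp (k : nat) : exp (- INR k) = exp (- 1) ^ k.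
Proof.
induction k as [|k IH]; [simpl; rewrite Ropp_0, exp_0; auto|].
rewrite S_INR; simpl; rewrite <- IH, <- exp_plus; f_equal; ring.
Qed.

Lemma exp_m1_half : 0 < exp (-1) <= / 2.
Proof.
split; [apply exp_pos|].
replace (-1) with (- (1)) by ring.
rewrite exp_Ropp; apply Rinv_le_contravar; [lra|].
assert (H := exp_ineq1_le 1); lra.
Qed.

(** The subtracted sum has exactly [N] terms of [r]: index 0 is padded with 0 so that it agrees with
    [Cpart]. As 1/e <= 1/2, a geometric tail is at most twice its first term. *)
Lemma series_exp_tail (r : nat -> R) (M : R) (N : nat) :
  (forall k, Rabs (r k) <= M * exp (- INR k)) ->
  ex_series r /\ Rabs (Series r - sum_f_R0 (fun k => match k with O => 0 | S j => r j end) N)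
    <= 2 * M * exp (- INR N).
Proof.
intros H.
assert (HM : 0 <= M).
{ specialize (H O); simpl in H; rewrite Ropp_0, exp_0, Rmult_1_r in H.
  apply Rle_trans with (2 := H), Rabs_pos. }
assert (H1 := exp_m1_half).
assert (Hq : Rabs (exp (-1)) < 1) by (rewrite Rabs_pos_eq; lra).
assert (Hg : forall c, ex_series (fun k => c * exp (- INR k))).
{ intros c; apply (ex_series_ext (fun k => c * (exp (-1)) ^ k)).
  - intros k; rewrite geom_exp; auto.
  - apply (ex_series_scal_l (V := R_NormedModule) c (fun k => exp (-1) ^ k)), ex_series_geom, Hq. }
assert (Hs : forall c, Series (fun k => c * exp (- INR k)) <= Rmax 0 (2 * c)).
{ intros c; rewrite Series_scal_l.
  rewrite (Series_ext _ (fun k => exp (-1) ^ k)) by (intros; apply geom_exp).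
  rewrite Series_geom by auto.
  assert (/ (1 - exp (-1)) <= 2).
  { replace 2 with (/ / 2) by field. apply Rinv_le_contravar; lra. }
  assert (0 < / (1 - exp (-1))) by (apply Rinv_0_lt_compat; lra).
  unfold Rmax; destruct (Rle_dec 0 (2 * c)); nra. }
assert (Hex : forall n, ex_series (fun k => r (n + k)%nat)).
{ intros n; apply ex_series_Rabs, (ex_series_le (V := R_CompleteNormedModule) _ (fun k => M * exp (- INR k))); auto.
  intros k; unfold norm; simpl; unfold abs; simpl; rewrite Rabs_Rabsolu.
  apply Rle_trans with (1 := H _), Rmult_le_compat_l; auto.
  apply exp_le; rewrite plus_INR; assert (0 <= INR n) by apply pos_INR; lra. }
split; [exact (Hex O)|].
assert (E : forall n, Series r - sum_f_R0 (fun k => match k with O => 0 | S j => r j end) n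
   = Series (fun k => r (n + k)%nat)).
{ induction n as [|n IH]; [simpl; rewrite Rminus_0_r; apply Series_ext; auto|].
  rewrite tech5. rewrite (Series_incr_1 _ (Hex n)), Nat.add_0_r in IH.
  rewrite (Series_ext (fun k => r (S n + k)%nat) (fun k => r (n + S k)%nat))
    by (intros k; f_equal; lia).
  lra. }
rewrite E.
assert (Hab : forall k, 0 <= Rabs (r (N + k)%nat) <= M * exp (- INR N) * exp (- INR k)).
{ intros k; split; [apply Rabs_pos|].
  apply Rle_trans with (1 := H _).
  rewrite plus_INR, Ropp_plus_distr, exp_plus; lra. }
apply Rle_trans with (1 := Series_Rabs _ (ex_series_le (V := R_CompleteNormedModule)
   (fun k => Rabs (r (N + k)%nat)) _ (fun k => eq_ind_r (fun t => t <= _) (proj2 (Hab k)) (Rabs_Rabsolu _)) (Hg _))).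
apply Rle_trans with (1 := Series_le _ _ Hab (Hg _)).
apply Rle_trans with (1 := Hs _).
rewrite Rmax_right; [lra|].
assert (0 < exp (- INR N)) by apply exp_pos; nra.
Qed.

Lemma Cser_tail (u : nat -> C) (M : R) (N : nat) :
  (forall k, Cmod (u k) <= M * exp (- INR k)) ->
  Cmod (Cser u - Cpart u N)%C <= 4 * M * exp (- INR N).
Proof.
intros H.
assert (Hr : forall k, Rabs (Re (u k)) <= M * exp (- INR k))
  by (intros k; apply Rle_trans with (2 := H k), re_le_Cmod).
assert (Hi : forall k, Rabs (Im (u k)) <= M * exp (- INR k))
  by (intros k; apply Rle_trans with (2 := H k), im_le_Cmod).
destruct (series_exp_tail _ M N Hr) as [_ T1].
destruct (series_exp_tail _ M N Hi) as [_ T2].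
assert (E : forall n, Re (Cpart u n) = sum_f_R0 (fun k => match k with O => 0 | S j => Re (u j) end) n
  /\ Im (Cpart u n) = sum_f_R0 (fun k => match k with O => 0 | S j => Im (u j) end) n).
{ induction n as [|n [IH1 IH2]]; [simpl; auto|]. rewrite !tech5, <- IH1, <- IH2; simpl; auto. }
destruct (E N) as [E1 E2].
apply Rle_trans with (1 := Cmod_le_sum _).
change (Rabs (Series (fun n => Re (u n)) - Re (Cpart u N)) +
  Rabs (Series (fun n => Im (u n)) - Im (Cpart u N)) <= 4 * M * exp (- INR N)).
rewrite E1, E2; lra.
Qed.

Definition zdec (u : Z -> C) (M : R) : Prop :=
  forall n, Cmod (u n) <= M * exp (- IZR (Z.abs n)).

(** Pairing n with -n-1 exhausts the integers, so that [zpart u N] is the sum over -N <= n < N. The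
    pairs are invariant under n -> -n-1, the reflection behind the oddness of [S1]. *)
Definition zpair (u : Z -> C) (k : nat) : C := (u (Z.of_nat k) + u (- Z.of_nat k - 1)%Z)%C.
Definition zs (u : Z -> C) : C := Cser (zpair u).
Definition zpart (u : Z -> C) (N : nat) : C := Cpart (zpair u) N.

Lemma zdec_nonneg u M : zdec u M -> 0 <= M.
Proof.
intros H; specialize (H 0%Z); simpl in H; rewrite Ropp_0, exp_0, Rmult_1_r in H.
apply Rle_trans with (2 := H), Cmod_ge_0.
Qed.

Lemma zpair_bound u M k : zdec u M -> Cmod (zpair u k) <= 2 * M * exp (- INR k).
Proof.
intros H; assert (HM := zdec_nonneg u M H).
apply Rle_trans with (1 := Cmod_triangle _ _).
assert (H1 := H (Z.of_nat k)); assert (H2 := H (- Z.of_nat k - 1)%Z).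
rewrite Z.abs_eq, <- INR_IZR_INZ in H1 by lia.
assert (H3 : exp (- IZR (Z.abs (- Z.of_nat k - 1))) <= exp (- INR k)).
{ apply exp_le, Ropp_le_contravar; rewrite INR_IZR_INZ; apply IZR_le; lia. }
assert (0 < exp (- INR k)) by apply exp_pos.
nra.
Qed.

Lemma zs_tail u M N : zdec u M -> Cmod (zs u - zpart u N)%C <= 8 * M * exp (- INR N).
Proof.
intros H; replace (8 * M) with (4 * (2 * M)) by ring.
apply Cser_tail; intros k; apply zpair_bound, H.
Qed.

Lemma zs_bound u M : zdec u M -> Cmod (zs u) <= 8 * M.
Proof.
intros H; assert (T := zs_tail u M 0 H); simpl in T.
rewrite Ropp_0, exp_0, Rmult_1_r in T.
replace (zs u) with (zs u - zpart u 0)%C; auto.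
unfold zpart; simpl; ring.
Qed.

Lemma Ceq_of_exp_bound (z w : C) (K : R) :
  (forall N, Cmod (z - w)%C <= K * exp (- INR N)) -> z = w.
Proof.
intros H.
destruct (Req_dec (Cmod (z - w)%C) 0) as [E|E].
- apply Cmod_eq_0 in E; replace z with (w + (z - w))%C by ring; rewrite E; ring.
- exfalso.
  assert (Hp : 0 < Cmod (z - w)%C) by (assert (T := Cmod_ge_0 (z - w)%C); lra).
  destruct (INR_unbounded (K / Cmod (z - w)%C)) as [N HN].
  specialize (H N); apply Rlt_div_l in HN; auto.
  assert (T := exp_ineq1_le (INR N)).
  assert (T2 : exp (INR N) * exp (- INR N) = 1) by (rewrite <- exp_plus, Rplus_opp_r, exp_0; auto).
  assert (0 < exp (- INR N)) by apply exp_pos.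
  assert (0 < exp (INR N)) by apply exp_pos.
  assert (Cmod (z - w)%C * exp (INR N) <= K).
  { apply Rle_trans with (K * exp (- INR N) * exp (INR N)); [apply Rmult_le_compat_r; lra|].
    rewrite Rmult_assoc, (Rmult_comm (exp (- INR N))), T2; lra. }
  nra.
Qed.

(** Identities between series are reduced to partial sums: geometric convergence along a sequence
    [phi] fixes the value. The split into even and odd indices takes phi N = 2N. *)
Lemma zs_unique u M (L : C) (phi : nat -> nat) (K : R) : zdec u M -> (forall N, (N <= phi N)%nat) ->
  (forall N, Cmod (L - zpart u (phi N))%C <= K * exp (- INR N)) -> zs u = L.
Proof.
intros Hu Hphi H; assert (HM := zdec_nonneg u M Hu).
apply Ceq_of_exp_bound with (K + 8 * M); intros N.
replace (zs u - L)%C with ((zs u - zpart u (phi N)) + - (L - zpart u (phi N)))%C by ring.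
apply Rle_trans with (1 := Cmod_triangle _ _); rewrite Cmod_opp.
assert (T := zs_tail u M (phi N) Hu).
assert (exp (- INR (phi N)) <= exp (- INR N)) by (apply exp_le, Ropp_le_contravar, le_INR, Hphi).
specialize (H N); nra.
Qed.

Lemma zs_ext u v : (forall n, u n = v n) -> zs u = zs v.
Proof. intros H; f_equal; apply functional_extensionality; auto. Qed.

Lemma zdec_plus u v M M' : zdec u M -> zdec v M' -> zdec (fun n => u n + v n)%C (M + M').
Proof.
intros H H' n; apply Rle_trans with (1 := Cmod_triangle _ _).
specialize (H n); specialize (H' n); lra.
Qed.

Lemma zdec_scal c u M : zdec u M -> zdec (fun n => c * u n)%C (Cmod c * M).
Proof.
intros H n; rewrite Cmod_mult, Rmult_assoc; apply Rmult_le_compat_l; [apply Cmod_ge_0|auto].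
Qed.

Lemma zs_plus u v M M' : zdec u M -> zdec v M' -> zs (fun n => u n + v n)%C = (zs u + zs v)%C.
Proof.
intros H H'.
apply (zs_unique _ (M + M') _ (fun N => N) (8 * M + 8 * M') (zdec_plus u v M M' H H')); auto.
intros N.
assert (E : zpart (fun n => u n + v n)%C N = (zpart u N + zpart v N)%C).
{ unfold zpart; induction N as [|N IH]; simpl; [ring|]; rewrite IH; unfold zpair; ring. }
rewrite E.
replace (zs u + zs v - (zpart u N + zpart v N))%C
  with ((zs u - zpart u N) + (zs v - zpart v N))%C by ring.
apply Rle_trans with (1 := Cmod_triangle _ _).
assert (T := zs_tail u M N H); assert (T' := zs_tail v M' N H'); lra.
Qed.

Lemma zs_scal c u M : zdec u M -> zs (fun n => c * u n)%C = (c * zs u)%C.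
Proof.
intros H.
apply (zs_unique _ (Cmod c * M) _ (fun N => N) (Cmod c * (8 * M)) (zdec_scal c u M H)); auto.
intros N.
assert (E : zpart (fun n => c * u n)%C N = (c * zpart u N)%C).
{ unfold zpart; induction N as [|N IH]; simpl; [ring|]; rewrite IH; unfold zpair; ring. }
rewrite E.
replace (c * zs u - c * zpart u N)%C with (c * (zs u - zpart u N))%C by ring.
rewrite Cmod_mult, Rmult_assoc; apply Rmult_le_compat_l; [apply Cmod_ge_0|].
apply zs_tail, H.
Qed.

Lemma zdec_shift u M k : zdec u M -> zdec (fun n => u (n + k)%Z) (M * exp (IZR (Z.abs k))).
Proof.
intros H n; apply Rle_trans with (1 := H _).
assert (HM := zdec_nonneg u M H).
rewrite Rmult_assoc, <- exp_plus; apply Rmult_le_compat_l; auto.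
apply exp_le. rewrite <- opp_IZR, <- opp_IZR, <- plus_IZR. apply IZR_le; lia.
Qed.

Lemma zs_shift1 u M : zdec u M -> zs (fun n => u (n + 1)%Z) = zs u.
Proof.
intros H; assert (HM := zdec_nonneg u M H).
apply (zs_unique _ _ _ (fun N => N) (10 * M) (zdec_shift u M 1 H)); auto.
intros N.
(* The windows from 1-N to N and from -N to N-1 differ in their end terms only, each of size
   e^-N. *)
assert (E : zpart (fun n => u (n + 1)%Z) N = (zpart u N + u (Z.of_nat N) - u (- Z.of_nat N)%Z)%C).
{ unfold zpart; induction N as [|N IH]; [simpl; ring|].
  change (Cpart (zpair (fun n => u (n + 1)%Z)) (S N)) with
    (Cpart (zpair (fun n => u (n + 1)%Z)) N + zpair (fun n => u (n + 1)%Z) N)%C.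
  change (Cpart (zpair u) (S N)) with (Cpart (zpair u) N + zpair u N)%C.
  rewrite IH; unfold zpair.
  replace (- Z.of_nat N - 1 + 1)%Z with (- Z.of_nat N)%Z by lia.
  replace (Z.of_nat (S N)) with (Z.of_nat N + 1)%Z by lia.
  replace (- (Z.of_nat N + 1))%Z with (- Z.of_nat N - 1)%Z by lia.
  ring. }
rewrite E.
replace (zs u - (zpart u N + u (Z.of_nat N) - u (- Z.of_nat N)%Z))%C
  with ((zs u - zpart u N) + (- u (Z.of_nat N) + u (- Z.of_nat N)%Z))%C by ring.
assert (T := zs_tail u M N H).
assert (T1 := H (Z.of_nat N)); assert (T2 := H (- Z.of_nat N)%Z).
rewrite Z.abs_eq, <- INR_IZR_INZ in T1 by lia.
rewrite Z.abs_opp, Z.abs_eq, <- INR_IZR_INZ in T2 by lia.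
assert (T3 := Cmod_triangle (zs u - zpart u N) (- u (Z.of_nat N) + u (- Z.of_nat N)%Z)).
assert (T4 := Cmod_triangle (- u (Z.of_nat N)) (u (- Z.of_nat N)%Z)).
rewrite Cmod_opp in T4; lra.
Qed.

Lemma zs_shift u M k : zdec u M -> zs (fun n => u (n + k)%Z) = zs u.
Proof.
revert k; apply (Z.peano_ind (fun k => zdec u M -> zs (fun n => u (n + k)%Z) = zs u)).
- intros _; apply zs_ext; intros n; rewrite Z.add_0_r; auto.
- intros k IH H; rewrite <- (IH H), <- (zs_shift1 _ _ (zdec_shift u M k H)).
  apply zs_ext; intros n; f_equal; lia.
- intros k IH H; rewrite <- (IH H), <- (zs_shift1 _ _ (zdec_shift u M (Z.pred k) H)).
  apply zs_ext; intros n; f_equal; lia.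
Qed.

Lemma zdec_even u M : zdec u M -> zdec (fun n => u (2 * n)%Z) M.
Proof.
intros H n; apply Rle_trans with (1 := H _); assert (HM := zdec_nonneg u M H).
apply Rmult_le_compat_l, exp_le, Ropp_le_contravar, IZR_le; auto; lia.
Qed.

Lemma zdec_odd u M : zdec u M -> zdec (fun n => u (2 * n + 1)%Z) M.
Proof.
intros H n; apply Rle_trans with (1 := H _); assert (HM := zdec_nonneg u M H).
apply Rmult_le_compat_l, exp_le, Ropp_le_contravar, IZR_le; auto; lia.
Qed.

Lemma zs_even_odd u M : zdec u M ->
  zs u = (zs (fun n => u (2 * n)%Z) + zs (fun n => u (2 * n + 1)%Z))%C.
Proof.
intros H.
apply (zs_unique u M _ (fun N => (2 * N)%nat) (16 * M) H); [intros; lia|].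
intros N.
assert (E : zpart u (2 * N) = (zpart (fun n => u (2 * n)%Z) N + zpart (fun n => u (2 * n + 1)%Z) N)%C).
{ unfold zpart; induction N as [|N IH]; [simpl; ring|].
  replace (2 * S N)%nat with (S (S (2 * N))) by lia.
  change (Cpart (zpair u) (S (S (2 * N)))) with
    (Cpart (zpair u) (2 * N) + zpair u (2 * N) + zpair u (S (2 * N)))%C.
  rewrite IH; cbn [Cpart]; unfold zpair.
  replace (Z.of_nat (2 * N)) with (2 * Z.of_nat N)%Z by lia.
  replace (Z.of_nat (S (2 * N))) with (2 * Z.of_nat N + 1)%Z by lia.
  replace (2 * (- Z.of_nat N - 1))%Z with (- (2 * Z.of_nat N + 1) - 1)%Z by lia.
  replace (- (2 * Z.of_nat N + 1) - 1 + 1)%Z with (- (2 * Z.of_nat N) - 1)%Z by lia.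
  ring. }
rewrite E.
assert (T := zs_tail _ M N (zdec_even u M H)); assert (T' := zs_tail _ M N (zdec_odd u M H)).
match goal with |- Cmod (?p + ?q - (?r + ?s))%C <= _ =>
  replace (p + q - (r + s))%C with ((p - r) + (q - s))%C by ring end.
apply Rle_trans with (1 := Cmod_triangle _ _); lra.
Qed.

(** Finite partial sums over [n] commute with [zs] by linearity, and the tails over [n] are e^-N
    times a bound summable in [m]. *)
Lemma zs_fubini (T : Z -> Z -> C) (M : R) :
  (forall m n, Cmod (T m n) <= M * exp (- IZR (Z.abs m)) * exp (- IZR (Z.abs n))) ->
  zs (fun m => zs (fun n => T m n)) = zs (fun n => zs (fun m => T m n)).
Proof.
intros H.
assert (Hrow : forall m, zdec (fun n => T m n) (M * exp (- IZR (Z.abs m)))) by (intros m n; apply H).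
assert (Hcol : forall n, zdec (fun m => T m n) (M * exp (- IZR (Z.abs n)))).
{ intros n m; apply Rle_trans with (1 := H m n); lra. }
assert (Drow : zdec (fun m => zs (fun n => T m n)) (8 * M)).
{ intros m; apply Rle_trans with (1 := zs_bound _ _ (Hrow m)); lra. }
assert (Dcol : zdec (fun n => zs (fun m => T m n)) (8 * M)).
{ intros n; apply Rle_trans with (1 := zs_bound _ _ (Hcol n)); lra. }
symmetry; apply (zs_unique _ (8 * M) _ (fun N => N) (64 * M) Dcol); auto.
intros N.
assert (Dpart : forall N, exists M', zdec (fun m => zpart (fun n => T m n) N) M').
{ induction N0 as [|N0 [M' IH]].
  - exists 0; intros m; unfold zpart; simpl; rewrite Cmod_0; lra.
  - eexists; exact (zdec_plus (fun m => zpart (fun n => T m n) N0)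
      (fun m => zpair (fun n => T m n) N0) _ _ IH
      (zdec_plus _ _ _ _ (Hcol (Z.of_nat N0)) (Hcol (- Z.of_nat N0 - 1)%Z))). }
assert (E : forall N, zs (fun m => zpart (fun n => T m n) N) = zpart (fun n => zs (fun m => T m n)) N).
{ induction N0 as [|N0 IH].
  - apply (zs_unique _ 0 _ (fun N => N) 0); auto.
    + intros m; unfold zpart; simpl; rewrite Cmod_0; lra.
    + intros K; assert (Ez : zpart (fun m => zpart (fun n => T m n) 0) K = 0%C).
      { unfold zpart at 1; induction K as [|K IH]; [reflexivity|].
        simpl; rewrite IH; unfold zpair, zpart; simpl; ring. }
      rewrite Ez; change (Cmod (RtoC 0 - RtoC 0)%C <= 0 * exp (- INR K)).
      unfold Cminus; rewrite Cplus_opp_r, Cmod_0; lra.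
  - destruct (Dpart N0) as [M' HM'].
    assert (D2 := zdec_plus _ _ _ _ (Hcol (Z.of_nat N0)) (Hcol (- Z.of_nat N0 - 1)%Z)).
    change (zs (fun m => zpart (fun n => T m n) N0 +
        (T m (Z.of_nat N0) + T m (- Z.of_nat N0 - 1)%Z))%C =
      (zpart (fun n => zs (fun m => T m n)) N0 + zpair (fun n => zs (fun m => T m n)) N0)%C).
    rewrite (zs_plus _ _ _ _ HM' D2), IH.
    rewrite (zs_plus _ _ _ _ (Hcol (Z.of_nat N0)) (Hcol (- Z.of_nat N0 - 1)%Z)).
    reflexivity. }
rewrite <- E.
destruct (Dpart N) as [M' HM'].
assert (Es : (zs (fun m => zs (fun n => T m n)) - zs (fun m => zpart (fun n => T m n) N))%C
  = zs (fun m => (zs (fun n => T m n) + -1 * zpart (fun n => T m n) N)%C)).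
{ rewrite (zs_plus _ _ _ _ Drow (zdec_scal (-1) _ _ HM')), (zs_scal _ _ _ HM'); ring. }
rewrite Es.
replace (64 * M * exp (- INR N)) with (8 * (8 * M * exp (- INR N))) by ring.
apply zs_bound; intros m.
replace (zs (fun n => T m n) + -1 * zpart (fun n => T m n) N)%C
  with (zs (fun n => T m n) - zpart (fun n => T m n) N)%C by ring.
apply Rle_trans with (1 := zs_tail _ _ N (Hrow m)); lra.
Qed.

(** Decay faster than every exponential absorbs the growth of e^(nu z) at any z together with powers
    of nu, so the class is stable under termwise differentiation. *)
Definition rapid (c : Z -> C) : Prop :=
  forall rho, exists M, 0 <= M /\ forall n, Cmod (c n) <= M * exp (- (rho * IZR (Z.abs n))).

Definition linear_growth (nu : Z -> C) (B : R) : Prop :=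
  0 <= B /\ forall n, Cmod (nu n) <= B * (1 + IZR (Z.abs n)).

Definition eser (nu c : Z -> C) (z : C) : C := zs (fun n => c n * cexp (nu n * z))%C.

Lemma IZR_abs_pos (n : Z) : 0 <= IZR (Z.abs n).
Proof. apply IZR_le; lia. Qed.

Lemma rapid_nu nu c B : linear_growth nu B -> rapid c -> rapid (fun n => nu n * c n)%C.
Proof.
intros [HB Hn] Hc rho; destruct (Hc (rho + 1)) as [M [HM H]].
exists (B * M); split; [nra|]; intros n; rewrite Cmod_mult.
assert (T := exp_ineq1_le (IZR (Z.abs n))).
replace (B * M * exp (- (rho * IZR (Z.abs n))))
  with ((B * exp (IZR (Z.abs n))) * (M * exp (- ((rho + 1) * IZR (Z.abs n))))).
- apply Rmult_le_compat; auto using Cmod_ge_0.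
  apply Rle_trans with (1 := Hn n), Rmult_le_compat_l; auto.
- replace (- (rho * IZR (Z.abs n))) with (IZR (Z.abs n) + - ((rho + 1) * IZR (Z.abs n))) by ring.
  rewrite exp_plus; ring.
Qed.

Lemma Cmod_cexp_le (z : C) : Cmod (cexp z) <= exp (Cmod z).
Proof.
rewrite Cmod_cexp; apply exp_le, Rle_trans with (2 := re_le_Cmod z), Rle_abs.
Qed.

Lemma eser_dec nu c B z : linear_growth nu B -> rapid c ->
  exists M, zdec (fun n => c n * cexp (nu n * z))%C M.
Proof.
intros [HB Hn] Hc.
assert (Hz := Cmod_ge_0 z).
destruct (Hc (B * Cmod z + 1)) as [M [HM H]].
exists (M * exp (B * Cmod z)); intros n; rewrite Cmod_mult.
replace (M * exp (B * Cmod z) * exp (- IZR (Z.abs n)))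
  with (M * exp (- ((B * Cmod z + 1) * IZR (Z.abs n))) * exp (B * (1 + IZR (Z.abs n)) * Cmod z)).
- apply Rmult_le_compat; auto using Cmod_ge_0.
  apply Rle_trans with (1 := Cmod_cexp_le _), exp_le; rewrite Cmod_mult.
  apply Rmult_le_compat_r; auto.
- rewrite !Rmult_assoc, <- !exp_plus; do 2 f_equal; ring.
Qed.

Lemma eser_taylor nu c B z : linear_growth nu B -> rapid c ->
  exists K, 0 <= K /\ forall h, Cmod h <= 1 ->
    Cmod (eser nu c (z + h) - eser nu c z - h * eser nu (fun n => nu n * c n) z)%C <= K * Cmod h ^ 2.
Proof.
intros HB Hc.
assert (Hz := Cmod_ge_0 z).
destruct (eser_dec nu c B z HB Hc) as [M0 D0].
destruct (eser_dec nu _ B z HB (rapid_nu nu c B HB Hc)) as [M1 D1].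
generalize HB; intros [HB0 Hn].
(* Budget of the rate: B |z| for e^(nu z), B for e^(nu h) with |h| <= 1, 2 for (1 + |n|)^2 <= e^(2
   |n|) in the Taylor bound, and 1 left for summability. *)
destruct (Hc (B * (Cmod z + 1) + 3)) as [M [HM H]].
set (K := M * (4 * B ^ 2) * exp (B * (Cmod z + 1))).
assert (HK : 0 <= K).
{ unfold K; apply Rmult_le_pos; [|left; apply exp_pos]; apply Rmult_le_pos; auto.
  assert (0 <= B ^ 2) by (apply pow_le; auto); lra. }
exists (8 * K); split; [lra|]; intros h Hh.
destruct (eser_dec nu c B (z + h)%C HB Hc) as [M2 D2].
assert (Hh0 := Cmod_ge_0 h).
assert (E : (eser nu c (z + h) - eser nu c z - h * eser nu (fun n => nu n * c n) z)%C =
  zs (fun n => c n * cexp (nu n * z) * (cexp (nu n * h) - 1 - nu n * h))%C).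
{ unfold eser.
  replace (zs (fun n => c n * cexp (nu n * z) * (cexp (nu n * h) - 1 - nu n * h))%C)
    with (zs (fun n => (c n * cexp (nu n * (z + h)) + -1 * (c n * cexp (nu n * z)))
        + - h * (nu n * c n * cexp (nu n * z)))%C).
  - rewrite (zs_plus _ _ _ _ (zdec_plus _ _ _ _ D2 (zdec_scal (-1) _ _ D0)) (zdec_scal (- h) _ _ D1)).
    rewrite (zs_plus _ _ _ _ D2 (zdec_scal (-1) _ _ D0)), (zs_scal _ _ _ D0), (zs_scal _ _ _ D1); ring.
  - apply zs_ext; intros n.
    replace (nu n * (z + h))%C with (nu n * z + nu n * h)%C by ring; rewrite cexp_plus; ring. }
rewrite E, Rmult_assoc; apply zs_bound; intros n.
rewrite !Cmod_mult.
set (N := IZR (Z.abs n)).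
assert (HN : 0 <= N) by apply IZR_abs_pos.
assert (T1 := exp_ineq1_le N).
assert (Hnh : Cmod (nu n * h) <= B * (1 + N) * Cmod h)
  by (rewrite Cmod_mult; apply Rmult_le_compat_r; auto).
assert (Hnh1 : Cmod (nu n * h) <= B * (1 + N)).
{ apply Rle_trans with (1 := Hnh). rewrite <- Rmult_1_r; apply Rmult_le_compat_l; auto.
  apply Rmult_le_pos; lra. }
assert (P1 : Cmod (cexp (nu n * z)) <= exp (B * (1 + N) * Cmod z)).
{ apply Rle_trans with (1 := Cmod_cexp_le _), exp_le; rewrite Cmod_mult.
  apply Rmult_le_compat_r; auto; apply Hn. }
assert (P2 : Cmod (cexp (nu n * h) - 1 - nu n * h)%C
   <= (4 * B ^ 2) * exp (2 * N) * Cmod h ^ 2 * exp (B * (1 + N))).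
{ apply Rle_trans with (1 := cexp_taylor _).
  apply Rmult_le_compat.
  - assert (0 <= Cmod (nu n * h) ^ 2) by (apply pow_le, Cmod_ge_0); lra.
  - left; apply exp_pos.
  - assert (S1 : Cmod (nu n * h) ^ 2 <= (B * (1 + N) * Cmod h) ^ 2)
      by (apply pow_incr; split; [apply Cmod_ge_0|auto]).
    assert (S2 : (1 + N) ^ 2 <= exp (2 * N)).
    { replace (2 * N) with (N + N) by ring; rewrite exp_plus; nra. }
    replace ((B * (1 + N) * Cmod h) ^ 2) with (B ^ 2 * Cmod h ^ 2 * (1 + N) ^ 2) in S1 by ring.
    assert (0 <= B ^ 2 * Cmod h ^ 2) by (apply Rmult_le_pos; apply pow_le; auto).
    nra.
  - apply exp_le; auto. }
replace (K * Cmod h ^ 2 * exp (- N)) with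
  ((M * exp (- ((B * (Cmod z + 1) + 3) * N))) * exp (B * (1 + N) * Cmod z)
   * ((4 * B ^ 2) * exp (2 * N) * Cmod h ^ 2 * exp (B * (1 + N)))).
- apply Rmult_le_compat; auto using Cmod_ge_0.
  + rewrite <- Cmod_mult; apply Cmod_ge_0.
  + apply Rmult_le_compat; auto using Cmod_ge_0; apply H.
- unfold K.
  replace (exp (- ((B * (Cmod z + 1) + 3) * N)))
    with (exp (- (B * (Cmod z + 1) * N)) * exp (- (2 * N)) * exp (- N))
    by (rewrite <- !exp_plus; f_equal; ring).
  replace (exp (B * (1 + N) * Cmod z)) with (exp (B * Cmod z) * exp (B * N * Cmod z))
    by (rewrite <- !exp_plus; f_equal; ring).
  replace (exp (B * (1 + N))) with (exp B * exp (B * N)) by (rewrite <- exp_plus; f_equal; ring).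
  replace (exp (B * (Cmod z + 1))) with (exp (B * Cmod z) * exp B) by (rewrite <- exp_plus; f_equal; ring).
  assert (X1 : exp (- (2 * N)) * exp (2 * N) = 1) by (rewrite <- exp_plus, Rplus_opp_l, exp_0; auto).
  assert (X2 : exp (- (B * (Cmod z + 1) * N)) * exp (B * N * Cmod z) * exp (B * N) = 1)
    by (rewrite <- !exp_plus; transitivity (exp 0); [f_equal; ring|apply exp_0]).
  transitivity (M * (4 * B ^ 2) * (exp (B * Cmod z) * exp B) * Cmod h ^ 2 * exp (- N)
    * (exp (- (2 * N)) * exp (2 * N))
    * (exp (- (B * (Cmod z + 1) * N)) * exp (B * N * Cmod z) * exp (B * N))); [ring|].
  rewrite X1, X2; ring.
Qed.

(** The constant may depend on z. Real and imaginary increments give the Cauchy-Riemann equations,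
    general ones give continuity. *)
Definition quad_holo (F F' : C -> C) : Prop :=
  forall z, exists K, 0 <= K /\ forall h, Cmod h <= 1 ->
    Cmod (F (z + h) - F z - h * F' z)%C <= K * Cmod h ^ 2.

Lemma quad_holo_holo F F' : quad_holo F F' -> holo F F'.
Proof.
intros H.
assert (Hx : forall x y, exists K, 0 <= K /\ forall t, Rabs t < 1 ->
   Cmod (F ((x + t)%R, y) - F (x, y) - t * F' (x, y))%C <= K * Rabs t ^ 2).
{ intros x y; destruct (H (x, y)) as [K [HK HH]]; exists K; split; auto; intros t Ht.
  specialize (HH (RtoC t)); rewrite Cmod_R in HH.
  replace ((x + t)%R, y) with ((x, y) + RtoC t)%C
    by (unfold Cplus, RtoC; simpl; f_equal; ring).
  apply HH; lra. }
assert (Hy : forall x y, exists K, 0 <= K /\ forall t, Rabs t < 1 ->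
   Cmod (F (x, (y + t)%R) - F (x, y) - (0%R, t) * F' (x, y))%C <= K * Rabs t ^ 2).
{ intros x y; destruct (H (x, y)) as [K [HK HH]]; exists K; split; auto; intros t Ht.
  assert (Em : Cmod (0, t) = Rabs t).
  { replace (0, t) with (Ci * RtoC t)%C by (unfold Cmult, Ci, RtoC; simpl; f_equal; ring).
    rewrite Cmod_mult, Cmod_Ci, Cmod_R; ring. }
  specialize (HH (0, t)); rewrite Em in HH.
  replace (x, (y + t)%R) with ((x, y) + (0, t))%C
    by (unfold Cplus; simpl; f_equal; ring).
  apply HH; lra. }
split; intros x y; split.
- destruct (Hx x y) as [K [HK HH]].
  apply (is_derive_quadratic_bound _ x _ 1 K Rlt_0_1 HK); intros t Ht.
  apply Rle_trans with (2 := HH t Ht), Rle_trans with (2 := re_le_Cmod _).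
  right; f_equal; unfold re_of, Re; simpl; ring.
- destruct (Hy x y) as [K [HK HH]].
  apply (is_derive_quadratic_bound _ y _ 1 K Rlt_0_1 HK); intros t Ht.
  apply Rle_trans with (2 := HH t Ht), Rle_trans with (2 := re_le_Cmod _).
  right; f_equal; unfold re_of, im_of, Re, Im; simpl; ring.
- destruct (Hx x y) as [K [HK HH]].
  apply (is_derive_quadratic_bound _ x _ 1 K Rlt_0_1 HK); intros t Ht.
  apply Rle_trans with (2 := HH t Ht), Rle_trans with (2 := im_le_Cmod _).
  right; f_equal; unfold im_of, Im; simpl; ring.
- destruct (Hy x y) as [K [HK HH]].
  apply (is_derive_quadratic_bound _ y _ 1 K Rlt_0_1 HK); intros t Ht.
  apply Rle_trans with (2 := HH t Ht), Rle_trans with (2 := im_le_Cmod _).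
  right; f_equal; unfold re_of, im_of, Re, Im; simpl; ring.
Qed.

Lemma quad_holo_cont F F' : quad_holo F F' -> cont2 (re_of F) /\ cont2 (im_of F).
Proof.
intros H.
assert (Hc : forall x y (eps : posreal), exists d : posreal, forall u v,
   Rabs (u - x) < d -> Rabs (v - y) < d -> Cmod (F (u, v) - F (x, y))%C < eps).
{ intros x y eps; destruct (H (x, y)) as [K [HK HH]].
  set (L := Cmod (F' (x, y)) + K + 1).
  assert (HL : 0 < L) by (unfold L; assert (T := Cmod_ge_0 (F' (x, y))); lra).
  assert (Hd : 0 < Rmin (/ 2) (eps / (2 * L))).
  { apply Rmin_pos; [lra|]; apply Rdiv_lt_0_compat; [apply eps|lra]. }
  exists (mkposreal _ Hd); simpl; intros u v Hu Hv.
  set (h := ((u - x)%R, (v - y)%R) : C).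
  assert (Hh : Cmod h < 2 * Rmin (/ 2) (eps / (2 * L))).
  { apply Rle_lt_trans with (1 := Cmod_le_sum h); unfold h; simpl; lra. }
  assert (M1 := Rmin_l (/ 2) (eps / (2 * L))); assert (M2 := Rmin_r (/ 2) (eps / (2 * L))).
  assert (Hh1 : Cmod h <= 1) by lra.
  assert (Hh2 : Cmod h * L < eps).
  { apply Rlt_div_r; auto. replace (eps / L) with (2 * (eps / (2 * L))) by (field; lra). lra. }
  specialize (HH h Hh1).
  replace ((x, y) + h)%C with ((u, v) : C) in HH by (unfold h, Cplus; simpl; f_equal; ring).
  replace (F (u, v) - F (x, y))%C with
    ((F (u, v) - F (x, y) - h * F' (x, y)) + h * F' (x, y))%C by ring.
  apply Rle_lt_trans with (1 := Cmod_triangle _ _); rewrite (Cmod_mult h).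
  apply Rle_lt_trans with (2 := Hh2); unfold L.
  assert (0 <= Cmod h) by apply Cmod_ge_0.
  assert (Cmod h ^ 2 <= Cmod h) by (simpl; nra).
  nra. }
split; intros x y; apply (proj1 (continuity_2d_pt_filterlim _ x y)); intros eps;
  destruct (Hc x y eps) as [d Hd]; exists d; intros u v Hu Hv;
  apply Rle_lt_trans with (2 := Hd u v Hu Hv).
- apply Rle_trans with (2 := re_le_Cmod _); right; f_equal; unfold re_of.
- apply Rle_trans with (2 := im_le_Cmod _); right; f_equal; unfold im_of.
Qed.

Lemma eser_quad_holo nu c B : linear_growth nu B -> rapid c ->
  quad_holo (eser nu c) (eser nu (fun n => nu n * c n)%C).
Proof. intros HB Hc z; apply (eser_taylor nu c B z HB Hc). Qed.

(** The derivative is again an exponential series with rapid coefficients, so the induction on the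
    order runs over all coefficient families at once. *)
Lemma eser_csmooth nu c B : linear_growth nu B -> rapid c -> csmooth (eser nu c).
Proof.
intros HB Hc.
enough (Hn : forall n c, rapid c -> smoothn n (re_of (eser nu c)) /\ smoothn n (im_of (eser nu c)))
  by (split; apply smooth2_smoothn; intros n; apply (Hn n c Hc)).
clear c Hc; induction n as [|n IH]; intros c Hc.
- destruct (quad_holo_cont _ _ (eser_quad_holo nu c B HB Hc)); split; split; auto.
- destruct (quad_holo_cont _ _ (eser_quad_holo nu c B HB Hc)) as [C1 C2].
  destruct (quad_holo_holo _ _ (eser_quad_holo nu c B HB Hc)) as [P1 P2].
  destruct (IH _ (rapid_nu nu c B HB Hc)) as [S1 S2].
  split; split; auto; do 2 eexists; split; [exact P1| |exact P2|]; split; auto.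
  apply smoothn_opp; auto.
Qed.

(** * Theta functions *)

(** The function e^(pi i w). Odd integers give -1, so signs (-1)^n are absorbed into the
    exponent. *)
Definition ee (w : C) : C := cexp ((0, PI) * w)%C.

Lemma ee_plus (z w : C) : ee (z + w)%C = (ee z * ee w)%C.
Proof. unfold ee; rewrite Cmult_plus_distr_l; apply cexp_plus. Qed.

Lemma ee_neq0 (z : C) : ee z <> 0%C.
Proof. apply cexp_neq0. Qed.

Lemma ee_0 : ee 0%C = 1%C.
Proof. unfold ee; rewrite Cmult_0_r; apply cexp_0. Qed.

Lemma Cmod_ee (z : C) : Cmod (ee z) = exp (- (PI * Im z)).
Proof. unfold ee; rewrite Cmod_cexp; f_equal; unfold Re, Im; simpl; ring. Qed.

Lemma ee_even (n : Z) : ee (RtoC (2 * IZR n)) = 1%C.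
Proof.
unfold ee, cexp; simpl.
replace (0 * (2 * IZR n) - PI * 0) with 0 by ring.
replace (0 * 0 + PI * (2 * IZR n)) with (2 * (IZR n * PI)) by ring.
rewrite exp_0, cos_2a_sin, sin_2a, sin_eq_0_1 by (exists n; auto).
apply injective_projections; simpl; ring.
Qed.

Lemma ee_1 : ee (RtoC 1) = (- (1))%C.
Proof.
unfold ee, cexp; simpl.
replace (0 * 1 - PI * 0) with 0 by ring.
replace (0 * 0 + PI * 1) with PI by ring.
rewrite exp_0, cos_PI, sin_PI; apply injective_projections; simpl; ring.
Qed.

Lemma ee_odd (n : Z) : ee (RtoC (2 * IZR n + 1)) = (- (1))%C.
Proof. rewrite RtoC_plus, ee_plus, ee_even, ee_1; ring. Qed.

Lemma ee_eq1 (z : C) : ee z = 1%C -> exists k : Z, z = RtoC (2 * IZR k).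
Proof.
intros H; apply cexp_eq1 in H; destruct H as [H1 [k Hk]]; exists k.
assert (HP := PI_RGT_0); destruct z as [x y]; simpl in *.
apply injective_projections; simpl; apply Rmult_eq_reg_l with PI; lra.
Qed.

Lemma quadratic_below (A B x : R) : 0 < A -> - (A * x ^ 2) + B * Rabs x <= B ^ 2 / (4 * A).
Proof.
intros HA; rewrite <- (pow2_abs x); set (t := Rabs x).
assert (H : 0 <= A * (t - B / (2 * A)) ^ 2) by (apply Rmult_le_pos; [lra|apply pow2_ge_0]).
replace (A * (t - B / (2 * A)) ^ 2) with (A * t ^ 2 - B * t + B ^ 2 / (4 * A)) in H by (field; lra).
lra.
Qed.

(** The sum of exp(pi i (k (n+d)^2 tau + e n + l (n+d) z)) over the integers n, a Jacobi theta
    series with characteristic [d], [e]. *)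
Definition tht (tau : C) (k d e l : R) (z : C) : C :=
  eser (fun n => (0, PI) * RtoC (l * (IZR n + d)))%C
       (fun n => ee (tau * RtoC (k * (IZR n + d) ^ 2) + RtoC (e * IZR n)))%C z.

Definition tht_term (tau : C) (k d e l : R) (z : C) (n : Z) : C :=
  ee (tau * RtoC (k * (IZR n + d) ^ 2) + RtoC (e * IZR n) + RtoC (l * (IZR n + d)) * z)%C.

Lemma tht_zs tau k d e l z : tht tau k d e l z = zs (tht_term tau k d e l z).
Proof.
apply zs_ext; intros n; unfold tht_term.
rewrite (ee_plus (_ + _)); unfold ee at 3; f_equal; f_equal; ring.
Qed.

(** Gaussian decay beats any exponential, by completing the square; the shift [d] costs at most 1 in
    |n|. *)
Lemma tht_rapid tau k d e : 0 < Im tau -> 0 < k -> 0 <= d <= 1 ->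
  rapid (fun n => ee (tau * RtoC (k * (IZR n + d) ^ 2) + RtoC (e * IZR n)))%C.
Proof.
intros Ht Hk Hd rho.
assert (HP := PI_RGT_0).
set (A := PI * (Im tau * k)).
assert (HA : 0 < A) by (unfold A; apply Rmult_lt_0_compat; auto; apply Rmult_lt_0_compat; auto).
exists (exp (Rabs rho + Rabs rho ^ 2 / (4 * A))); split; [left; apply exp_pos|]; intros n.
rewrite Cmod_ee, <- exp_plus; apply exp_le.
replace (Im (tau * RtoC (k * (IZR n + d) ^ 2) + RtoC (e * IZR n))%C)
  with (Im tau * k * (IZR n + d) ^ 2) by (destruct tau; simpl; ring).
assert (Q := quadratic_below A (Rabs rho) (IZR n + d) HA).
assert (T : IZR (Z.abs n) <= Rabs (IZR n + d) + 1).
{ rewrite abs_IZR; unfold Rabs; destruct (Rcase_abs (IZR n)), (Rcase_abs (IZR n + d)); lra. }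
assert (T2 : rho * IZR (Z.abs n) <= Rabs rho * IZR (Z.abs n))
  by (apply Rmult_le_compat_r; [apply IZR_abs_pos|apply Rle_abs]).
assert (T3 : Rabs rho * IZR (Z.abs n) <= Rabs rho * (Rabs (IZR n + d) + 1))
  by (apply Rmult_le_compat_l; [apply Rabs_pos|auto]).
unfold A in Q at 1; lra.
Qed.

Lemma tht_growth d l : 0 <= d <= 1 ->
  linear_growth (fun n => (0, PI) * RtoC (l * (IZR n + d)))%C (PI * Rabs l).
Proof.
intros Hd; assert (HP := PI_RGT_0); split.
- apply Rmult_le_pos; [lra|apply Rabs_pos].
- intros n; rewrite Cmod_mult, Cmod_R, Rabs_mult, <- Rmult_assoc.
  replace (Cmod (0, PI)) with PI.
  + apply Rmult_le_compat_l; [apply Rmult_le_pos; [lra|apply Rabs_pos]|].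
    rewrite abs_IZR; unfold Rabs; destruct (Rcase_abs (IZR n)), (Rcase_abs (IZR n + d)); lra.
  + replace (0, PI) with (Ci * RtoC PI)%C by (unfold Cmult, Ci, RtoC; simpl; f_equal; ring).
    rewrite Cmod_mult, Cmod_Ci, Cmod_R, Rabs_pos_eq; lra.
Qed.

Lemma tht_dec tau k d e l z : 0 < Im tau -> 0 < k -> 0 <= d <= 1 ->
  exists M, zdec (tht_term tau k d e l z) M.
Proof.
intros Ht Hk Hd.
destruct (eser_dec _ _ _ z (tht_growth d l Hd) (tht_rapid tau k d e Ht Hk Hd)) as [M H].
exists M; intros n.
apply Rle_trans with (2 := H n); right; f_equal; unfold tht_term.
rewrite (ee_plus (_ + _)); unfold ee at 2; f_equal; f_equal; ring.
Qed.

(** [S1] is Jacobi's theta_1 up to the factor i; [B2] and [D2] are theta_3 and theta_2 at (2 z, 2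
    tau), through which the addition formula expresses products of two translates of [S1]. *)
Definition S1 (tau z : C) : C := tht tau 1 (1 / 2) 1 2 z.
Definition B2 (tau z : C) : C := tht tau 2 0 0 4 z.
Definition D2 (tau z : C) : C := tht tau 2 (1 / 2) 0 4 z.

Lemma zs_reflect u : zs (fun n => u (- n - 1)%Z) = zs u.
Proof.
unfold zs; f_equal; apply functional_extensionality; intros k; unfold zpair.
replace (- (- Z.of_nat k - 1) - 1)%Z with (Z.of_nat k) by lia; ring.
Qed.

(** The reflection n -> -n-1 changes the sign of n + 1/2 and that of (-1)^n. *)
Lemma S1_odd tau z : 0 < Im tau -> S1 tau (- z)%C = (- S1 tau z)%C.
Proof.
intros Ht; unfold S1; rewrite !tht_zs.
destruct (tht_dec tau 1 (1 / 2) 1 2 z Ht ltac:(lra) ltac:(lra)) as [M H].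
rewrite <- (zs_reflect (tht_term tau 1 (1 / 2) 1 2 (- z))).
replace (- zs (tht_term tau 1 (1 / 2) 1 2 z))%C with (- (1) * zs (tht_term tau 1 (1 / 2) 1 2 z))%C by ring.
rewrite <- (zs_scal _ _ _ H); apply zs_ext; intros n; unfold tht_term.
rewrite <- (ee_odd (- n - 1)), <- ee_plus; f_equal.
rewrite minus_IZR, opp_IZR.
apply injective_projections; destruct tau, z; simpl; field.
Qed.

Lemma S1_0 tau : 0 < Im tau -> S1 tau 0%C = 0%C.
Proof.
intros Ht; assert (H := S1_odd tau 0%C Ht).
assert (E0 : Copp (RtoC 0) = RtoC 0) by ring; rewrite E0 in H.
assert (E : (2 * S1 tau 0 = 0)%C).
{ replace (2 * S1 tau 0)%C with (S1 tau 0 + S1 tau 0)%C by ring. rewrite H at 1; ring. }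
replace (S1 tau 0%C) with (/ 2 * (2 * S1 tau 0))%C.
- rewrite E; ring.
- field; intros E2; apply RtoC_inj in E2; lra.
Qed.

(** General term of S1 (x + y) S1 (x - y), with the second index n replaced by M = m + n + 1; the
    coefficient of [x] then depends on [M] alone. *)
Definition pair_term (tau x y : C) (m M : Z) : C :=
  ee (tau * RtoC ((IZR m + 1 / 2) ^ 2 + (IZR M - IZR m - 1 / 2) ^ 2)
      + RtoC (2 * IZR M) * x + RtoC (2 * (2 * IZR m + 1 - IZR M)) * y + RtoC (IZR M - 1))%C.

(** The form p^2 + (q - p)^2 dominates (p^2 + q^2) / 3, so the Gaussian beats the linear terms in
    both indices. The bound has the product shape required by [zs_fubini]. *)
Lemma pair_term_bound tau x y : 0 < Im tau ->
  exists K, forall m M, Cmod (pair_term tau x y m M) <= K * exp (- IZR (Z.abs m)) * exp (- IZR (Z.abs M)).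
Proof.
intros Ht; assert (HP := PI_RGT_0).
set (A := PI * Im tau / 3).
set (B := PI * (2 * Rabs (Im x) + 4 * Rabs (Im y)) + 1).
assert (HA : 0 < A) by (unfold A; apply Rdiv_lt_0_compat; [apply Rmult_lt_0_compat; auto|lra]).
exists (exp (B ^ 2 / (4 * A) + B ^ 2 / (4 * A) + 1)); intros m M.
unfold pair_term; rewrite Cmod_ee, <- !exp_plus; apply exp_le.
set (p := IZR m + 1 / 2); set (q := IZR M).
assert (Em : IZR m = p - 1 / 2) by (unfold p; ring).
match goal with |- - (PI * Im ?w) <= _ =>
  replace (Im w) with (Im tau * (p ^ 2 + (q - p) ^ 2) + 2 * q * Im x + 2 * (2 * p - q) * Im y)
   by (rewrite Em; destruct tau, x, y; simpl; field) end.
assert (Q1 := quadratic_below A B p HA); assert (Q2 := quadratic_below A B q HA).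
assert (Hm : IZR (Z.abs m) <= Rabs p + 1).
{ rewrite abs_IZR, Em; unfold Rabs; destruct (Rcase_abs (p - 1 / 2)), (Rcase_abs p); lra. }
assert (HM : IZR (Z.abs M) = Rabs q) by (rewrite abs_IZR; auto).
rewrite HM.
assert (G : (p ^ 2 + q ^ 2) / 3 <= p ^ 2 + (q - p) ^ 2).
{ assert (0 <= (q - 3 / 2 * p) ^ 2) by apply pow2_ge_0. assert (0 <= p ^ 2) by apply pow2_ge_0. nra. }
assert (G2 : A * (p ^ 2 + q ^ 2) <= PI * (Im tau * (p ^ 2 + (q - p) ^ 2))).
{ unfold A. replace (PI * Im tau / 3 * (p ^ 2 + q ^ 2)) with (PI * (Im tau * ((p ^ 2 + q ^ 2) / 3))) by field.
  apply Rmult_le_compat_l; [lra|]; apply Rmult_le_compat_l; lra. }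
assert (L : - (2 * q * Im x + 2 * (2 * p - q) * Im y)
   <= (2 * Rabs (Im x) + 4 * Rabs (Im y)) * Rabs p + (2 * Rabs (Im x) + 4 * Rabs (Im y)) * Rabs q).
{ assert (X1 := Rle_abs (- (q * Im x))); rewrite Rabs_Ropp, Rabs_mult in X1.
  assert (X2 := Rle_abs (- (p * Im y))); rewrite Rabs_Ropp, Rabs_mult in X2.
  assert (X3 := Rle_abs (q * Im y)); rewrite Rabs_mult in X3.
  assert (0 <= Rabs (Im x)) by apply Rabs_pos; assert (0 <= Rabs (Im y)) by apply Rabs_pos.
  assert (0 <= Rabs p) by apply Rabs_pos; assert (0 <= Rabs q) by apply Rabs_pos.
  nra. }
apply Rmult_le_compat_l with (r := PI) in L; [|lra].
unfold B in *; lra.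
Qed.

(* Writing [M = m + n + 1] in the double series of the left-hand side, the terms with [M] even
   and odd separate the variables [x] and [y]. *)
Lemma S1_addition tau x y : 0 < Im tau ->
  (S1 tau (x + y) * S1 tau (x - y) = D2 tau x * B2 tau y - B2 tau x * D2 tau y)%C.
Proof.
intros Ht; unfold S1, D2, B2; rewrite !tht_zs.
destruct (tht_dec tau 1 (1 / 2) 1 2 (x + y) Ht ltac:(lra) ltac:(lra)) as [M1 H1].
destruct (tht_dec tau 1 (1 / 2) 1 2 (x - y) Ht ltac:(lra) ltac:(lra)) as [M2 H2].
destruct (tht_dec tau 2 0 0 4 x Ht ltac:(lra) ltac:(lra)) as [M3 H3].
destruct (tht_dec tau 2 0 0 4 y Ht ltac:(lra) ltac:(lra)) as [M4 H4].
destruct (tht_dec tau 2 (1 / 2) 0 4 x Ht ltac:(lra) ltac:(lra)) as [M5 H5].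
destruct (tht_dec tau 2 (1 / 2) 0 4 y Ht ltac:(lra) ltac:(lra)) as [M6 H6].
destruct (pair_term_bound tau x y Ht) as [K HK].
assert (Hcol : forall n, zdec (fun m => pair_term tau x y m n) (K * exp (- IZR (Z.abs n)))).
{ intros n m; apply Rle_trans with (1 := HK m n); lra. }
assert (HK0 : 0 <= K).
{ assert (T := zdec_nonneg _ _ (Hcol 0%Z)). simpl in T.
  rewrite Ropp_0, exp_0, Rmult_1_r in T; auto. }
assert (Dcol : zdec (fun n => zs (fun m => pair_term tau x y m n)) (8 * K)).
{ intros n; apply Rle_trans with (1 := zs_bound _ _ (Hcol n)); lra. }
transitivity (zs (fun m => zs (fun M => pair_term tau x y m M))).
{ rewrite Cmult_comm, <- (zs_scal _ _ _ H1); apply zs_ext; intros m.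
  rewrite Cmult_comm, <- (zs_shift _ _ (- m - 1) H2).
  rewrite <- (zs_scal _ _ _ (zdec_shift _ _ _ H2)); apply zs_ext; intros n.
  unfold tht_term, pair_term; rewrite <- ee_plus; f_equal.
  rewrite !plus_IZR, minus_IZR, opp_IZR.
  apply injective_projections; destruct tau, x, y; simpl; field. }
rewrite (zs_fubini _ K HK).
rewrite (zs_even_odd _ _ Dcol).
assert (E1 : zs (fun n => zs (fun m => pair_term tau x y m (2 * n))) =
   (- (zs (tht_term tau 2 0 0 4 x) * zs (tht_term tau 2 (1 / 2) 0 4 y)))%C).
{ replace (- (zs (tht_term tau 2 0 0 4 x) * zs (tht_term tau 2 (1 / 2) 0 4 y)))%C
    with ((- zs (tht_term tau 2 (1 / 2) 0 4 y)) * zs (tht_term tau 2 0 0 4 x))%C by ring.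
  rewrite <- (zs_scal _ _ _ H3); apply zs_ext; intros i.
  rewrite <- (zs_shift _ _ i (Hcol (2 * i)%Z)).
  replace (- zs (tht_term tau 2 (1 / 2) 0 4 y) * tht_term tau 2 0 0 4 x i)%C
    with ((- (1) * tht_term tau 2 0 0 4 x i) * zs (tht_term tau 2 (1 / 2) 0 4 y))%C by ring.
  rewrite <- (zs_scal _ _ _ H6); apply zs_ext; intros j.
  rewrite <- (ee_odd (i - 1)).
  unfold tht_term, pair_term; rewrite <- !ee_plus; f_equal.
  rewrite minus_IZR, plus_IZR, mult_IZR.
  apply injective_projections; destruct tau, x, y; simpl; field. }
assert (E2 : zs (fun n => zs (fun m => pair_term tau x y m (2 * n + 1))) =
   (zs (tht_term tau 2 (1 / 2) 0 4 x) * zs (tht_term tau 2 0 0 4 y))%C).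
{ rewrite Cmult_comm.
  rewrite <- (zs_scal _ _ _ H5); apply zs_ext; intros i.
  rewrite <- (zs_shift _ _ i (Hcol (2 * i + 1)%Z)).
  rewrite Cmult_comm.
  rewrite <- (zs_scal _ _ _ H4); apply zs_ext; intros j.
  rewrite <- (Cmult_1_l (tht_term tau 2 (1 / 2) 0 4 x i)).
  rewrite <- (ee_even i).
  unfold tht_term, pair_term; rewrite <- !ee_plus; f_equal.
  rewrite !plus_IZR, mult_IZR.
  apply injective_projections; destruct tau, x, y; simpl; field. }
rewrite E1, E2; ring.
Qed.

(** * The finite triple product *)

Fixpoint Cprod (f : nat -> C) (n : nat) : C :=
  match n with O => 1%C | S k => (Cprod f k * f k)%C end.

Lemma Cprod_ext f g n : (forall i, (i < n)%nat -> f i = g i) -> Cprod f n = Cprod g n.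
Proof.
induction n as [|n IH]; intros H; simpl; auto.
rewrite IH by (intros; apply H; lia); rewrite H by lia; auto.
Qed.

Lemma Cprod_add f m n : Cprod f (m + n) = (Cprod f m * Cprod (fun i => f (m + i)%nat) n)%C.
Proof.
induction n as [|n IH]; [rewrite Nat.add_0_r; simpl; ring|].
rewrite Nat.add_succ_r; simpl; rewrite IH; ring.
Qed.

Lemma Cprod_mult f g n : Cprod (fun i => f i * g i)%C n = (Cprod f n * Cprod g n)%C.
Proof. induction n as [|n IH]; simpl; [ring|]; rewrite IH; ring. Qed.

Lemma Cprod_rev f n : Cprod f n = Cprod (fun i => f (n - 1 - i)%nat) n.
Proof.
revert f; induction n as [|n IH]; intros f; auto.
rewrite (Cprod_add (fun i => f (S n - 1 - i)%nat) 1 n : Cprod _ (S n) = _).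
rewrite (Cprod_ext _ (fun i => f (n - 1 - i)%nat) n) by (intros; f_equal; lia).
rewrite <- IH; simpl; replace (n - 0 - 0)%nat with n by lia; ring.
Qed.

Lemma Cmod_sub_ge (x : C) : 1 - Cmod x <= Cmod (1 - x)%C.
Proof.
assert (H := Cmod_triangle (1 - x) x).
replace (1 - x + x)%C with (RtoC 1) in H by ring; rewrite Cmod_1 in H; lra.
Qed.

Lemma Cmod_sub_le (x : C) : Cmod (1 - x)%C <= 1 + Cmod x.
Proof.
assert (H := Cmod_triangle 1 (- x)); rewrite Cmod_opp, Cmod_1 in H; exact H.
Qed.

Lemma Cprod_neq0 (f : nat -> C) n : (forall i, f i <> 0%C) -> Cprod f n <> 0%C.
Proof.
intros H; induction n as [|n IH]; simpl.
- intros E; apply RtoC_inj in E; lra.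
- apply Cmult_neq_0; [exact IH|exact (H n)].
Qed.

Lemma geom_partial (rho : R) (n : nat) : 0 < rho < 1 ->
  sum_f_R0 (fun i => rho ^ i) n <= / (1 - rho).
Proof.
intros H; rewrite tech3 by lra.
unfold Rdiv; rewrite <- (Rmult_1_l (/ (1 - rho))) at 2; apply Rmult_le_compat_r.
- left; apply Rinv_0_lt_compat; lra.
- assert (0 < rho ^ S n) by (apply pow_lt; lra); lra.
Qed.

(** Each factor is at most 1 + |x| <= e^|x|, and the exponents sum to a geometric series. *)
Lemma Cprod_upper (x : nat -> C) (X rho : R) : 0 < rho < 1 -> 0 <= X ->
  (forall i, Cmod (x i) <= X * rho ^ i) ->
  exists Cb, 0 < Cb /\ forall N, Cmod (Cprod (fun i => 1 - x i)%C N) <= Cb.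
Proof.
intros Hr HX Hx.
exists (exp (X * / (1 - rho))); split; [apply exp_pos|].
assert (H : forall N, Cmod (Cprod (fun i => 1 - x i)%C (S N)) <= exp (X * sum_f_R0 (fun i => rho ^ i) N)).
{ induction N as [|N IH].
  - change (Cmod (1 * (1 - x O))%C <= exp (X * rho ^ 0)).
    rewrite Cmult_1_l; apply Rle_trans with (1 := Cmod_sub_le _).
    assert (T := Hx O); assert (E := exp_ineq1_le (X * rho ^ 0)); lra.
  - change (Cprod (fun i => 1 - x i)%C (S (S N)))
      with (Cprod (fun i => 1 - x i)%C (S N) * (1 - x (S N)))%C.
    rewrite Cmod_mult, tech5, Rmult_plus_distr_l, exp_plus.
    apply Rmult_le_compat; auto using Cmod_ge_0.
    apply Rle_trans with (1 := Cmod_sub_le _).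
    assert (T := Hx (S N)); assert (E := exp_ineq1_le (X * rho ^ S N)); lra. }
intros [|N].
- simpl; rewrite Cmod_1; apply Rle_trans with (exp 0); [rewrite exp_0; lra|].
  apply exp_le, Rmult_le_pos; auto.
  left; apply Rinv_0_lt_compat; lra.
- apply Rle_trans with (1 := H N), exp_le, Rmult_le_compat_l; auto; apply geom_partial, Hr.
Qed.

(** From some [M] on, the remaining moduli sum to at most 1/2, and a tail product is at least 1
    minus that sum; the finitely many earlier partial products are non-zero and have a positive
    minimum. *)
Lemma Cprod_lower (x : nat -> C) (X rho : R) : 0 < rho < 1 -> 0 <= X ->
  (forall i, Cmod (x i) <= X * rho ^ i) -> (forall i, x i <> 1%C) ->
  exists c, 0 < c /\ forall N, c <= Cmod (Cprod (fun i => 1 - x i)%C N).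
Proof.
intros Hr HX Hx Hne.
assert (Hg : 0 < / (1 - rho)) by (apply Rinv_0_lt_compat; lra).
assert (HM : exists M, X * rho ^ M * / (1 - rho) <= / 2).
{ assert (He : 0 < / 2 / (X * / (1 - rho) + 1)) by (apply Rdiv_lt_0_compat; nra).
  destruct (pow_lt_1_zero rho ltac:(rewrite Rabs_pos_eq; lra) _ He) as [M HM].
  exists M; specialize (HM M (le_n M)); rewrite Rabs_pos_eq in HM by (apply pow_le; lra).
  apply Rlt_div_r in HM; [|nra].
  assert (0 < rho ^ M) by (apply pow_lt; lra).
  assert (0 <= X * / (1 - rho)) by nra. nra. }
destruct HM as [M HM].
assert (HrM : 0 < rho ^ M) by (apply pow_lt; lra).
assert (Htail : forall n, 1 - X * rho ^ M * sum_f_R0 (fun i => rho ^ i) n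
   <= Cmod (Cprod (fun i => 1 - x (M + i)%nat)%C (S n))).
{ assert (Hb : forall i, Cmod (x (M + i)%nat) <= X * rho ^ M * rho ^ i).
  { intros i; apply Rle_trans with (1 := Hx _); rewrite pow_add; lra. }
  assert (Hle : forall n, X * rho ^ M * sum_f_R0 (fun i => rho ^ i) n <= / 2).
  { intros n; apply Rle_trans with (2 := HM), Rmult_le_compat_l; [nra|apply geom_partial, Hr]. }
  induction n as [|n IH].
  - change (1 - X * rho ^ M * rho ^ 0 <= Cmod (1 * (1 - x (M + 0)%nat))%C).
    rewrite Cmult_1_l; apply Rle_trans with (2 := Cmod_sub_ge _).
    specialize (Hb O); lra.
  - change (Cprod (fun i => 1 - x (M + i)%nat)%C (S (S n)))
      with (Cprod (fun i => 1 - x (M + i)%nat)%C (S n) * (1 - x (M + S n)%nat))%C.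
    rewrite Cmod_mult, tech5.
    assert (T := Cmod_sub_ge (x (M + S n)%nat)); specialize (Hb (S n)).
    assert (L1 := Hle n); assert (L2 := Hle (S n)); rewrite tech5 in L2.
    set (s := X * rho ^ M * sum_f_R0 (fun i => rho ^ i) n) in *.
    set (t := X * rho ^ M * rho ^ S n) in *.
    rewrite Rmult_plus_distr_l in L2 |- *; fold s t in L2 |- *.
    assert (0 <= s).
    { unfold s; apply Rmult_le_pos; [nra|]. apply cond_pos_sum; intros; apply pow_le; lra. }
    assert (0 <= t) by (unfold t; apply Rmult_le_pos; [nra|apply pow_le; lra]).
    assert (0 <= s * t) by nra.
    apply Rle_trans with ((1 - s) * (1 - t)); [nra|].
    apply Rmult_le_compat; lra. }
assert (Hpos : forall N, 0 < Cmod (Cprod (fun i => 1 - x i)%C N)).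
{ intros N; apply Cmod_gt_0, Cprod_neq0; intros i E; apply (Hne i).
  replace (x i) with (1 - (1 - x i))%C by ring; rewrite E; ring. }
assert (Hmin : forall L, exists c, 0 < c /\ forall N, (N <= L)%nat -> c <= Cmod (Cprod (fun i => 1 - x i)%C N)).
{ induction L as [|L [c [Hc IH]]].
  - exists 1; split; [lra|]; intros N HN; assert (N = O) by lia; subst; simpl; rewrite Cmod_1; lra.
  - exists (Rmin c (Cmod (Cprod (fun i => 1 - x i)%C (S L)))); split; [apply Rmin_pos; auto|].
    intros N HN; destruct (Nat.eq_dec N (S L)) as [->|HN'].
    + apply Rmin_r.
    + apply Rle_trans with (1 := Rmin_l _ _), IH; lia. }
destruct (Hmin M) as [c [Hc HcM]].
exists (c / 2); split; [lra|]; intros N.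
destruct (le_lt_dec N M) as [HN|HN].
- specialize (HcM N HN); lra.
- replace N with (M + S (N - M - 1))%nat by lia.
  rewrite Cprod_add, Cmod_mult.
  assert (T := Htail (N - M - 1)%nat).
  assert (L : X * rho ^ M * sum_f_R0 (fun i => rho ^ i) (N - M - 1) <= / 2).
  { apply Rle_trans with (2 := HM), Rmult_le_compat_l; [nra|apply geom_partial, Hr]. }
  specialize (HcM M (le_n M)).
  set (P := Cmod (Cprod (fun i => 1 - x i)%C M)) in *.
  set (Q := Cmod (Cprod (fun i => 1 - x (M + i)%nat)%C (S (N - M - 1)))) in *.
  nra.
Qed.

Lemma Cprod_cauchy (x : nat -> C) (X rho : R) : 0 < rho < 1 -> 0 <= X ->
  (forall i, Cmod (x i) <= X * rho ^ i) ->
  exists K, 0 <= K /\ forall N m,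
    Cmod (Cprod (fun i => 1 - x i)%C (N + m) - Cprod (fun i => 1 - x i)%C N)%C <= K * rho ^ N.
Proof.
intros Hr HX Hx.
destruct (Cprod_upper x X rho Hr HX Hx) as [Cb [HC HU]].
assert (Hg : 0 < / (1 - rho)) by (apply Rinv_0_lt_compat; lra).
exists (Cb * X * / (1 - rho)); split; [apply Rmult_le_pos; nra|]; intros N m.
assert (H : forall m, Cmod (Cprod (fun i => 1 - x i)%C (N + S m) - Cprod (fun i => 1 - x i)%C N)%C
   <= Cb * X * rho ^ N * sum_f_R0 (fun i => rho ^ i) m).
{ assert (Hstep : forall i, Cmod (Cprod (fun i => 1 - x i)%C (S i) - Cprod (fun i => 1 - x i)%C i)%C
     <= Cb * X * rho ^ i).
  { intros i; simpl.
    replace (Cprod (fun i => 1 - x i) i * (1 - x i) - Cprod (fun i => 1 - x i) i)%C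
      with (- (Cprod (fun i => 1 - x i) i * x i))%C by ring.
    rewrite Cmod_opp, Cmod_mult, Rmult_assoc; apply Rmult_le_compat; auto using Cmod_ge_0. }
  induction m0 as [|m0 IH].
  - rewrite Nat.add_1_r; simpl sum_f_R0; rewrite Rmult_1_r; apply Hstep.
  - rewrite tech5, Rmult_plus_distr_l.
    replace (Cprod (fun i => 1 - x i) (N + S (S m0)) - Cprod (fun i => 1 - x i) N)%C
     with ((Cprod (fun i => 1 - x i) (N + S m0) - Cprod (fun i => 1 - x i) N)
       + (Cprod (fun i => 1 - x i) (N + S (S m0)) - Cprod (fun i => 1 - x i) (N + S m0)))%C by ring.
    apply Rle_trans with (1 := Cmod_triangle _ _), Rplus_le_compat; auto.
    replace (N + S (S m0))%nat with (S (N + S m0)) by lia.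
    apply Rle_trans with (1 := Hstep _); rewrite pow_add; lra. }
destruct m as [|m].
- rewrite Nat.add_0_r; unfold Cminus; rewrite Cplus_opp_r, Cmod_0.
  apply Rmult_le_pos; [apply Rmult_le_pos; nra|apply pow_le; lra].
- apply Rle_trans with (1 := H m).
  replace (Cb * X * / (1 - rho) * rho ^ N) with (Cb * X * rho ^ N * / (1 - rho)) by ring.
  apply Rmult_le_compat_l; [|apply geom_partial, Hr].
  apply Rmult_le_pos; [nra|apply pow_le; lra].
Qed.

(** The power q^r of q = e^(2 pi i tau), with a real exponent so that differences of indices avoid
    subtraction of naturals. *)
Definition qpow (tau : C) (r : R) : C := ee (tau * RtoC (2 * r))%C.

Lemma qpow_plus tau r s : qpow tau (r + s) = (qpow tau r * qpow tau s)%C.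
Proof.
unfold qpow; rewrite <- ee_plus; f_equal.
rewrite Rmult_plus_distr_l, RtoC_plus; ring.
Qed.

Lemma qpow_0 tau : qpow tau 0 = 1%C.
Proof. unfold qpow; rewrite Rmult_0_r, Cmult_0_r; apply ee_0. Qed.

Definition qpoch (tau : C) (m : nat) : C := Cprod (fun i => 1 - qpow tau (INR i + 1))%C m.

(** Gaussian binomials by the q-Pascal rule instead of quotients: this is the recursion that
    [cauchy_binomial] consumes, with no division involved. *)
Fixpoint qbin (tau : C) (m k : nat) : C :=
  match k with
  | O => 1%C
  | S k' => match m with
            | O => 0%C
            | S m' => (qbin tau m' (S k') + qpow tau (INR m' - INR k') * qbin tau m' k')%C
            end
  end.

Lemma qbin_above tau m k : (m < k)%nat -> qbin tau m k = 0%C.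
Proof.
revert k; induction m as [|m IH]; intros [|k] H; try lia; simpl; auto.
rewrite !IH by lia; ring.
Qed.

(** The q-Pascal rule combined with 1 - q^(m+1) = (1 - q^(m-k)) + q^(m-k) (1 - q^(k+1)). It later
    compares the coefficients with bounded products. *)
Lemma qbin_poch tau m k : (k <= m)%nat ->
  (qbin tau m k * (qpoch tau k * qpoch tau (m - k)) = qpoch tau m)%C.
Proof.
revert k; induction m as [|m IH]; intros k Hk.
- assert (k = O) by lia; subst; simpl; unfold qpoch; simpl; ring.
- destruct k as [|k].
  + rewrite Nat.sub_0_r; simpl qbin; unfold qpoch at 1; simpl; ring.
  + assert (Hk' : (k <= m)%nat) by lia.
    assert (E1 := IH k Hk').
    replace (S m - S k)%nat with (m - k)%nat by lia.
    assert (Es : qpoch tau (S k) = (qpoch tau k * (1 - qpow tau (INR k + 1)))%C) by reflexivity.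
    assert (Em : qpoch tau (S m) = (qpoch tau m * (1 - qpow tau (INR m + 1)))%C) by reflexivity.
    assert (Eq : qpow tau (INR m + 1) = (qpow tau (INR m - INR k) * qpow tau (INR k + 1))%C)
      by (rewrite <- qpow_plus; f_equal; ring).
    change (qbin tau (S m) (S k)) with
      (qbin tau m (S k) + qpow tau (INR m - INR k) * qbin tau m k)%C.
    destruct (Nat.eq_dec k m) as [->|Hne].
    * rewrite qbin_above by lia; rewrite Rminus_diag, qpow_0, Em.
      rewrite <- E1 at 2; rewrite Nat.sub_diag; ring.
    * assert (E2 := IH (S k) ltac:(lia)).
      assert (Ed : qpoch tau (m - k) = (qpoch tau (m - S k) * (1 - qpow tau (INR m - INR k)))%C).
      { replace (m - k)%nat with (S (m - S k)) by lia.
        change (qpoch tau (S (m - S k))) with (qpoch tau (m - S k) * (1 - qpow tau (INR (m - S k) + 1)))%C.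
        do 3 f_equal. rewrite minus_INR, S_INR by lia; ring. }
      rewrite Em, Eq, Es.
      transitivity (qbin tau m (S k) * (qpoch tau (S k) * qpoch tau (m - S k)) * (1 - qpow tau (INR m - INR k))
        + qpow tau (INR m - INR k) * (qbin tau m k * (qpoch tau k * qpoch tau (m - k)))
          * (1 - qpow tau (INR k + 1)))%C.
      { rewrite Ed, Es; ring. }
      rewrite E1, E2; ring.
Qed.

(** The monomial q^(k(k-1)/2) w^k with w = e^(2 pi i z). *)
Definition qterm (tau z : C) (k : nat) : C :=
  ee (tau * RtoC (INR k ^ 2 - INR k) + RtoC (2 * INR k) * z)%C.

Lemma Cpart_shift u n : Cpart u (S n) = (u O + Cpart (fun k => u (S k)) n)%C.
Proof.
induction n as [|n IH]; [simpl; ring|].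
change (Cpart u (S (S n))) with (Cpart u (S n) + u (S n))%C.
rewrite IH; simpl; ring.
Qed.

Lemma Cpart_ext u v n : (forall k, (k < n)%nat -> u k = v k) -> Cpart u n = Cpart v n.
Proof.
induction n as [|n IH]; intros H; simpl; auto.
rewrite IH by (intros; apply H; lia); rewrite H by lia; auto.
Qed.

Lemma Cpart_lin u v c n : Cpart (fun k => u k + c * v k)%C n = (Cpart u n + c * Cpart v n)%C.
Proof. induction n as [|n IH]; simpl; [ring|]; rewrite IH; ring. Qed.

(** Induction on the last factor by the q-Pascal rule. Any length [L] above [m] is allowed, because
    further coefficients vanish; the shifted sum of the induction step has one term fewer. *)
Lemma cauchy_binomial tau z m L : (m < L)%nat ->
  Cpart (fun k => qbin tau m k * qterm tau z k)%C L =
  Cprod (fun i => 1 + ee (2 * z + tau * RtoC (2 * INR i)))%C m.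
Proof.
revert L; induction m as [|m IH]; intros L HL.
- destruct L as [|L]; [lia|]; rewrite Cpart_shift.
  rewrite (Cpart_ext _ (fun _ => RtoC 0)) by (intros k _; rewrite qbin_above by lia; ring).
  assert (E0 : forall n, Cpart (fun _ => RtoC 0) n = 0%C)
    by (induction n as [|n IHn]; simpl; auto; rewrite IHn; ring).
  rewrite E0; unfold qterm; simpl.
  replace (tau * RtoC (0 * (0 * 1) - 0) + RtoC (2 * 0) * z)%C with (RtoC 0).
  + rewrite ee_0; ring.
  + rewrite !Rmult_0_l, Rmult_0_r, Rminus_diag; ring.
- destruct L as [|L]; [lia|]; rewrite Cpart_shift.
  set (X := ee (2 * z + tau * RtoC (2 * INR m))%C).
  rewrite (Cpart_ext _ (fun k => qbin tau m (S k) * qterm tau z (S k) + X * (qbin tau m k * qterm tau z k))%C).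
  + rewrite Cpart_lin.
    assert (I1 := IH (S L) ltac:(lia)); rewrite Cpart_shift in I1.
    assert (I2 := IH L ltac:(lia)).
    set (P := Cprod (fun i => 1 + ee (2 * z + tau * RtoC (2 * INR i)))%C m) in *.
    change (Cprod (fun i => 1 + ee (2 * z + tau * RtoC (2 * INR i)))%C (S m)) with (P * (1 + X))%C.
    rewrite I2; replace (qbin tau (S m) 0) with (qbin tau m 0) by (destruct m; reflexivity).
    transitivity (qbin tau m 0 * qterm tau z 0
      + Cpart (fun k => qbin tau m (S k) * qterm tau z (S k)) L + X * P)%C; [ring|].
    rewrite I1; ring.
  + intros k _.
    change (qbin tau (S m) (S k)) with
      (qbin tau m (S k) + qpow tau (INR m - INR k) * qbin tau m k)%C.
    assert (E : (qpow tau (INR m - INR k) * qterm tau z (S k) = X * qterm tau z k)%C).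
    { unfold qpow, qterm, X; rewrite <- !ee_plus; f_equal; rewrite S_INR.
      apply injective_projections; destruct tau, z; simpl; ring. }
    transitivity (qbin tau m (S k) * qterm tau z (S k)
      + qbin tau m k * (qpow tau (INR m - INR k) * qterm tau z (S k)))%C; [ring|].
    rewrite E; ring.
Qed.

Lemma Cpart_zpart (u : Z -> C) (N : nat) :
  Cpart (fun k => u (Z.of_nat k - Z.of_nat N)%Z) (2 * N) = zpart u N.
Proof.
induction N as [|N IH]; [reflexivity|].
replace (2 * S N)%nat with (S (S (2 * N))) by lia.
rewrite Cpart_shift.
rewrite (Cpart_ext _ (fun k => u (Z.of_nat k - Z.of_nat N)%Z) (S (2 * N)))
  by (intros k _; f_equal; lia).
change (Cpart (fun k => u (Z.of_nat k - Z.of_nat N)%Z) (S (2 * N)))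
  with (Cpart (fun k => u (Z.of_nat k - Z.of_nat N)%Z) (2 * N) + u (Z.of_nat (2 * N) - Z.of_nat N)%Z)%C.
rewrite IH; unfold zpart; simpl Cpart; unfold zpair.
replace (Z.of_nat (2 * N) - Z.of_nat N)%Z with (Z.of_nat N) by lia.
replace (Z.of_nat 0 - Z.of_nat (S N))%Z with (- Z.of_nat N - 1)%Z by lia.
ring.
Qed.

Lemma Cpart_bound (w : nat -> C) (c : R) (N : nat) : 0 <= c ->
  (forall k, (k < N)%nat -> Cmod (w k) <= c * exp (- INR k)) -> Cmod (Cpart w N) <= 2 * c.
Proof.
intros Hc H.
assert (H1 := exp_m1_half).
enough (E : Cmod (Cpart w N) <= 2 * c * (1 - exp (- INR N))).
{ apply Rle_trans with (1 := E). assert (0 < exp (- INR N)) by apply exp_pos; nra. }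
induction N as [|N IH].
- simpl; rewrite Cmod_0, Ropp_0, exp_0; lra.
- simpl Cpart; apply Rle_trans with (1 := Cmod_triangle _ _).
  specialize (IH ltac:(intros; apply H; lia)); specialize (H N ltac:(lia)).
  rewrite S_INR, Ropp_plus_distr, exp_plus.
  change (- (1)) with (-1) in *.
  assert (P := exp_pos (- INR N)).
  replace (exp (- (1))) with (exp (-1)) by (f_equal; ring).
  assert (c * exp (- INR N) * (2 * exp (-1)) <= c * exp (- INR N) * 1)
    by (apply Rmult_le_compat_l; [apply Rmult_le_pos; lra|lra]).
  lra.
Qed.

(** Cauchy's binomial theorem with 2N factors at a shifted argument, where the exponents of q run
    from 1 - N to N; the factors with exponent at most 0 are turned over. Recentring the sum at N
    makes it a weighted partial sum of [S1]. *)
Lemma triple_product_finite (tau z : C) (N : nat) :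
  (Cprod (fun j => 1 - ee (- (2 * z) + tau * RtoC (2 * INR j))) N
   * Cprod (fun j => 1 - ee (2 * z + tau * RtoC (2 * (INR j + 1)))) N
   * ee (tau * RtoC (/ 4) + z))%C =
  Cpart (fun k => qbin tau (2 * N) k
     * tht_term tau 1 (1 / 2) 1 2 z (Z.of_nat k - Z.of_nat N))%C (S (2 * N)).
Proof.
(* The shift by (1 - N) tau recentres the exponents, and the 1/2 turns every factor 1 + w q^i into 1
   - w q^i. *)
set (z' := (z + tau * RtoC (1 - INR N) + RtoC (/ 2))%C).
assert (E := cauchy_binomial tau z' (2 * N) (S (2 * N)) ltac:(lia)).
(* The monomial relating the k-th term at z' to the theta term of index k - N. The turned-over
   factors produce the same monomial times e^(pi i (tau/4 + z)), so it cancels. *)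
set (kap := ee (tau * RtoC (INR N - INR N ^ 2 - / 4) + RtoC (2 * INR N - 1) * z + RtoC (INR N))%C).
assert (EL : Cpart (fun k => qbin tau (2 * N) k * qterm tau z' k)%C (S (2 * N)) =
  (kap * Cpart (fun k => qbin tau (2 * N) k
     * tht_term tau 1 (1 / 2) 1 2 z (Z.of_nat k - Z.of_nat N)) (S (2 * N)))%C).
{ rewrite (Cpart_ext _ (fun k => 0 + kap * (qbin tau (2 * N) k
     * tht_term tau 1 (1 / 2) 1 2 z (Z.of_nat k - Z.of_nat N)))%C (S (2 * N))).
  - rewrite Cpart_lin.
    assert (E0 : forall n, Cpart (fun _ => RtoC 0) n = RtoC 0)
      by (induction n as [|n IHn]; simpl; auto; rewrite IHn; ring).
    rewrite E0; ring.
  - intros k _.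
    assert (Et : qterm tau z' k = (kap * tht_term tau 1 (1 / 2) 1 2 z (Z.of_nat k - Z.of_nat N))%C).
    { unfold qterm, kap, tht_term, z'; rewrite <- ee_plus; f_equal.
      rewrite minus_IZR, <- !INR_IZR_INZ.
      apply injective_projections; destruct tau, z; simpl; field. }
    rewrite Et; ring. }
rewrite EL in E.
replace (2 * N)%nat with (N + N)%nat in E at 2 by lia.
rewrite Cprod_add in E.
assert (ER : Cprod (fun i => 1 + ee (2 * z' + tau * RtoC (2 * INR (N + i))))%C N =
  Cprod (fun j => 1 - ee (2 * z + tau * RtoC (2 * (INR j + 1))))%C N).
{ apply Cprod_ext; intros i _.
  replace (ee (2 * z' + tau * RtoC (2 * INR (N + i))))%C
    with (ee (2 * z + tau * RtoC (2 * (INR i + 1))) * ee (RtoC 1))%C.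
  - rewrite ee_1; ring.
  - rewrite <- ee_plus; f_equal; unfold z'; rewrite plus_INR.
    apply injective_projections; destruct tau, z; simpl; field. }
rewrite ER in E.
rewrite Cprod_rev in E.
assert (EF : Cprod (fun i => 1 + ee (2 * z' + tau * RtoC (2 * INR (N - 1 - i))))%C N =
  (Cprod (fun j => - ee (2 * z - tau * RtoC (2 * INR j))) N
   * Cprod (fun j => 1 - ee (- (2 * z) + tau * RtoC (2 * INR j))) N)%C).
{ rewrite <- Cprod_mult; apply Cprod_ext; intros i Hi.
  replace (ee (2 * z' + tau * RtoC (2 * INR (N - 1 - i))))%C
    with (ee (2 * z - tau * RtoC (2 * INR i)) * ee (RtoC 1))%C.
  - rewrite ee_1.
    transitivity (1 - ee (2 * z - tau * RtoC (2 * INR i)) : C)%C; [ring|].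
    assert (E1 : (ee (2 * z - tau * RtoC (2 * INR i)) * ee (- (2 * z) + tau * RtoC (2 * INR i)) = 1)%C).
    { rewrite <- ee_plus, <- ee_0; f_equal; ring. }
    rewrite <- E1 at 1; ring.
  - rewrite <- ee_plus; f_equal; unfold z'.
    rewrite !minus_INR by lia; simpl INR.
    apply injective_projections; destruct tau, z; simpl; field. }
rewrite EF in E.
assert (EK : forall n, Cprod (fun j => - ee (2 * z - tau * RtoC (2 * INR j)))%C n =
   ee (RtoC (2 * INR n) * z - tau * RtoC (INR n ^ 2 - INR n) + RtoC (INR n))%C).
{ induction n as [|n IH].
  - simpl Cprod; symmetry; rewrite <- ee_0 at 1; f_equal.
    apply injective_projections; destruct tau, z; simpl; ring.
  - simpl Cprod; rewrite IH.
    replace (- ee (2 * z - tau * RtoC (2 * INR n)))%C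
      with (ee (2 * z - tau * RtoC (2 * INR n)) * ee (RtoC 1))%C by (rewrite ee_1; ring).
    rewrite <- !ee_plus; f_equal; rewrite S_INR.
    apply injective_projections; destruct tau, z; simpl; ring. }
rewrite EK in E.
assert (Ekap : ee (RtoC (2 * INR N) * z - tau * RtoC (INR N ^ 2 - INR N) + RtoC (INR N))%C =
  (kap * ee (tau * RtoC (/ 4) + z))%C).
{ unfold kap; rewrite <- ee_plus; f_equal.
  apply injective_projections; destruct tau, z; simpl; field. }
rewrite Ekap in E.
assert (Hk : kap <> 0%C) by apply ee_neq0.
apply (f_equal (fun t => / kap * t)%C) in E.
match type of E with (_ * (_ * ?P))%C = _ => transitivity P end.
- transitivity (/ kap * (kap * Cpart (fun k => qbin tau (2 * N) k
     * tht_term tau 1 (1 / 2) 1 2 z (Z.of_nat k - Z.of_nat N)) (S (2 * N))))%C.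
  + rewrite E; field; auto.
  + field; auto.
- reflexivity.
Qed.

Definition in_lattice (tau z : C) : Prop :=
  exists m n : Z, z = (RtoC (IZR m) + tau * RtoC (IZR n))%C.

Lemma exp_pow_INR (r : R) (n : nat) : exp r ^ n = exp (r * INR n).
Proof.
induction n as [|n IH]; [simpl; rewrite Rmult_0_r, exp_0; auto|].
simpl pow; rewrite IH, <- exp_plus, S_INR; f_equal; ring.
Qed.

(* The finite triple product stays away from [0] off the lattice, while its normalised
   expansion tends to the theta series with geometric error. *)
Lemma S1_zero (tau z : C) : 0 < Im tau -> S1 tau z = 0%C -> in_lattice tau z.
Proof.
intros Ht Hz.
destruct (Classical_Prop.classic (in_lattice tau z)) as [|Hnl]; auto; exfalso.
assert (HP := PI_RGT_0).
(* e^-beta = |q| is the ratio of the geometric bounds on the factors. *)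
set (beta := 2 * PI * Im tau).
assert (Hbeta : 0 < beta) by (unfold beta; apply Rmult_lt_0_compat; lra).
set (rho := exp (- beta)).
assert (Hrho : 0 < rho < 1).
{ split; [apply exp_pos|]. unfold rho; rewrite <- exp_0; apply exp_increasing; lra. }
assert (HxL : forall j, Cmod (ee (- (2 * z) + tau * RtoC (2 * INR j))%C) <= exp (2 * PI * Im z) * rho ^ j).
{ intros j; unfold rho; rewrite Cmod_ee, exp_pow_INR, <- exp_plus; right; f_equal; unfold beta.
  destruct tau, z; simpl; ring. }
assert (HxR : forall j, Cmod (ee (2 * z + tau * RtoC (2 * (INR j + 1)))%C)
   <= exp (- (2 * PI * Im z) - beta) * rho ^ j).
{ intros j; unfold rho; rewrite Cmod_ee, exp_pow_INR, <- exp_plus; right; f_equal; unfold beta.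
  destruct tau, z; simpl; ring. }
assert (Hxq : forall j, Cmod (qpow tau (INR j + 1)) <= 1 * rho ^ j).
{ intros j; unfold qpow, rho; rewrite Cmod_ee, exp_pow_INR, Rmult_1_l; apply exp_le; unfold beta.
  destruct tau as [ta tb]; simpl in *. nra. }
(* A vanishing factor would make 2 z congruent to an even multiple of tau modulo even integers,
   which puts z in the lattice. *)
assert (NL : forall j, ee (- (2 * z) + tau * RtoC (2 * INR j))%C <> 1%C).
{ intros j E; apply ee_eq1 in E; destruct E as [k Hk]; apply Hnl.
  exists (- k)%Z, (Z.of_nat j); rewrite opp_IZR, <- INR_IZR_INZ.
  destruct tau as [ta tb], z as [zx zy]; unfold RtoC, Cplus, Cmult, Copp in Hk |- *; simpl in *.
  injection Hk; intros; f_equal; lra. }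
assert (NR : forall j, ee (2 * z + tau * RtoC (2 * (INR j + 1)))%C <> 1%C).
{ intros j E; apply ee_eq1 in E; destruct E as [k Hk]; apply Hnl.
  exists k, (- Z.of_nat j - 1)%Z; rewrite minus_IZR, opp_IZR, <- INR_IZR_INZ.
  destruct tau as [ta tb], z as [zx zy]; unfold RtoC, Cplus, Cmult, Copp in Hk |- *; simpl in *.
  injection Hk; intros; f_equal; lra. }
assert (NQ : forall j, qpow tau (INR j + 1) <> 1%C).
{ intros j E; apply ee_eq1 in E; destruct E as [k Hk].
  destruct tau as [ta tb]; unfold RtoC, Cmult in Hk; simpl in *.
  injection Hk; intros. assert (0 <= INR j) by apply pos_INR. nra. }
destruct (Cprod_lower _ _ rho Hrho (Rlt_le _ _ (exp_pos _)) HxL NL) as [c1 [Hc1 B1]].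
destruct (Cprod_lower _ _ rho Hrho (Rlt_le _ _ (exp_pos _)) HxR NR) as [c2 [Hc2 B2]].
destruct (Cprod_lower _ 1 rho Hrho ltac:(lra) Hxq NQ) as [cp [Hcp Bp]].
destruct (Cprod_upper _ 1 rho Hrho ltac:(lra) Hxq) as [Cp [HCp Up]].
destruct (Cprod_cauchy _ 1 rho Hrho ltac:(lra) Hxq) as [K [HK Kp]].
change (forall N, cp <= Cmod (qpoch tau N)) in Bp.
change (forall N, Cmod (qpoch tau N) <= Cp) in Up.
change (forall N m, Cmod (qpoch tau (N + m) - qpoch tau N)%C <= K * rho ^ N) in Kp.
set (t := tht_term tau 1 (1 / 2) 1 2 z).
(* Rate 1 + beta instead of 1: the weight of index n is controlled only up to rho^(N - |n|), and the
   surplus e^(-beta |n|) restores rho^N. *)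
assert (Hdec : exists M, 0 <= M /\ forall n, Cmod (t n) <= M * exp (- ((1 + beta) * IZR (Z.abs n)))).
{ destruct (tht_rapid tau 1 (1 / 2) 1 Ht ltac:(lra) ltac:(lra) (1 + beta + 2 * PI * Rabs (Im z))) as [M [HM H]].
  exists (M * exp (PI * Rabs (Im z))); split; [apply Rmult_le_pos; [auto|left; apply exp_pos]|].
  intros n; unfold t, tht_term; rewrite ee_plus, Cmod_mult.
  apply Rle_trans with (M * exp (- ((1 + beta + 2 * PI * Rabs (Im z)) * IZR (Z.abs n)))
     * exp (2 * PI * Rabs (Im z) * IZR (Z.abs n) + PI * Rabs (Im z))).
  - apply Rmult_le_compat; auto using Cmod_ge_0.
    rewrite Cmod_ee; apply exp_le.
    assert (Ei : Im (RtoC (2 * (IZR n + 1 / 2)) * z)%C = (2 * IZR n + 1) * Im z)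
      by (destruct z; simpl; field).
    rewrite Ei.
    assert (Ea : - ((2 * IZR n + 1) * Im z) <= (2 * IZR (Z.abs n) + 1) * Rabs (Im z)).
    { apply Rle_trans with (1 := Rle_abs _); rewrite Rabs_Ropp, Rabs_mult.
      apply Rmult_le_compat_r; [apply Rabs_pos|].
      apply Rle_trans with (1 := Rabs_triang _ _).
      rewrite Rabs_mult, (Rabs_pos_eq 2), Rabs_R1, abs_IZR by lra; lra. }
    apply Rmult_le_compat_l with (r := PI) in Ea; lra.
  - rewrite !Rmult_assoc, <- !exp_plus; right; do 2 f_equal; ring. }
destruct Hdec as [M [HM Hdec]].
assert (Dt : zdec t M).
{ intros n; apply Rle_trans with (1 := Hdec n), Rmult_le_compat_l; auto; apply exp_le.
  assert (0 <= IZR (Z.abs n)) by apply IZR_abs_pos; nra. }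
set (E0 := Cmod (ee (tau * RtoC (/ 4) + z)%C)).
assert (HE0 : 0 < E0) by apply Cmod_gt_0, ee_neq0.
assert (Hzs : zs t = 0%C) by (rewrite <- Hz; unfold S1; rewrite tht_zs; reflexivity).
set (low := cp * cp * (c1 * c2 * E0)).
assert (Hlow : 0 < low) by (unfold low; repeat apply Rmult_lt_0_compat; auto).
set (K2 := Cp * (4 * Cp * K) / (cp * cp)).
assert (Hcc : 0 < cp * cp) by nra.
assert (HK2 : 0 <= K2) by (unfold K2; apply Rdiv_le_0_compat; [repeat apply Rmult_le_pos; lra|auto]).
(* The sums have 2N + 1 terms, one more than the window of [zpart]: 5 is 4 for the window plus 1 for
   the last term, and 9 is 8 plus 1. *)
assert (Hmain : forall N, low <= 5 * (K2 * M) * rho ^ N + 9 * Cp * M * exp (- INR N)).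
{ intros N.
  assert (Q := triple_product_finite tau z N); fold t in Q.
  set (T := Cpart (fun k => qbin tau (2 * N) k * t (Z.of_nat k - Z.of_nat N)%Z)%C (S (2 * N))) in *.
  assert (LT : low <= Cmod (qpoch tau N * qpoch tau N * T)%C).
  { rewrite <- Q, !Cmod_mult; fold E0; unfold low.
    apply Rmult_le_compat; try nra.
    - repeat apply Rmult_le_pos; lra.
    - specialize (Bp N); apply Rmult_le_compat; lra.
    - apply Rmult_le_compat_r; [lra|]; apply Rmult_le_compat; auto; lra. }
  (* Deviation of the normalised weights from a constant. Its sum is O(rho^N), and the constant
     multiplies a partial sum of a series with value 0. *)
  set (v := fun n => ((qpoch tau N * qpoch tau N * qbin tau (2 * N) (Z.to_nat (n + Z.of_nat N))
     - qpoch tau (2 * N)) * t n)%C).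
  assert (Ev : (qpoch tau N * qpoch tau N * T = Cpart (fun k => v (Z.of_nat k - Z.of_nat N)%Z) (S (2 * N))
    + qpoch tau (2 * N) * Cpart (fun k => t (Z.of_nat k - Z.of_nat N)%Z) (S (2 * N)))%C).
  { rewrite <- Cpart_lin; unfold T.
    transitivity (Cpart (fun _ => RtoC 0) (S (2 * N)) + qpoch tau N * qpoch tau N *
       Cpart (fun k => qbin tau (2 * N) k * t (Z.of_nat k - Z.of_nat N)%Z)%C (S (2 * N)))%C.
    - assert (Ez : forall n, Cpart (fun _ => RtoC 0) n = RtoC 0)
        by (induction n as [|n IHn]; simpl; auto; rewrite IHn; ring).
      rewrite Ez; ring.
    - rewrite <- Cpart_lin; apply Cpart_ext; intros k _; unfold v.
      replace (Z.to_nat (Z.of_nat k - Z.of_nat N + Z.of_nat N)) with k by lia; ring. }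
  assert (Bv : forall n, (Z.abs n <= Z.of_nat N)%Z -> Cmod (v n) <= K2 * M * rho ^ N * exp (- IZR (Z.abs n))).
  { intros n Hn.
    set (k := Z.to_nat (n + Z.of_nat N)).
    assert (Hk : (k <= 2 * N)%nat) by (unfold k; lia).
    (* The indices N, k and 2N - k are all at least N - |n|, so their q-factorials differ by
       O(rho^(N - |n|)). *)
    set (mn := (N - Z.abs_nat n)%nat).
    assert (Hdiff : forall j, (mn <= j)%nat -> Cmod (qpoch tau N - qpoch tau j)%C <= 2 * (K * rho ^ mn)).
    { intros j Hj.
      assert (A1 := Kp mn (N - mn)%nat); assert (A2 := Kp mn (j - mn)%nat).
      replace (mn + (N - mn))%nat with N in A1 by (unfold mn in *; lia).
      replace (mn + (j - mn))%nat with j in A2 by lia.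
      replace (qpoch tau N - qpoch tau j)%C with
        ((qpoch tau N - qpoch tau mn) + - (qpoch tau j - qpoch tau mn))%C by ring.
      apply Rle_trans with (1 := Cmod_triangle _ _); rewrite Cmod_opp; lra. }
    assert (Hd1 := Kp (Nat.min N k) (N - Nat.min N k)%nat).
    assert (Hq : Cmod (qpoch tau N * qpoch tau N * qbin tau (2 * N) k - qpoch tau (2 * N))%C <= K2 * rho ^ mn).
    { assert (Eb := qbin_poch tau (2 * N) k Hk).
      assert (Em : ((qpoch tau N * qpoch tau N * qbin tau (2 * N) k - qpoch tau (2 * N))
          * (qpoch tau k * qpoch tau (2 * N - k))
        = qpoch tau (2 * N) * (qpoch tau N * (qpoch tau N - qpoch tau k)
            + qpoch tau k * (qpoch tau N - qpoch tau (2 * N - k))))%C).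
      { transitivity (qpoch tau N * qpoch tau N * (qbin tau (2 * N) k * (qpoch tau k * qpoch tau (2 * N - k)))
          - qpoch tau (2 * N) * (qpoch tau k * qpoch tau (2 * N - k)))%C; [ring|].
        rewrite Eb; ring. }
      apply (f_equal Cmod) in Em; rewrite !Cmod_mult in Em.
      assert (D1 := Hdiff k ltac:(unfold mn, k; lia)).
      assert (D2 := Hdiff (2 * N - k)%nat ltac:(unfold mn, k; lia)).
      assert (Tr := Cmod_triangle (qpoch tau N * (qpoch tau N - qpoch tau k))
            (qpoch tau k * (qpoch tau N - qpoch tau (2 * N - k)))).
      rewrite !Cmod_mult in Tr.
      set (r := rho ^ mn) in *.
      assert (Hr : 0 < r) by (apply pow_lt; lra).
      assert (U1 : Cmod (qpoch tau N) * Cmod (qpoch tau N - qpoch tau k)%C <= Cp * (2 * (K * r)))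
        by (apply Rmult_le_compat; auto using Cmod_ge_0).
      assert (U2 : Cmod (qpoch tau k) * Cmod (qpoch tau N - qpoch tau (2 * N - k))%C <= Cp * (2 * (K * r)))
        by (apply Rmult_le_compat; auto using Cmod_ge_0).
      assert (U3 : Cmod (qpoch tau (2 * N)) * Cmod (qpoch tau N * (qpoch tau N - qpoch tau k)
            + qpoch tau k * (qpoch tau N - qpoch tau (2 * N - k)))%C <= Cp * (2 * (Cp * (2 * (K * r)))))
        by (apply Rmult_le_compat; auto using Cmod_ge_0; lra).
      assert (L1 : cp * cp <= Cmod (qpoch tau k) * Cmod (qpoch tau (2 * N - k)))
        by (apply Rmult_le_compat; auto; lra).
      rewrite <- Em in U3.
      apply Rmult_le_reg_r with (cp * cp); auto.
      replace (K2 * r * (cp * cp)) with (Cp * (2 * (Cp * (2 * (K * r))))) by (unfold K2; field; lra).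
      apply Rle_trans with (2 := U3), Rmult_le_compat_l; auto using Cmod_ge_0. }
    unfold v; fold k; rewrite Cmod_mult.
    apply Rle_trans with (K2 * rho ^ mn * (M * exp (- ((1 + beta) * IZR (Z.abs n))))).
    - apply Rmult_le_compat; auto using Cmod_ge_0.
    - assert (Er : rho ^ N = rho ^ mn * exp (- (beta * IZR (Z.abs n)))).
      { replace N with (mn + Z.abs_nat n)%nat at 1 by (unfold mn; lia).
        rewrite pow_add; f_equal; unfold rho; rewrite exp_pow_INR; f_equal.
        rewrite INR_IZR_INZ, Nat2Z.inj_abs_nat; ring. }
      rewrite Er.
      replace (- ((1 + beta) * IZR (Z.abs n))) with (- (beta * IZR (Z.abs n)) + - IZR (Z.abs n)) by ring.
      rewrite exp_plus; right; ring. }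
  assert (Hc0 : 0 <= K2 * M * rho ^ N) by (apply Rmult_le_pos; [nra|apply pow_le; lra]).
  assert (Pv : Cmod (Cpart (fun k => v (Z.of_nat k - Z.of_nat N)%Z) (S (2 * N))) <= 5 * (K2 * M * rho ^ N)).
  { change (Cmod (Cpart (fun k => v (Z.of_nat k - Z.of_nat N)%Z) (2 * N)
      + v (Z.of_nat (2 * N) - Z.of_nat N)%Z)%C <= 5 * (K2 * M * rho ^ N)).
    rewrite Cpart_zpart; apply Rle_trans with (1 := Cmod_triangle _ _).
    assert (Z1 : Cmod (zpart v N) <= 2 * (2 * (K2 * M * rho ^ N))).
    { apply Cpart_bound; [lra|]; intros k Hk; unfold zpair.
      apply Rle_trans with (1 := Cmod_triangle _ _).
      assert (b1 := Bv (Z.of_nat k) ltac:(lia)); assert (b2 := Bv (- Z.of_nat k - 1)%Z ltac:(lia)).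
      rewrite Z.abs_eq, <- INR_IZR_INZ in b1 by lia.
      assert (exp (- IZR (Z.abs (- Z.of_nat k - 1))) <= exp (- INR k)).
      { apply exp_le, Ropp_le_contravar; rewrite INR_IZR_INZ; apply IZR_le; lia. }
      assert (K2 * M * rho ^ N * exp (- IZR (Z.abs (- Z.of_nat k - 1)))
         <= K2 * M * rho ^ N * exp (- INR k)) by (apply Rmult_le_compat_l; auto).
      lra. }
    assert (Z2 := Bv (Z.of_nat (2 * N) - Z.of_nat N)%Z ltac:(lia)).
    assert (exp (- IZR (Z.abs (Z.of_nat (2 * N) - Z.of_nat N))) <= 1).
    { rewrite <- exp_0; apply exp_le. assert (T0 := IZR_abs_pos (Z.of_nat (2 * N) - Z.of_nat N)); lra. }
    assert (K2 * M * rho ^ N * exp (- IZR (Z.abs (Z.of_nat (2 * N) - Z.of_nat N)))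
         <= K2 * M * rho ^ N * 1) by (apply Rmult_le_compat_l; auto).
    lra. }
  assert (Pt : Cmod (Cpart (fun k => t (Z.of_nat k - Z.of_nat N)%Z) (S (2 * N))) <= 9 * M * exp (- INR N)).
  { change (Cmod (Cpart (fun k => t (Z.of_nat k - Z.of_nat N)%Z) (2 * N)
      + t (Z.of_nat (2 * N) - Z.of_nat N)%Z)%C <= 9 * M * exp (- INR N)).
    rewrite Cpart_zpart; apply Rle_trans with (1 := Cmod_triangle _ _).
    assert (Z1 := zs_tail t M N Dt); rewrite Hzs in Z1.
    replace (0 - zpart t N)%C with (- zpart t N)%C in Z1 by ring; rewrite Cmod_opp in Z1.
    assert (Z2 := Dt (Z.of_nat (2 * N) - Z.of_nat N)%Z).
    replace (Z.abs (Z.of_nat (2 * N) - Z.of_nat N)) with (Z.of_nat N) in Z2 by lia.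
    rewrite <- INR_IZR_INZ in Z2; lra. }
  apply Rle_trans with (1 := LT); rewrite Ev.
  apply Rle_trans with (1 := Cmod_triangle _ _); rewrite (Cmod_mult (qpoch tau (2 * N))).
  assert (Cmod (qpoch tau (2 * N)) * Cmod (Cpart (fun k => t (Z.of_nat k - Z.of_nat N)%Z) (S (2 * N)))
     <= Cp * (9 * M * exp (- INR N))) by (apply Rmult_le_compat; auto using Cmod_ge_0).
  lra. }
assert (Hsmall : forall q c, 0 < q < 1 -> 0 <= c -> exists N0, forall N, (N0 <= N)%nat -> c * q ^ N < low / 2).
{ intros q c Hq Hc.
  assert (He : 0 < low / 2 / (c + 1)) by (repeat apply Rdiv_lt_0_compat; lra).
  destruct (pow_lt_1_zero q ltac:(rewrite Rabs_pos_eq; lra) _ He) as [N0 H0].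
  exists N0; intros N HN; specialize (H0 N HN); rewrite Rabs_pos_eq in H0 by (apply pow_le; lra).
  apply Rlt_div_r in H0; [|lra]. assert (0 < q ^ N) by (apply pow_lt; lra). nra. }
assert (He := exp_m1_half).
destruct (Hsmall rho (5 * (K2 * M)) Hrho ltac:(nra)) as [N1 H1].
destruct (Hsmall (exp (-1)) (9 * Cp * M) ltac:(lra) ltac:(nra)) as [N2 H2].
specialize (Hmain (N1 + N2)%nat); specialize (H1 (N1 + N2)%nat ltac:(lia)); specialize (H2 (N1 + N2)%nat ltac:(lia)).
rewrite geom_exp in Hmain; lra.
Qed.

Definition lat (tau : C) (m n : Z) : C := (RtoC (IZR m) + tau * RtoC (IZR n))%C.

(** Shifting the summation index by n absorbs the linear term in tau into the square; the
    translation by m contributes (-1)^m, because (2 j + 1) m and m have the same parity. *)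
Lemma S1_quasi tau z m n : 0 < Im tau ->
  S1 tau (z + lat tau m n)%C =
  (ee (RtoC (IZR m - IZR n) - tau * RtoC (IZR n ^ 2) - RtoC (2 * IZR n) * z) * S1 tau z)%C.
Proof.
intros Ht; unfold S1; rewrite !tht_zs.
destruct (tht_dec tau 1 (1 / 2) 1 2 z Ht ltac:(lra) ltac:(lra)) as [M H].
rewrite <- (zs_shift _ _ n H), <- (zs_scal _ _ _ (zdec_shift _ _ n H)).
apply zs_ext; intros j; unfold tht_term, lat.
rewrite <- ee_plus.
match goal with |- ee ?u = ee ?v => transitivity (ee (RtoC (2 * IZR (j * m))) * ee v)%C end.
- rewrite <- ee_plus; f_equal; rewrite plus_IZR, mult_IZR.
  apply injective_projections; destruct tau, z; simpl; field.
- rewrite ee_even; ring.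
Qed.

Lemma S1_lattice (tau z : C) : 0 < Im tau -> (S1 tau z = 0%C <-> in_lattice tau z).
Proof.
intros Ht; split; [apply S1_zero, Ht|].
intros [m [n ->]]; fold (lat tau m n); rewrite <- (Cplus_0_l (lat tau m n)).
rewrite (S1_quasi tau 0 m n Ht), (S1_0 tau Ht); ring.
Qed.

(** * Derivatives of theta functions *)

Lemma holo_mult (F F' G G' : C -> C) : holo F F' -> holo G G' ->
  holo (fun z => F z * G z)%C (fun z => F' z * G z + F z * G' z)%C.
Proof.
intros [F1 F2] [G1 G2]; split.
- apply (partials_ext _ _ _ _ _ (partials_minus _ _ _ _ _ _
    (partials_mult _ _ _ _ _ _ F1 G1) (partials_mult _ _ _ _ _ _ F2 G2)));
  intros x y; unfold re_of, im_of, Re, Im; simpl; ring.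
- apply (partials_ext _ _ _ _ _ (partials_plus _ _ _ _ _ _
    (partials_mult _ _ _ _ _ _ F1 G2) (partials_mult _ _ _ _ _ _ F2 G1)));
  intros x y; unfold re_of, im_of, Re, Im; simpl; ring.
Qed.

Lemma holo_plus (F F' G G' : C -> C) : holo F F' -> holo G G' ->
  holo (fun z => F z + G z)%C (fun z => F' z + G' z)%C.
Proof.
intros [F1 F2] [G1 G2]; split.
- apply (partials_ext _ _ _ _ _ (partials_plus _ _ _ _ _ _ F1 G1));
  intros x y; unfold re_of, im_of, Re, Im; simpl; ring.
- apply (partials_ext _ _ _ _ _ (partials_plus _ _ _ _ _ _ F2 G2));
  intros x y; unfold re_of, im_of, Re, Im; simpl; ring.
Qed.

Lemma holo_const (c : C) : holo (fun _ => c) (fun _ => 0%C).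
Proof.
split.
- apply (partials_ext _ _ _ _ _ (partials_const (Re c))); intros; unfold re_of, im_of; simpl; ring.
- apply (partials_ext _ _ _ _ _ (partials_const (Im c))); intros; unfold re_of, im_of; simpl; ring.
Qed.

Lemma holo_scal (c : C) (F F' : C -> C) : holo F F' -> holo (fun z => c * F z)%C (fun z => c * F' z)%C.
Proof.
intros H; replace (fun z => c * F' z)%C with (fun z => 0 * F z + c * F' z)%C
  by (apply functional_extensionality; intros; ring).
apply (holo_mult (fun _ => c) (fun _ => 0%C)); auto; apply holo_const.
Qed.

Lemma partials_translate (g gx gy : R -> R -> R) (u v : R) : has_partials g gx gy ->
  has_partials (fun x y => g (x + u) (y + v)) (fun x y => gx (x + u) (y + v)) (fun x y => gy (x + u) (y + v)).
Proof.
intros H x y; split.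
- apply (is_derive_ext (fun t => g (t + u) (y + v))); [auto|].
  replace (gx (x + u) (y + v)) with (1 * gx (x + u) (y + v)) by ring.
  apply (is_derive_comp (fun t => g t (y + v)) (fun t => t + u)); [apply H|auto_derive; auto].
- replace (gy (x + u) (y + v)) with (1 * gy (x + u) (y + v)) by ring.
  apply (is_derive_comp (fun t => g (x + u) t) (fun t => t + v)); [apply H|auto_derive; auto].
Qed.

Lemma holo_translate (F F' : C -> C) (w : C) : holo F F' ->
  holo (fun z => F (z + w)%C) (fun z => F' (z + w)%C).
Proof.
intros [H1 H2]; destruct w as [u v]; split;
[exact (partials_translate _ _ _ u v H1)|exact (partials_translate _ _ _ u v H2)].
Qed.

Lemma smooth2_translate (g : R -> R -> R) (u v : R) :
  smooth2 g -> smooth2 (fun x y => g (x + u) (y + v)).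
Proof.
rewrite !smooth2_smoothn; intros H n; specialize (H n); revert g H.
assert (Hc : forall g, cont2 g -> cont2 (fun x y => g (x + u) (y + v))).
{ intros g Hg; apply cont2_comp; auto; apply cont2_plus;
  auto using cont2_fst, cont2_snd, cont2_const. }
induction n as [|n IH]; intros g [H1 H2]; split; auto.
destruct H2 as [gx [gy [Hp [Hx Hy]]]].
exists (fun x y => gx (x + u) (y + v)), (fun x y => gy (x + u) (y + v)).
split; [apply partials_translate, Hp|split; apply IH; auto].
Qed.

Lemma csmooth_translate (F : C -> C) (w : C) : csmooth F -> csmooth (fun z => F (z + w)%C).
Proof.
intros [H1 H2]; destruct w as [u v]; split;
[exact (smooth2_translate _ u v H1)|exact (smooth2_translate _ u v H2)].
Qed.

Lemma csmooth_mult (F G : C -> C) : csmooth F -> csmooth G -> csmooth (fun z => F z * G z)%C.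
Proof.
intros [F1 F2] [G1 G2]; split.
- exact (smooth2_minus _ _ (smooth2_mult _ _ F1 G1) (smooth2_mult _ _ F2 G2)).
- exact (smooth2_plus _ _ (smooth2_mult _ _ F1 G2) (smooth2_mult _ _ F2 G1)).
Qed.

Lemma csmooth_plus (F G : C -> C) : csmooth F -> csmooth G -> csmooth (fun z => F z + G z)%C.
Proof.
intros [F1 F2] [G1 G2]; split; [exact (smooth2_plus _ _ F1 G1)|exact (smooth2_plus _ _ F2 G2)].
Qed.

Lemma csmooth_const (c : C) : csmooth (fun _ => c).
Proof. split; [exact (smooth2_const (Re c))|exact (smooth2_const (Im c))]. Qed.

Lemma holo_unique (F F1 F2 : C -> C) (z : C) : holo F F1 -> holo F F2 -> F1 z = F2 z.
Proof.
intros [A1 A2] [B1 B2]; destruct z as [x y].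
destruct (pd_ext_partials _ _ _ x y A1) as [a1 _]; destruct (pd_ext_partials _ _ _ x y B1) as [b1 _].
destruct (pd_ext_partials _ _ _ x y A2) as [a2 _]; destruct (pd_ext_partials _ _ _ x y B2) as [b2 _].
rewrite b1 in a1; rewrite b2 in a2.
apply injective_projections; auto.
Qed.

Definition thtd (tau : C) (k d e l : R) (z : C) : C :=
  eser (fun n => (0, PI) * RtoC (l * (IZR n + d)))%C
       (fun n => ((0, PI) * RtoC (l * (IZR n + d)))
          * ee (tau * RtoC (k * (IZR n + d) ^ 2) + RtoC (e * IZR n)))%C z.

Lemma tht_holo tau k d e l : 0 < Im tau -> 0 < k -> 0 <= d <= 1 ->
  holo (tht tau k d e l) (thtd tau k d e l) /\ csmooth (tht tau k d e l).
Proof.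
intros Ht Hk Hd; split.
- exact (quad_holo_holo _ _ (eser_quad_holo _ _ _ (tht_growth d l Hd) (tht_rapid tau k d e Ht Hk Hd))).
- exact (eser_csmooth _ _ _ (tht_growth d l Hd) (tht_rapid tau k d e Ht Hk Hd)).
Qed.

Definition S1d (tau z : C) : C := thtd tau 1 (1 / 2) 1 2 z.
Definition B2d (tau z : C) : C := thtd tau 2 0 0 4 z.
Definition D2d (tau z : C) : C := thtd tau 2 (1 / 2) 0 4 z.

Lemma S1_holo tau : 0 < Im tau -> holo (S1 tau) (S1d tau) /\ csmooth (S1 tau).
Proof. intros Ht; exact (tht_holo tau 1 (1 / 2) 1 2 Ht ltac:(lra) ltac:(lra)). Qed.

Lemma B2_holo tau : 0 < Im tau -> holo (B2 tau) (B2d tau) /\ csmooth (B2 tau).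
Proof. intros Ht; exact (tht_holo tau 2 0 0 4 Ht ltac:(lra) ltac:(lra)). Qed.

Lemma D2_holo tau : 0 < Im tau -> holo (D2 tau) (D2d tau) /\ csmooth (D2 tau).
Proof. intros Ht; exact (tht_holo tau 2 (1 / 2) 0 4 Ht ltac:(lra) ltac:(lra)). Qed.

(** The derivative in x of the addition formula at x = y, where S1 (x - y) vanishes and only its
    derivative survives. *)
Lemma S1_wronskian tau y : 0 < Im tau ->
  (S1 tau (y + y) * S1d tau 0 = D2d tau y * B2 tau y - B2d tau y * D2 tau y)%C.
Proof.
intros Ht.
destruct (S1_holo tau Ht) as [HS _]; destruct (B2_holo tau Ht) as [HB _];
destruct (D2_holo tau Ht) as [HD _].
assert (H1 := holo_mult _ _ _ _ (holo_translate _ _ y HS) (holo_translate _ _ (- y)%C HS)).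
assert (H2 := holo_plus _ _ _ _ (holo_scal (B2 tau y) _ _ HD) (holo_scal (- D2 tau y)%C _ _ HB)).
assert (Ef : (fun z => B2 tau y * D2 tau z + - D2 tau y * B2 tau z)%C
   = (fun z => S1 tau (z + y) * S1 tau (z + - y))%C).
{ apply functional_extensionality; intros z; symmetry.
  transitivity (S1 tau (z + y) * S1 tau (z - y))%C; [reflexivity|].
  rewrite (S1_addition tau z y Ht); ring. }
assert (H3 : holo (fun z => S1 tau (z + y) * S1 tau (z + - y))%C
   (fun z => B2 tau y * D2d tau z + - D2 tau y * B2d tau z)%C) by (rewrite <- Ef; exact H2).
assert (E := holo_unique _ _ _ y H1 H3); simpl in E.
rewrite Cplus_opp_r, (S1_0 tau Ht) in E.
transitivity (S1d tau (y + y) * 0 + S1 tau (y + y) * S1d tau 0)%C; [ring|].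
rewrite E; ring.
Qed.

(** U / V has derivative 0 near 0; the argument runs along the real axis, on real and imaginary
    parts, by the mean value theorem. *)
Lemma proportional_of_wronskian (U U' V V' : C -> C) : holo U U' -> holo V V' ->
  (forall z, (U' z * V z - V' z * U z = 0)%C) -> V 0%C <> 0%C ->
  exists eps, 0 < eps /\ forall t, 0 < t < eps -> (U (RtoC t) * V 0 = V (RtoC t) * U 0)%C.
Proof.
intros [HU1 HU2] [HV1 HV2] HW H0.
set (u1 := fun t => Re (U (RtoC t))); set (u2 := fun t => Im (U (RtoC t))).
set (v1 := fun t => Re (V (RtoC t))); set (v2 := fun t => Im (V (RtoC t))).
assert (du1 : forall t, is_derive u1 t (Re (U' (RtoC t)))) by (intros t; exact (proj1 (HU1 t 0))).
assert (du2 : forall t, is_derive u2 t (Im (U' (RtoC t)))) by (intros t; exact (proj1 (HU2 t 0))).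
assert (dv1 : forall t, is_derive v1 t (Re (V' (RtoC t)))) by (intros t; exact (proj1 (HV1 t 0))).
assert (dv2 : forall t, is_derive v2 t (Im (V' (RtoC t)))) by (intros t; exact (proj1 (HV2 t 0))).
set (n := fun t => v1 t * v1 t + v2 t * v2 t).
assert (dn : forall t, is_derive n t (Re (V' (RtoC t)) * v1 t + v1 t * Re (V' (RtoC t))
   + (Im (V' (RtoC t)) * v2 t + v2 t * Im (V' (RtoC t))))).
{ intros t; apply (is_derive_plus (fun t => v1 t * v1 t) (fun t => v2 t * v2 t)).
  - apply (is_derive_mult v1 v1); auto using Rmult_comm.
  - apply (is_derive_mult v2 v2); auto using Rmult_comm. }
assert (Hn0 : 0 < n 0).
{ unfold n, v1, v2. apply Cmod_gt_0 in H0.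
  assert (E := Cmod2_alt (V 0%C)). nra. }
assert (Hcont : continuous n 0) by (apply (ex_derive_continuous (V := R_NormedModule) n); eexists; apply dn).
assert (Heps : exists eps, 0 < eps /\ forall t, Rabs t < eps -> 0 < n t).
{ assert (Hl : locally (n 0) (fun y => 0 < y)) by (apply open_gt; auto).
  destruct (Hcont _ Hl) as [eps He].
  exists eps; split; [apply eps|]; intros t Ht; apply He.
  unfold ball; simpl; unfold AbsRing_ball, abs, minus, plus, opp; simpl.
  replace (t + - 0) with t by ring; auto. }
destruct Heps as [eps [Heps Hpos]].
exists eps; split; auto; intros t Ht.
assert (HWr : forall s, (Re (U' (RtoC s)) * v1 s - Im (U' (RtoC s)) * v2 s
    - (Re (V' (RtoC s)) * u1 s - Im (V' (RtoC s)) * u2 s) = 0) /\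
   (Re (U' (RtoC s)) * v2 s + Im (U' (RtoC s)) * v1 s
    - (Re (V' (RtoC s)) * u2 s + Im (V' (RtoC s)) * u1 s) = 0)).
{ intros s; specialize (HW (RtoC s)); unfold u1, u2, v1, v2.
  split; [apply (f_equal Re) in HW|apply (f_equal Im) in HW]; unfold Re, Im in *; simpl in *; lra. }
(* Real and imaginary parts of U conj V / |V|^2. Their derivatives are those of (U' V - V' U)
   conj(V)^2 / |V|^4, which explains the weights q1^2 - q2^2 and 2 q1 q2. *)
assert (dq : forall s, Rabs s < eps ->
  is_derive (fun s => (u1 s * v1 s + u2 s * v2 s) * / n s) s 0 /\
  is_derive (fun s => (u2 s * v1 s - u1 s * v2 s) * / n s) s 0).
{ intros s Hs; assert (Hns := Hpos s Hs).
  destruct (HWr s) as [W1 W2].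
  assert (di := is_derive_inv n s _ (dn s) (Rgt_not_eq _ _ Hns)).
  assert (d11 := is_derive_mult u1 v1 s _ _ (du1 s) (dv1 s) Rmult_comm).
  assert (d22 := is_derive_mult u2 v2 s _ _ (du2 s) (dv2 s) Rmult_comm).
  assert (d21 := is_derive_mult u2 v1 s _ _ (du2 s) (dv1 s) Rmult_comm).
  assert (d12 := is_derive_mult u1 v2 s _ _ (du1 s) (dv2 s) Rmult_comm).
  assert (e1 := is_derive_mult _ _ s _ _ (is_derive_plus _ _ s _ _ d11 d22) di Rmult_comm).
  assert (e2 := is_derive_mult _ _ s _ _ (is_derive_minus _ _ s _ _ d21 d12) di Rmult_comm).
  unfold plus, minus, opp, mult in e1, e2; simpl in e1, e2; unfold plus, mult, opp in e1, e2; simpl in e1, e2.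
  assert (Hne : n s <> 0) by lra.
  split.
  - match type of e1 with is_derive _ _ ?l => replace l with 0 in e1; [exact e1|] end.
    revert W1 W2 Hne; unfold n.
    generalize (u1 s) (u2 s) (v1 s) (v2 s) (Re (U' (RtoC s))) (Im (U' (RtoC s))) (Re (V' (RtoC s))) (Im (V' (RtoC s))).
    intros p1 p2 q1 q2 a1 a2 b1 b2 W1 W2 Hne.
    transitivity (((a1 * q1 - a2 * q2 - (b1 * p1 - b2 * p2)) * (q1 * q1 - q2 * q2)
       + (a1 * q2 + a2 * q1 - (b1 * p2 + b2 * p1)) * (2 * q1 * q2)) / ((q1 * q1 + q2 * q2) ^ 2)).
    + rewrite W1, W2; field; auto.
    + field; auto.
  - match type of e2 with is_derive _ _ ?l => replace l with 0 in e2; [exact e2|] end.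
    revert W1 W2 Hne; unfold n.
    generalize (u1 s) (u2 s) (v1 s) (v2 s) (Re (U' (RtoC s))) (Im (U' (RtoC s))) (Re (V' (RtoC s))) (Im (V' (RtoC s))).
    intros p1 p2 q1 q2 a1 a2 b1 b2 W1 W2 Hne.
    transitivity (((a1 * q2 + a2 * q1 - (b1 * p2 + b2 * p1)) * (q1 * q1 - q2 * q2)
       - (a1 * q1 - a2 * q2 - (b1 * p1 - b2 * p2)) * (2 * q1 * q2)) / ((q1 * q1 + q2 * q2) ^ 2)).
    + rewrite W1, W2; field; auto.
    + field; auto. }
assert (Hconst : forall q : R -> R, (forall s, Rabs s < eps -> is_derive q s 0) -> q t = q 0).
{ intros q Hq.
  destruct (MVT_gen q 0 t (fun _ => 0)) as [c [_ Hc]].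
  - intros s Hs; apply Hq; rewrite Rmin_left, Rmax_right in Hs by lra; rewrite Rabs_pos_eq; lra.
  - intros s Hs; rewrite Rmin_left, Rmax_right in Hs by lra.
    apply continuity_pt_filterlim, (ex_derive_continuous (V := R_NormedModule) q); exists 0; apply Hq; rewrite Rabs_pos_eq; lra.
  - lra. }
assert (Q1 := Hconst _ (fun s Hs => proj1 (dq s Hs))).
assert (Q2 := Hconst _ (fun s Hs => proj2 (dq s Hs))).
cbv beta in Q1, Q2.
assert (Hnt := Hpos t ltac:(rewrite Rabs_pos_eq; lra)).
assert (Et : (U (RtoC t) = (((u1 0 * v1 0 + u2 0 * v2 0) * / n 0)%R, ((u2 0 * v1 0 - u1 0 * v2 0) * / n 0)%R) * V (RtoC t))%C).
{ rewrite <- Q1, <- Q2.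
  apply injective_projections; simpl; change (fst (U (RtoC t))) with (u1 t); change (snd (U (RtoC t))) with (u2 t);
  change (fst (V (RtoC t))) with (v1 t); change (snd (V (RtoC t))) with (v2 t); unfold n in *; field; lra. }
assert (E0 : (U 0 = (((u1 0 * v1 0 + u2 0 * v2 0) * / n 0)%R, ((u2 0 * v1 0 - u1 0 * v2 0) * / n 0)%R) * V 0)%C).
{ apply injective_projections; simpl; change (fst (U (RtoC 0))) with (u1 0); change (snd (U (RtoC 0))) with (u2 0);
  change (fst (V (RtoC 0))) with (v1 0); change (snd (V (RtoC 0))) with (v2 0); unfold n in *; field; lra. }
rewrite Et, E0; ring.
Qed.

Lemma S1_square tau x : 0 < Im tau ->
  (S1 tau x * S1 tau x = D2 tau x * B2 tau 0 - B2 tau x * D2 tau 0)%C.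
Proof.
intros Ht; assert (E := S1_addition tau x 0 Ht).
replace (x + 0)%C with x in E by ring; replace (x - 0)%C with x in E by ring; exact E.
Qed.

Lemma Csqr_eq0 (z : C) : (z * z = 0)%C -> z = 0%C.
Proof.
intros H; destruct (classic (z = 0%C)) as [E|E]; auto; exfalso; exact (Cmult_neq_0 z z E E H).
Qed.

Lemma S1_real_neq0 tau t : 0 < Im tau -> 0 < t < 1 -> S1 tau (RtoC t) <> 0%C.
Proof.
intros Ht H E; apply S1_zero in E; auto; destruct E as [m [n E]].
destruct tau as [a b]; unfold RtoC, Cplus, Cmult in E; simpl in *; injection E; intros E2 E1.
assert (Hn : IZR n = 0) by nra.
rewrite Hn in E1.
assert (E3 : t = IZR m) by lra.
rewrite E3 in H; destruct H as [H1 H2]; apply lt_IZR in H1; apply lt_IZR in H2; lia.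
Qed.

(* If [S1'(0)] vanished, the Wronskian of [D2] and [B2] would vanish identically, so their
   ratio would be constant on a real interval, and [S1] would vanish there. *)
Lemma S1d_0_neq0 tau : 0 < Im tau -> S1d tau 0%C <> 0%C.
Proof.
intros Ht H.
destruct (B2_holo tau Ht) as [HB _]; destruct (D2_holo tau Ht) as [HD _].
assert (HW : forall z, (D2d tau z * B2 tau z - B2d tau z * D2 tau z = 0)%C).
{ intros z; rewrite <- (S1_wronskian tau z Ht), H; ring. }
assert (Hc : exists eps, 0 < eps /\ forall t, 0 < t < eps ->
   (D2 tau (RtoC t) * B2 tau 0 = B2 tau (RtoC t) * D2 tau 0)%C).
{ destruct (classic (B2 tau 0%C = 0%C)) as [E|E].
  - destruct (classic (D2 tau 0%C = 0%C)) as [E'|E'].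
    + exists 1; split; [lra|]; intros t _; rewrite E, E'; ring.
    + destruct (proportional_of_wronskian _ _ _ _ HB HD) as [eps [He Hp]]; auto.
      * intros z; transitivity (- (D2d tau z * B2 tau z - B2d tau z * D2 tau z))%C; [ring|].
        rewrite HW; ring.
      * exists eps; split; auto; intros t Htt; symmetry; apply Hp, Htt.
  - exact (proportional_of_wronskian _ _ _ _ HD HB HW E). }
destruct Hc as [eps [He Hc]].
set (t := Rmin eps 1 / 2).
assert (Hm : 0 < Rmin eps 1) by (apply Rmin_pos; lra).
assert (H1 := Rmin_l eps 1); assert (H2 := Rmin_r eps 1).
apply (S1_real_neq0 tau t Ht); [unfold t; lra|].
apply Csqr_eq0; rewrite (S1_square tau _ Ht), (Hc t) by (unfold t; lra); ring.
Qed.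

(** * Products of theta functions *)

Definition sh (tau p z : C) : C := S1 tau (z + - p)%C.

Fixpoint ps (tau : C) (l : list C) (z : C) : C :=
  match l with nil => 1%C | p :: l' => (sh tau p z * ps tau l' z)%C end.

Fixpoint psd (tau : C) (l : list C) (z : C) : C :=
  match l with
  | nil => 0%C
  | p :: l' => (S1d tau (z + - p) * ps tau l' z + sh tau p z * psd tau l' z)%C
  end.

Fixpoint csum (l : list C) : C := match l with nil => 0%C | p :: l' => (p + csum l')%C end.

Lemma ps_holo tau l : 0 < Im tau -> holo (ps tau l) (psd tau l) /\ csmooth (ps tau l).
Proof.
intros Ht; destruct (S1_holo tau Ht) as [HS CS].
induction l as [|p l [IH1 IH2]].
- split; [exact (holo_const 1)|exact (csmooth_const 1)].
- split.
  + exact (holo_mult _ _ _ _ (holo_translate _ _ (- p)%C HS) IH1).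
  + exact (csmooth_mult _ _ (csmooth_translate _ (- p)%C CS) IH2).
Qed.

(** Automorphy factor of a product of k translates of [S1]. It sees the zeros only through their
    number and their sum [sg], so lists with equal length and sum give sections of one bundle. *)
Definition mulfac (tau z : C) (k : nat) (sg : C) (m n : Z) : C :=
  ee (RtoC (INR k) * (RtoC (IZR m - IZR n) - tau * RtoC (IZR n ^ 2) - RtoC (2 * IZR n) * z)
      + RtoC (2 * IZR n) * sg)%C.

Lemma ps_quasi tau l z m n : 0 < Im tau ->
  ps tau l (z + lat tau m n)%C = (mulfac tau z (length l) (csum l) m n * ps tau l z)%C.
Proof.
intros Ht; induction l as [|p l IH].
- simpl; unfold mulfac.
  replace (ee _) with (RtoC 1); [ring|].
  rewrite <- ee_0; f_equal; simpl; ring.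
- simpl ps; rewrite IH; unfold sh.
  replace (z + lat tau m n + - p)%C with (z + - p + lat tau m n)%C by ring.
  rewrite (S1_quasi tau _ m n Ht).
  assert (E : mulfac tau z (length (p :: l)) (csum (p :: l)) m n =
    (ee (RtoC (IZR m - IZR n) - tau * RtoC (IZR n ^ 2) - RtoC (2 * IZR n) * (z + - p))
     * mulfac tau z (length l) (csum l) m n)%C).
  { unfold mulfac; rewrite <- ee_plus; f_equal.
    change (length (p :: l)) with (S (length l)); rewrite S_INR, RtoC_plus; simpl csum; ring. }
  rewrite E; ring.
Qed.

Lemma mulfac_neq0 tau z k sg m n : mulfac tau z k sg m n <> 0%C.
Proof. apply ee_neq0. Qed.

Lemma ps_zero tau l z : 0 < Im tau ->
  (ps tau l z = 0%C <-> exists p, In p l /\ in_lattice tau (z + - p)%C).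
Proof.
intros Ht; induction l as [|p l IH]; simpl.
- split; [intros E; apply RtoC_inj in E; lra|intros [p [[] _]]].
- split.
  + intros E; destruct (classic (sh tau p z = 0%C)) as [E1|E1].
    * exists p; split; auto; apply S1_lattice; auto.
    * destruct (classic (ps tau l z = 0%C)) as [E2|E2]; [|exfalso; exact (Cmult_neq_0 _ _ E1 E2 E)].
      apply IH in E2; destruct E2 as [q [Hq E2]]; exists q; auto.
  + intros [q [[<-|Hq] E]].
    * unfold sh; rewrite (proj2 (S1_lattice tau _ Ht) E); ring.
    * rewrite (proj2 IH) by (exists q; auto); ring.
Qed.

Definition wr (F F' G G' : C -> C) (z : C) : C := (F z * G' z - F' z * G z)%C.

(* Differentiating [F (z + w) G z = G (z + w) F z] avoids the derivative of the multiplier. *)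
Lemma wr_quasi (F F' G G' : C -> C) (w z : C) (M : C -> C) : holo F F' -> holo G G' ->
  (forall z, F (z + w)%C = (M z * F z)%C) -> (forall z, G (z + w)%C = (M z * G z)%C) ->
  wr F F' G G' (z + w)%C = (M z * M z * wr F F' G G' z)%C.
Proof.
intros HF HG EF EG.
assert (H1 := holo_mult _ _ _ _ (holo_translate _ _ w HF) HG).
assert (H2 := holo_mult _ _ _ _ (holo_translate _ _ w HG) HF).
assert (Ef : (fun z => F (z + w) * G z)%C = (fun z => G (z + w) * F z)%C).
{ apply functional_extensionality; intros u; rewrite EF, EG; ring. }
assert (H3 : holo (fun z => F (z + w) * G z)%C (fun z => G' (z + w) * F z + G (z + w) * F' z)%C)
  by (rewrite Ef; exact H2).
assert (E := holo_unique _ _ _ z H1 H3); simpl in E.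
unfold wr; rewrite EF, EG in *.
transitivity (M z * (G' (z + w) * F z - F' (z + w) * G z))%C; [ring|].
replace (G' (z + w) * F z - F' (z + w) * G z)%C
  with ((G' (z + w) * F z + M z * G z * F' z) - F' (z + w) * G z - M z * G z * F' z)%C by ring.
rewrite <- E; ring.
Qed.

Lemma wr_common_factor (F F' G G' R R' : C -> C) (z : C) :
  wr (fun z => F z * R z)%C (fun z => F' z * R z + F z * R' z)%C
     (fun z => G z * R z)%C (fun z => G' z * R z + G z * R' z)%C z
  = (R z * R z * wr F F' G G' z)%C.
Proof. unfold wr; ring. Qed.

Lemma wr_unique (F F1 F2 G G1 G2 : C -> C) (z : C) : holo F F1 -> holo F F2 -> holo G G1 -> holo G G2 ->
  wr F F1 G G1 z = wr F F2 G G2 z.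
Proof.
intros A1 A2 B1 B2; unfold wr; rewrite (holo_unique _ _ _ z A1 A2), (holo_unique _ _ _ z B1 B2); auto.
Qed.

Lemma sh_pair tau c g z : 0 < Im tau ->
  (sh tau (c + g) z * sh tau (c - g) z = D2 tau (z + - c) * B2 tau g - B2 tau (z + - c) * D2 tau g)%C.
Proof.
intros Ht; rewrite <- (S1_addition tau (z + - c) g Ht), Cmult_comm; unfold sh.
f_equal; f_equal; ring.
Qed.

(** Both products lie in the span of [D2] and [B2] at z - c, so the Wronskian is a 2 by 2
    determinant times that of [D2] and [B2]. The addition formula evaluates the former,
    [S1_wronskian] the latter, and the zeros become explicit. *)
Lemma wr_pair (tau c g d z : C) : 0 < Im tau ->
  exists F' G', holo (fun z => sh tau (c + g) z * sh tau (c - g) z)%C F' /\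
    holo (fun z => sh tau (c + d) z * sh tau (c - d) z)%C G' /\
    wr (fun z => sh tau (c + g) z * sh tau (c - g) z)%C F'
       (fun z => sh tau (c + d) z * sh tau (c - d) z)%C G' z =
    (- (S1 tau (g + d) * S1 tau (g - d)) * (S1 tau ((z + - c) + (z + - c)) * S1d tau 0))%C.
Proof.
intros Ht.
destruct (B2_holo tau Ht) as [HB _]; destruct (D2_holo tau Ht) as [HD _].
assert (HH : forall h, holo (fun z => sh tau (c + h) z * sh tau (c - h) z)%C
   (fun z => B2 tau h * D2d tau (z + - c) + - D2 tau h * B2d tau (z + - c))%C).
{ intros h.
  assert (Ef : (fun z => sh tau (c + h) z * sh tau (c - h) z)%C =
     (fun z => B2 tau h * D2 tau (z + - c) + - D2 tau h * B2 tau (z + - c))%C).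
  { apply functional_extensionality; intros u; rewrite (sh_pair tau c h u Ht); ring. }
  rewrite Ef.
  exact (holo_plus _ _ _ _ (holo_scal (B2 tau h) _ _ (holo_translate _ _ (- c)%C HD))
    (holo_scal (- D2 tau h)%C _ _ (holo_translate _ _ (- c)%C HB))). }
do 2 eexists; split; [exact (HH g)|split; [exact (HH d)|]].
rewrite (S1_wronskian tau (z + - c) Ht), (S1_addition tau g d Ht); unfold wr.
rewrite !(sh_pair tau c _ z Ht); ring.
Qed.

(** Every sufficiently small x > 0 works: x |v| < |u| as soon as x < |u| / (|v| + 1). *)
Lemma finite_avoid (l : list (C * C)) : (forall p, In p l -> fst p <> 0%C) ->
  exists x, 0 < x /\ forall p, In p l -> (fst p + RtoC x * snd p <> 0)%C.
Proof.
intros H.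
assert (Hs : exists e, 0 < e /\ forall x, 0 < x < e -> forall p, In p l -> (fst p + RtoC x * snd p <> 0)%C).
{ induction l as [|[u v] l IH].
  - exists 1; split; [lra|]; intros x _ p [].
  - destruct IH as [e [He IH]]; [intros p Hp; apply H; right; auto|].
    assert (Hu : 0 < Cmod u) by (apply Cmod_gt_0; apply (H (u, v)); left; auto).
    assert (Hv := Cmod_ge_0 v).
    assert (Hd : 0 < Cmod u / (Cmod v + 1)) by (apply Rdiv_lt_0_compat; lra).
    exists (Rmin e (Cmod u / (Cmod v + 1))); split; [apply Rmin_pos; auto|].
    intros x [Hx1 Hx2] p [<-|Hp].
    + simpl; intros E.
      assert (Eu : u = (- (RtoC x * v))%C)
        by (transitivity (u + RtoC x * v - RtoC x * v)%C; [ring|rewrite E; ring]).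
      assert (Em : Cmod u = x * Cmod v)
        by (rewrite Eu, Cmod_opp, Cmod_mult, Cmod_R, Rabs_pos_eq by lra; auto).
      assert (T := Rlt_le_trans _ _ _ Hx2 (Rmin_r _ _)).
      apply Rlt_div_r in T; [|lra]; nra.
    + apply IH; auto; split; auto; apply Rlt_le_trans with (1 := Hx2), Rmin_l. }
destruct Hs as [e [He Hs]]; exists (e / 2); split; [lra|]; apply Hs; lra.
Qed.

(** * The sections *)

(** Real coordinates with respect to 1 and tau, in which lattice membership is integrality of [s]
    and [t]. *)
Definition pt (tau : C) (s t : R) : C := (RtoC s + tau * RtoC t)%C.

Lemma pt_sub tau s t s' t' : (pt tau s t + - pt tau s' t')%C = pt tau (s - s') (t - t').
Proof. unfold pt; rewrite !RtoC_minus; ring. Qed.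

Lemma pt_add tau s t s' t' : (pt tau s t + pt tau s' t')%C = pt tau (s + s') (t + t').
Proof. unfold pt; rewrite !RtoC_plus; ring. Qed.

Lemma pt_minus tau s t s' t' : (pt tau s t - pt tau s' t')%C = pt tau (s - s') (t - t').
Proof. apply pt_sub. Qed.

Lemma pt_lattice tau s t : 0 < Im tau -> in_lattice tau (pt tau s t) ->
  exists m n, s = IZR m /\ t = IZR n.
Proof.
unfold pt; intros Ht [m [n E]]; exists m, n.
destruct tau as [a b]; unfold RtoC, Cplus, Cmult in E; simpl in *; injection E; intros E2 E1.
assert (Et : t = IZR n) by nra.
split; auto; rewrite Et in E1; lra.
Qed.

Definition nonint (r : R) : Prop := forall m : Z, r <> IZR m.

Lemma nonint_frac (r : R) (p q : Z) : (0 < q)%Z -> (p mod q <> 0)%Z -> IZR q * r = IZR p -> nonint r.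
Proof.
intros Hq Hp E m Em; rewrite Em, <- mult_IZR in E; apply eq_IZR in E.
apply Hp; rewrite <- E, Z.mul_comm; apply Z_mod_mult.
Qed.

Lemma pt_not_lattice tau s t : 0 < Im tau -> nonint s \/ nonint t -> ~ in_lattice tau (pt tau s t).
Proof.
intros Ht [H|H] E; apply (pt_lattice tau s t Ht) in E; destruct E as [m [n [E1 E2]]].
- exact (H m E1).
- exact (H n E2).
Qed.

Lemma ps_neq0 tau l z : 0 < Im tau -> (forall p, In p l -> ~ in_lattice tau (z + - p)%C) ->
  ps tau l z <> 0%C.
Proof. intros Ht H E; apply (ps_zero tau l z Ht) in E; destruct E as [p [Hp E]]; exact (H p Hp E). Qed.

Lemma in_lattice_0 tau : in_lattice tau 0%C.
Proof. exists 0%Z, 0%Z; ring. Qed.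

Lemma ps_at_node tau l p : 0 < Im tau -> In p l -> ps tau l p = 0%C.
Proof.
intros Ht Hp; apply ps_zero; auto; exists p; split; auto.
rewrite Cplus_opp_r; apply in_lattice_0.
Qed.

(** In the product rule only the term differentiating the factor at [p] survives; it is S1'(0) times
    values of [S1] off the lattice. *)
Lemma psd_simple tau l p : 0 < Im tau -> NoDup l -> In p l ->
  (forall q, In q l -> q <> p -> ~ in_lattice tau (p + - q)%C) -> psd tau l p <> 0%C.
Proof.
intros Ht; induction l as [|q l IH]; intros Hnd Hp Hsep; [destruct Hp|].
inversion Hnd as [|? ? Hq Hl]; subst.
simpl; destruct (classic (q = p)) as [->|Hqp].
- unfold sh; rewrite Cplus_opp_r, (S1_0 tau Ht).
  replace (S1d tau 0 * ps tau l p + 0 * psd tau l p)%C with (S1d tau 0 * ps tau l p)%C by ring.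
  apply Cmult_neq_0; [apply S1d_0_neq0, Ht|].
  apply ps_neq0; auto; intros r Hr; apply Hsep; [right; auto|].
  intros ->; auto.
- destruct Hp as [Hp|Hp]; [congruence|].
  rewrite (ps_at_node tau l p Ht Hp).
  replace (S1d tau (p + - q) * 0 + sh tau q p * psd tau l p)%C with (sh tau q p * psd tau l p)%C by ring.
  apply Cmult_neq_0.
  + intros E; apply (Hsep q); auto; [left; auto|]; apply S1_lattice; auto.
  + apply IH; auto; intros r Hr; apply Hsep; right; auto.
Qed.

Lemma wr_pair_list (tau c g d z : C) (l : list C) : 0 < Im tau ->
  wr (ps tau (c + g :: c - g :: l)%C) (psd tau (c + g :: c - g :: l)%C)
     (ps tau (c + d :: c - d :: l)%C) (psd tau (c + d :: c - d :: l)%C) z =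
  (ps tau l z * ps tau l z *
   (- (S1 tau (g + d) * S1 tau (g - d)) * (S1 tau ((z + - c) + (z + - c)) * S1d tau 0)))%C.
Proof.
intros Ht; destruct (wr_pair tau c g d z Ht) as (F' & G' & HF & HG & E).
destruct (ps_holo tau l Ht) as [HL _].
assert (Ef : forall h, ps tau (c + h :: c - h :: l)%C =
   (fun z => sh tau (c + h) z * sh tau (c - h) z * ps tau l z)%C).
{ intros h; apply functional_extensionality; intros u; simpl; ring. }
assert (A1 : holo (ps tau (c + g :: c - g :: l)%C) (fun z => F' z * ps tau l z
    + (sh tau (c + g) z * sh tau (c - g) z) * psd tau l z)%C)
  by (rewrite Ef; exact (holo_mult _ _ _ _ HF HL)).
assert (A2 : holo (ps tau (c + d :: c - d :: l)%C) (fun z => G' z * ps tau l z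
    + (sh tau (c + d) z * sh tau (c - d) z) * psd tau l z)%C)
  by (rewrite Ef; exact (holo_mult _ _ _ _ HG HL)).
rewrite (wr_unique _ _ _ _ _ _ z (proj1 (ps_holo tau _ Ht)) A1 (proj1 (ps_holo tau _ Ht)) A2).
rewrite !Ef, <- E.
exact (wr_common_factor _ _ _ _ _ _ z).
Qed.

(** Equally spaced on the line t = 1/3. This height keeps them off the half periods and, modulo the
    lattice, off the real zeros 1/4, -1/4 of [s0] and 1/3, -1/3 of [s1]. *)
Definition node (tau : C) (n i : nat) : C := pt tau (INR i / INR n) (1 / 3).
Definition nodes (tau : C) (n : nat) : list C := map (node tau n) (seq 0 n).
(* The four lists have equal sums, so that the products have the same multipliers.  [A] controls
   the Wronskian at the half periods, where that of [s0, s1] vanishes; [B] is there for its values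
   at the common zeros of [s0] and [s1]. *)
Definition zeros0 (tau : C) (n : nat) : list C := pt tau (1 / 4) 0 :: pt tau (- (1 / 4)) 0 :: nodes tau n.
Definition zeros1 (tau : C) (n : nat) : list C := pt tau (1 / 3) 0 :: pt tau (- (1 / 3)) 0 :: nodes tau n.
Definition zerosA (tau : C) (n : nat) : list C :=
  pt tau 0 (1 / 6) :: pt tau (- (1 / 4)) (1 / 6) :: pt tau (1 / 4) 0 :: map (node tau n) (seq 1 (n - 1)).
Definition zerosB (tau : C) (n : nat) : list C :=
  pt tau 0 (1 / 2) :: pt tau 0 (- (1 / 2) - INR n / 3)
  :: map (fun i => pt tau (INR i / INR n) (2 / 3)) (seq 0 n).

Lemma nodes_cons tau n : (1 <= n)%nat ->
  nodes tau n = pt tau 0 (1 / 3) :: map (node tau n) (seq 1 (n - 1)).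
Proof.
intros Hn; unfold nodes; destruct n as [|n]; [lia|].
simpl; rewrite Nat.sub_0_r; f_equal; unfold node, pt.
unfold Rdiv; rewrite Rmult_0_l; reflexivity.
Qed.

Lemma zeros_length tau n : (1 <= n)%nat ->
  length (zeros0 tau n) = (n + 2)%nat /\ length (zeros1 tau n) = (n + 2)%nat /\
  length (zerosA tau n) = (n + 2)%nat /\ length (zerosB tau n) = (n + 2)%nat.
Proof.
intros Hn; unfold zeros0, zeros1, zerosA, zerosB, nodes; simpl.
rewrite !length_map, !length_seq; lia.
Qed.

Lemma zeros_sum tau n : (1 <= n)%nat ->
  csum (zeros1 tau n) = csum (zeros0 tau n) /\
  csum (zerosA tau n) = csum (zeros0 tau n) /\
  csum (zerosB tau n) = csum (zeros0 tau n).
Proof.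
intros Hn; split; [|split].
- unfold zeros0, zeros1; simpl; unfold pt; rewrite !RtoC_opp; ring.
- unfold zeros0, zerosA; rewrite (nodes_cons tau n Hn); simpl.
  assert (E : (pt tau 0 (1 / 6) + pt tau (- (1 / 4)) (1 / 6) + pt tau (1 / 4) 0 =
    pt tau (1 / 4) 0 + pt tau (- (1 / 4)) 0 + pt tau 0 (1 / 3))%C)
    by (rewrite !pt_add; f_equal; field).
  transitivity (pt tau 0 (1 / 6) + pt tau (- (1 / 4)) (1 / 6) + pt tau (1 / 4) 0
     + csum (map (node tau n) (seq 1 (n - 1))))%C; [ring|].
  rewrite E; ring.
- unfold zeros0, zerosB, nodes; simpl.
  assert (E : forall l, csum (map (fun i => pt tau (INR i / INR n) (2 / 3)) l) =
     (csum (map (node tau n) l) + pt tau 0 (INR (length l) / 3))%C).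
  { induction l as [|i l IH]; simpl csum; simpl map; simpl csum.
    - unfold pt; simpl; unfold Rdiv; rewrite Rmult_0_l; ring.
    - rewrite IH; change (length (i :: l)) with (S (length l)); rewrite S_INR.
      transitivity (pt tau (INR i / INR n) (2 / 3) + pt tau 0 (INR (length l) / 3)
        + csum (map (node tau n) l))%C; [ring|].
      transitivity (node tau n i + pt tau 0 ((INR (length l) + 1) / 3) + csum (map (node tau n) l))%C; [|ring].
      unfold node; rewrite !pt_add; do 2 f_equal; field. }
  rewrite E, length_seq.
  transitivity (pt tau 0 (1 / 2) + pt tau 0 (- (1 / 2) - INR n / 3) + pt tau 0 (INR n / 3)
     + csum (map (node tau n) (seq 0 n)))%C; [ring|].
  transitivity (pt tau (1 / 4) 0 + pt tau (- (1 / 4)) 0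
     + csum (map (node tau n) (seq 0 n)))%C; [|ring].
  rewrite !pt_add; do 2 f_equal; field.
Qed.

Ltac nonint_tac p q := apply (nonint_frac _ p q); [lia | discriminate | lra].

Lemma node_sep tau n i j : 0 < Im tau -> (i < n)%nat -> (j < n)%nat -> i <> j ->
  ~ in_lattice tau (node tau n i + - node tau n j)%C.
Proof.
intros Ht Hi Hj Hij; unfold node; rewrite pt_sub; apply pt_not_lattice; auto; left.
intros m E.
assert (Hn : 0 < INR n) by (apply lt_0_INR; lia).
assert (E2 : INR i - INR j = IZR m * INR n) by (rewrite <- E; field; lra).
rewrite !INR_IZR_INZ, <- minus_IZR, <- mult_IZR in E2; apply eq_IZR in E2.
assert (m = 0)%Z by nia; subst m; lia.
Qed.

Lemma pt_inj tau s t s' t' : 0 < Im tau -> pt tau s t = pt tau s' t' -> s = s' /\ t = t'.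
Proof.
intros Ht E; destruct tau as [a b]; unfold pt, RtoC, Cplus, Cmult in E; simpl in *.
injection E; intros E2 E1; assert (t = t') by nra; subst; split; auto; lra.
Qed.

Lemma node_inj tau n i j : 0 < Im tau -> (1 <= n)%nat -> node tau n i = node tau n j -> i = j.
Proof.
intros Ht Hn E.
assert (Hn' : 0 < INR n) by (apply lt_0_INR; lia).
apply pt_inj in E; auto; destruct E as [E _]; apply INR_eq.
apply Rmult_eq_reg_r with (/ INR n); auto; apply Rgt_not_eq, Rinv_0_lt_compat; auto.
Qed.

Lemma in_nodes tau n p : In p (nodes tau n) -> exists i, (i < n)%nat /\ p = node tau n i.
Proof.
intros H; apply in_map_iff in H; destruct H as [i [<- Hi]]; apply in_seq in Hi; exists i; split; auto; lia.
Qed.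

Lemma zeros0_nodup tau n : 0 < Im tau -> (1 <= n)%nat -> NoDup (zeros0 tau n).
Proof.
intros Ht Hn.
assert (Hnot : forall s, ~ In (pt tau s 0) (nodes tau n)).
{ intros s H; apply in_nodes in H; destruct H as [i [_ E]].
  apply pt_inj in E; auto; lra. }
constructor.
- intros [E|E]; [apply pt_inj in E; auto; lra|exact (Hnot _ E)].
- constructor; [apply Hnot|].
  apply FinFun.Injective_map_NoDup; [|apply seq_NoDup].
  intros i j; apply node_inj; auto.
Qed.

Lemma zeros0_sep tau n i q : 0 < Im tau -> (i < n)%nat -> In q (zeros0 tau n) -> q <> node tau n i ->
  ~ in_lattice tau (node tau n i + - q)%C.
Proof.
intros Ht Hi [<-|[<-|Hq]] Hne.
- unfold node; rewrite pt_sub; apply pt_not_lattice; auto; right; nonint_tac 1%Z 3%Z.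
- unfold node; rewrite pt_sub; apply pt_not_lattice; auto; right; nonint_tac 1%Z 3%Z.
- apply in_nodes in Hq; destruct Hq as [j [Hj ->]]; apply node_sep; auto; intros ->; auto.
Qed.

Lemma zerosA_node0 tau n : 0 < Im tau -> (1 <= n)%nat -> ps tau (zerosA tau n) (node tau n 0) <> 0%C.
Proof.
intros Ht Hn; apply ps_neq0; auto.
assert (E0 : node tau n 0 = pt tau 0 (1 / 3)) by (unfold node, Rdiv; simpl; rewrite Rmult_0_l; auto).
intros p [<-|[<-|[<-|Hp]]].
- rewrite E0, pt_sub; apply pt_not_lattice; auto; right; nonint_tac 1%Z 6%Z.
- rewrite E0, pt_sub; apply pt_not_lattice; auto; right; nonint_tac 1%Z 6%Z.
- rewrite E0, pt_sub; apply pt_not_lattice; auto; right; nonint_tac 1%Z 3%Z.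
- apply in_map_iff in Hp; destruct Hp as [i [<- Hi]]; apply in_seq in Hi.
  apply node_sep; auto; lia.
Qed.

Lemma zerosA_node tau n i : 0 < Im tau -> (1 <= i < n)%nat -> ps tau (zerosA tau n) (node tau n i) = 0%C.
Proof.
intros Ht Hi; apply ps_at_node; auto; unfold zerosA; do 3 right.
apply in_map, in_seq; lia.
Qed.

Lemma zerosB_node tau n i : 0 < Im tau -> (i < n)%nat -> ps tau (zerosB tau n) (node tau n i) <> 0%C.
Proof.
intros Ht Hi; apply ps_neq0; auto.
intros p [<-|[<-|Hp]].
- unfold node; rewrite pt_sub; apply pt_not_lattice; auto; right; nonint_tac (-1)%Z 6%Z.
- unfold node; rewrite pt_sub; apply pt_not_lattice; auto; right.
  (* The difference of heights is (5 + 2 n) / 6, whose numerator is odd. *)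
  apply (nonint_frac _ (5 + 2 * Z.of_nat n) 6); [lia| |].
  + intros E; apply Z.mod_divide in E; [|lia]; destruct E as [k E]; lia.
  + rewrite plus_IZR, mult_IZR, <- INR_IZR_INZ; lra.
- apply in_map_iff in Hp; destruct Hp as [j [<- Hj]].
  unfold node; rewrite pt_sub; apply pt_not_lattice; auto; right; nonint_tac (-1)%Z 3%Z.
Qed.

Lemma zeros0_beta tau n s : 0 < Im tau -> s = 1 / 3 \/ s = - (1 / 3) -> ps tau (zeros0 tau n) (pt tau s 0) <> 0%C.
Proof.
intros Ht Hs; apply ps_neq0; auto.
intros p [<-|[<-|Hp]].
- rewrite pt_sub; apply pt_not_lattice; auto; left; destruct Hs as [-> | ->];
   [nonint_tac 1%Z 12%Z|nonint_tac (-7)%Z 12%Z].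
- rewrite pt_sub; apply pt_not_lattice; auto; left; destruct Hs as [-> | ->];
   [nonint_tac 7%Z 12%Z|nonint_tac (-1)%Z 12%Z].
- apply in_nodes in Hp; destruct Hp as [j [Hj ->]].
  unfold node; rewrite pt_sub; apply pt_not_lattice; auto; right; nonint_tac (-1)%Z 3%Z.
Qed.

Lemma half_period tau z : in_lattice tau (z + z)%C ->
  exists e e' m n : Z, (e = 0 \/ e = 1)%Z /\ (e' = 0 \/ e' = 1)%Z /\
    z = (pt tau (IZR e / 2) (IZR e' / 2) + lat tau m n)%C.
Proof.
intros [m [n E]].
exists (m mod 2)%Z, (n mod 2)%Z, (m / 2)%Z, (n / 2)%Z.
assert (Hm := Z.mod_pos_bound m 2 ltac:(lia)); assert (Hn := Z.mod_pos_bound n 2 ltac:(lia)).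
split; [lia|split; [lia|]].
assert (Em : IZR m = 2 * IZR (m / 2) + IZR (m mod 2)) by (rewrite <- mult_IZR, <- plus_IZR; f_equal; apply Z.div_mod; lia).
assert (En : IZR n = 2 * IZR (n / 2) + IZR (n mod 2)) by (rewrite <- mult_IZR, <- plus_IZR; f_equal; apply Z.div_mod; lia).
rewrite Em, En in E.
destruct tau as [a b], z as [x y]; unfold pt, lat, RtoC, Cplus, Cmult in *; simpl in *.
injection E; intros E2 E1; f_equal; lra.
Qed.

(** The lists differ in the pairs 1/4, -1/4 and 1/3, -1/3 with midpoint 0. As 7/12 and -1/12 are not
    integers, [wr_pair_list] leaves only nodes and half periods as zeros. *)
Lemma wr_01 tau n z : 0 < Im tau ->
  wr (ps tau (zeros0 tau n)) (psd tau (zeros0 tau n)) (ps tau (zeros1 tau n)) (psd tau (zeros1 tau n)) z = 0%C ->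
  ps tau (nodes tau n) z = 0%C \/ in_lattice tau (z + z)%C.
Proof.
intros Ht E.
assert (E' := wr_pair_list tau 0 (pt tau (1 / 4) 0) (pt tau (1 / 3) 0) z (nodes tau n) Ht).
assert (Ep : forall s, (0 + pt tau s 0)%C = pt tau s 0 /\ (0 - pt tau s 0)%C = pt tau (- s) 0).
{ intros s; unfold pt; rewrite RtoC_opp; split; ring. }
rewrite !(proj1 (Ep _)), !(proj2 (Ep _)) in E'.
unfold zeros0, zeros1 in E; rewrite E in E'.
destruct (classic (ps tau (nodes tau n) z = 0%C)) as [|H1]; auto.
destruct (classic (in_lattice tau (z + z)%C)) as [|H2]; auto.
exfalso; symmetry in E'; revert E'.
assert (N1 : S1 tau (pt tau (1 / 4) 0 + pt tau (1 / 3) 0)%C <> 0%C).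
{ rewrite pt_add; intros H; apply (S1_lattice tau _ Ht) in H; revert H.
  apply pt_not_lattice; auto; left; nonint_tac 7%Z 12%Z. }
assert (N2 : S1 tau (pt tau (1 / 4) 0 - pt tau (1 / 3) 0)%C <> 0%C).
{ rewrite pt_minus; intros H; apply (S1_lattice tau _ Ht) in H; revert H.
  apply pt_not_lattice; auto; left; nonint_tac (-1)%Z 12%Z. }
assert (N3 : S1 tau (z + - 0 + (z + - 0))%C <> 0%C).
{ intros H; apply (S1_lattice tau _ Ht) in H; apply H2.
  replace (z + - 0 + (z + - 0))%C with (z + z)%C in H by ring; auto. }
assert (N4 := S1d_0_neq0 tau Ht).
repeat apply Cmult_neq_0; auto.
intros H; apply (Cmult_neq_0 _ _ N1 N2).
match goal with |- ?P = _ => transitivity (- (- P))%C end; [ring|rewrite H; ring].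
Qed.

(** After reordering, the lists differ in the pair tau/3, -1/4 against tau/6, -1/4 + tau/6, both
    with midpoint -1/8 + tau/6. Twice a half period minus twice this midpoint has tau-coordinate
    -1/3 modulo integers, so the factor with doubled argument does not vanish. *)
Lemma wr_0A tau n e e' : 0 < Im tau -> (1 <= n)%nat -> (e = 0 \/ e = 1)%Z -> (e' = 0 \/ e' = 1)%Z ->
  wr (ps tau (zeros0 tau n)) (psd tau (zeros0 tau n)) (ps tau (zerosA tau n)) (psd tau (zerosA tau n))
    (pt tau (IZR e / 2) (IZR e' / 2)) <> 0%C.
Proof.
intros Ht Hn He He'.
set (l := pt tau (1 / 4) 0 :: map (node tau n) (seq 1 (n - 1))).
set (h := pt tau (IZR e / 2) (IZR e' / 2)).
assert (E := wr_pair_list tau (pt tau (- (1 / 8)) (1 / 6)) (pt tau (1 / 8) (1 / 6)) (pt tau (1 / 8) 0) h l Ht).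
rewrite !pt_add, !pt_minus in E.
replace (- (1 / 8) + 1 / 8) with 0 in E by field.
replace (1 / 6 + 1 / 6) with (1 / 3) in E by field.
replace (- (1 / 8) - 1 / 8) with (- (1 / 4)) in E by field.
replace (1 / 6 - 1 / 6) with 0 in E by field.
replace (1 / 6 + 0) with (1 / 6) in E by field.
replace (1 / 6 - 0) with (1 / 6) in E by field.
assert (Ef : ps tau (zeros0 tau n) = ps tau (pt tau 0 (1 / 3) :: pt tau (- (1 / 4)) 0 :: l)).
{ apply functional_extensionality; intros u; unfold zeros0, l; rewrite (nodes_cons tau n Hn); simpl; ring. }
assert (A1 : holo (ps tau (zeros0 tau n)) (psd tau (pt tau 0 (1 / 3) :: pt tau (- (1 / 4)) 0 :: l)))
  by (rewrite Ef; apply ps_holo, Ht).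
assert (A2 := proj1 (ps_holo tau (zerosA tau n) Ht)).
rewrite (wr_unique _ _ _ _ _ _ h (proj1 (ps_holo tau _ Ht)) A1 A2 A2), Ef.
change (zerosA tau n) with (pt tau 0 (1 / 6) :: pt tau (- (1 / 4)) (1 / 6) :: l).
rewrite E.
assert (HR : ps tau l h <> 0%C).
{ apply ps_neq0; auto; intros p [<-|Hp].
  - unfold h; rewrite pt_sub; apply pt_not_lattice; auto; left.
    destruct He as [-> | ->]; [nonint_tac (-1)%Z 4%Z|nonint_tac 1%Z 4%Z].
  - apply in_map_iff in Hp; destruct Hp as [i [<- _]]; unfold h, node.
    rewrite pt_sub; apply pt_not_lattice; auto; right.
    destruct He' as [-> | ->]; [nonint_tac (-1)%Z 3%Z|nonint_tac 1%Z 6%Z]. }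
assert (HS : forall s t, nonint s \/ nonint t -> S1 tau (pt tau s t) <> 0%C).
{ intros s t Hst H; apply (S1_lattice tau _ Ht) in H; revert H; apply pt_not_lattice; auto. }
apply Cmult_neq_0; [exact (Cmult_neq_0 _ _ HR HR)|].
apply Cmult_neq_0; [|apply Cmult_neq_0].
- intros H.
  assert (N : (S1 tau (pt tau (1 / 8 + 1 / 8) (1 / 6)) * S1 tau (pt tau (1 / 8 - 1 / 8) (1 / 6)) <> 0)%C).
  { apply Cmult_neq_0; apply HS; right; nonint_tac 1%Z 6%Z. }
  apply N; match goal with |- ?P = _ => transitivity (- (- P))%C end; [ring|rewrite H; ring].
- unfold h; rewrite pt_sub, pt_add; apply HS; right.
  destruct He' as [-> | ->]; [nonint_tac (-1)%Z 3%Z|nonint_tac 2%Z 3%Z].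
- apply S1d_0_neq0, Ht.
Qed.

Definition sec (tau : C) (n : nat) (x lam : R) (i : nat) (z : C) : C :=
  match i with
  | O => ps tau (zeros0 tau n) z
  | S O => ps tau (zeros1 tau n) z
  | _ => (ps tau (zeros0 tau n) z
          + RtoC x * (ps tau (zerosA tau n) z + RtoC lam * ps tau (zerosB tau n) z))%C
  end.

Definition secd (tau : C) (n : nat) (x lam : R) (i : nat) (z : C) : C :=
  match i with
  | O => psd tau (zeros0 tau n) z
  | S O => psd tau (zeros1 tau n) z
  | _ => (psd tau (zeros0 tau n) z
          + RtoC x * (psd tau (zerosA tau n) z + RtoC lam * psd tau (zerosB tau n) z))%C
  end.

Lemma sec_holo tau n x lam i : 0 < Im tau ->
  holo (sec tau n x lam i) (secd tau n x lam i) /\ csmooth (sec tau n x lam i).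
Proof.
intros Ht.
destruct (ps_holo tau (zeros0 tau n) Ht) as [H0 C0].
destruct (ps_holo tau (zeros1 tau n) Ht) as [H1 C1].
destruct (ps_holo tau (zerosA tau n) Ht) as [HA CA].
destruct (ps_holo tau (zerosB tau n) Ht) as [HB CB].
destruct i as [|[|i]]; [split; auto|split; auto|split].
- exact (holo_plus _ _ _ _ H0 (holo_scal (RtoC x) _ _ (holo_plus _ _ _ _ HA (holo_scal (RtoC lam) _ _ HB)))).
- exact (csmooth_plus _ _ C0 (csmooth_mult _ _ (csmooth_const (RtoC x))
    (csmooth_plus _ _ CA (csmooth_mult _ _ (csmooth_const (RtoC lam)) CB)))).
Qed.

Lemma sec_quasi tau n x lam i z m m' : 0 < Im tau -> (1 <= n)%nat ->
  sec tau n x lam i (z + lat tau m m')%C =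
  (mulfac tau z (n + 2) (csum (zeros0 tau n)) m m' * sec tau n x lam i z)%C.
Proof.
intros Ht Hn.
destruct (zeros_length tau n Hn) as (L0 & L1 & LA & LB).
destruct (zeros_sum tau n Hn) as (E1 & EA & EB).
destruct i as [|[|i]]; cbn [sec].
- rewrite ps_quasi, L0 by auto; ring.
- rewrite ps_quasi, L1, E1 by auto; ring.
- rewrite !ps_quasi, L0, LA, LB, EA, EB by auto; ring.
Qed.

Lemma sec_quasi_periodic a b n x lam : 0 < b -> (1 <= n)%nat ->
  quasi_periodic a b (n + 2) (sec (a, b) n x lam).
Proof.
intros Hb Hn; assert (Ht : 0 < Im (a, b)) by exact Hb.
split.
- exists (mulfac (a, b) 0 (n + 2) (csum (zeros0 (a, b) n)) 1 0); split.
  + unfold mulfac; rewrite Cmod_ee.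
    transitivity (exp 0); [|apply exp_0].
    f_equal; simpl; ring.
  + intros i u v.
    replace ((u + 1)%R, v) with ((u, v) + lat (a, b) 1 0)%C
      by (unfold lat, RtoC, Cplus, Cmult; simpl; f_equal; ring).
    rewrite sec_quasi by auto; f_equal; unfold mulfac; f_equal; simpl IZR.
    rewrite Rmult_0_r; ring.
- exists (fun z => mulfac (a, b) z (n + 2) (csum (zeros0 (a, b) n)) 0 1),
    (2 * PI * INR (n + 2) * b - 4 * PI * Im (csum (zeros0 (a, b) n))).
  split.
  + intros u v; unfold mulfac; rewrite Cmod_ee.
    assert (Hsq : forall r, exp r ^ 2 = exp (2 * r))
      by (intros r; simpl; rewrite Rmult_1_r, <- exp_plus; f_equal; ring).
    rewrite Hsq.
    f_equal; generalize (INR (n + 2)); intros k.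
    destruct (csum (zeros0 (a, b) n)); simpl; ring.
  + intros i u v.
    replace ((u + a)%R, (v + b)%R) with ((u, v) + lat (a, b) 0 1)%C
      by (unfold lat, RtoC, Cplus, Cmult; simpl; f_equal; ring).
    apply sec_quasi; auto.
Qed.

Lemma lattice_translate tau z p : in_lattice tau (z + - p)%C -> exists m m', z = (p + lat tau m m')%C.
Proof.
intros [m [m' E]]; exists m, m'; unfold lat; rewrite <- E; ring.
Qed.

(** The summand [s0] of [s2] drops out and [x] factors out, so [lam] alone settles the Wronskian and
    [x] is left for the zeros 1/3, -1/3 of [s1]. *)
Lemma wr_0_sec tau n x lam z :
  wr (sec tau n x lam 0) (secd tau n x lam 0) (sec tau n x lam 2) (secd tau n x lam 2) z =
  (RtoC x * (wr (ps tau (zeros0 tau n)) (psd tau (zeros0 tau n)) (ps tau (zerosA tau n)) (psd tau (zerosA tau n)) z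
   + RtoC lam * wr (ps tau (zeros0 tau n)) (psd tau (zeros0 tau n)) (ps tau (zerosB tau n)) (psd tau (zerosB tau n)) z))%C.
Proof. unfold wr; cbn [sec secd]; ring. Qed.

Lemma sections_exist tau n : 0 < Im tau -> (1 <= n)%nat ->
  exists x lam, section_triple (sec tau n x lam) (secd tau n x lam).
Proof.
intros Ht Hn.
set (F0 := ps tau (zeros0 tau n)); set (FA := ps tau (zerosA tau n)); set (FB := ps tau (zerosB tau n)).
set (wA := fun h => wr F0 (psd tau (zeros0 tau n)) FA (psd tau (zerosA tau n)) h).
set (wB := fun h => wr F0 (psd tau (zeros0 tau n)) FB (psd tau (zerosB tau n)) h).
set (hp := fun e e' => pt tau (IZR e / 2) (IZR e' / 2)).
set (a0 := node tau n 0).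
(* Five conditions on [lam]: the value at the first node, the only node where [A] is non-zero, and
   the Wronskian at the four half periods. *)
destruct (finite_avoid ((FA a0, FB a0) :: (wA (hp 0 0)%Z, wB (hp 0 0)%Z) :: (wA (hp 1 0)%Z, wB (hp 1 0)%Z)
  :: (wA (hp 0 1)%Z, wB (hp 0 1)%Z) :: (wA (hp 1 1)%Z, wB (hp 1 1)%Z) :: nil)) as [lam [Hlam Av]].
{ intros p [<-|[<-|[<-|[<-|[<-|[]]]]]]; simpl.
  - apply zerosA_node0; auto.
  - apply wr_0A; auto.
  - apply wr_0A; auto.
  - apply wr_0A; auto.
  - apply wr_0A; auto. }
set (be := pt tau (1 / 3) 0); set (be' := pt tau (- (1 / 3)) 0).
(* At the two zeros of [s1] that are not nodes, [s0] is non-zero, so a small [x] keeps [s2]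
   non-zero. *)
destruct (finite_avoid ((F0 be, (FA be + RtoC lam * FB be)%C) :: (F0 be', (FA be' + RtoC lam * FB be')%C) :: nil))
  as [x [Hx Bv]].
{ intros p [<-|[<-|[]]]; simpl; apply zeros0_beta; auto. }
exists x, lam.
assert (HxC : RtoC x <> 0%C) by (intros E; apply RtoC_inj in E; lra).
assert (HlC : RtoC lam <> 0%C) by (intros E; apply RtoC_inj in E; lra).
set (s := sec tau n x lam); set (ds := secd tau n x lam).
assert (Hh : forall i, holo (s i) (ds i)) by (intros i; exact (proj1 (sec_holo tau n x lam i Ht))).
assert (N2node : forall i, (i < n)%nat -> s 2%nat (node tau n i) <> 0%C).
{ intros i Hi; unfold s; cbn [sec].
  rewrite (ps_at_node tau (zeros0 tau n)) by (auto; do 2 right; apply in_map, in_seq; lia).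
  rewrite Cplus_0_l; apply Cmult_neq_0; auto.
  destruct (Nat.eq_dec i 0) as [->|Hi0].
  - apply (Av (FA a0, FB a0)); left; auto.
  - rewrite zerosA_node by (auto; lia).
    rewrite Cplus_0_l; apply Cmult_neq_0; auto; apply zerosB_node; auto. }
(* Vanishing of sections, and below of Wronskians, is invariant under the lattice, so
   representatives are enough. *)
assert (Tr : forall i p m m', s i (p + lat tau m m')%C = 0%C -> s i p = 0%C).
{ intros i p m m' E; unfold s in E; rewrite sec_quasi in E by auto.
  destruct (classic (s i p = 0%C)) as [|H]; auto; exfalso.
  exact (Cmult_neq_0 _ _ (mulfac_neq0 _ _ _ _ _ _) H E). }
assert (Wq : forall i p m m', wr (s 0%nat) (ds 0%nat) (s i) (ds i) (p + lat tau m m')%C = 0%C ->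
   wr (s 0%nat) (ds 0%nat) (s i) (ds i) p = 0%C).
{ intros i p m m' E.
  rewrite (wr_quasi _ _ _ _ (lat tau m m') p (fun z => mulfac tau z (n + 2) (csum (zeros0 tau n)) m m')) in E; auto.
  - destruct (classic (wr (s 0%nat) (ds 0%nat) (s i) (ds i) p = 0%C)) as [|H]; auto; exfalso.
    exact (Cmult_neq_0 _ _ (Cmult_neq_0 _ _ (mulfac_neq0 _ _ _ _ _ _) (mulfac_neq0 _ _ _ _ _ _)) H E).
  - intros z; apply sec_quasi; auto.
  - intros z; apply sec_quasi; auto. }
split; [intros i; exact (proj2 (sec_holo tau n x lam i Ht))|split; [exact Hh|split]].
- intros z; destruct (classic (s 1%nat z = 0%C)) as [E|E]; auto; right; intros E2.
  apply (ps_zero tau (zeros1 tau n) z Ht) in E; destruct E as [p [Hp E]].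
  apply lattice_translate in E; destruct E as [m [m' ->]].
  apply Tr in E2; destruct Hp as [<-|[<-|Hp]].
  + exact (Bv _ (or_introl eq_refl) E2).
  + exact (Bv _ (or_intror (or_introl eq_refl)) E2).
  + apply in_nodes in Hp; destruct Hp as [i [Hi ->]]; exact (N2node i Hi E2).
- intros z; destruct (classic (wronskian s ds 1 z = 0%C)) as [E|E]; auto; right; intros E2.
  change (wr (s 0%nat) (ds 0%nat) (s 2%nat) (ds 2%nat) z = 0%C) in E2.
  destruct (wr_01 tau n z Ht E) as [E3|E3].
  + apply (ps_zero tau (nodes tau n) z Ht) in E3; destruct E3 as [p [Hp E3]].
    apply lattice_translate in E3; destruct E3 as [m [m' ->]].
    apply Wq in E2; apply in_nodes in Hp; destruct Hp as [i [Hi ->]].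
    assert (Hin : In (node tau n i) (zeros0 tau n)) by (do 2 right; apply in_map, in_seq; lia).
    assert (E0 : s 0%nat (node tau n i) = 0%C) by (apply ps_at_node; auto).
    unfold wr in E2; rewrite E0 in E2.
    (* At a node s0 = 0, so the Wronskian is - s0' s2 there, and the node is a simple zero of
       [s0]. *)
    assert (Nd : ds 0%nat (node tau n i) <> 0%C).
    { apply psd_simple; auto; [apply zeros0_nodup; auto|].
      intros q Hq Hne; apply zeros0_sep; auto. }
    apply (Cmult_neq_0 _ _ Nd (N2node i Hi)).
    transitivity (- (0 * ds 2%nat (node tau n i) - ds 0%nat (node tau n i) * s 2%nat (node tau n i)))%C;
      [ring|rewrite E2; ring].
  + apply half_period in E3; destruct E3 as (e & e' & m & m' & He & He' & ->).
    apply Wq in E2; unfold s, ds in E2; rewrite wr_0_sec in E2.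
    assert (Nw : (wA (hp e e') + RtoC lam * wB (hp e e') <> 0)%C).
    { destruct He as [-> | ->], He' as [-> | ->].
      - apply (Av (wA (hp 0 0)%Z, wB (hp 0 0)%Z)); simpl; tauto.
      - apply (Av (wA (hp 0 1)%Z, wB (hp 0 1)%Z)); simpl; tauto.
      - apply (Av (wA (hp 1 0)%Z, wB (hp 1 0)%Z)); simpl; tauto.
      - apply (Av (wA (hp 1 1)%Z, wB (hp 1 1)%Z)); simpl; tauto. }
    exact (Cmult_neq_0 _ _ HxC Nw E2).
Qed.

(** * The multiple point *)

Lemma surf_norm s ds x y : section_triple s ds ->
  sum4 (fun i => surf s i x y * surf s i x y) * surf_den s x y = Cmod (s 0%nat (x, y)) ^ 2.
Proof.
intros H; assert (Hd := Rgt_not_eq _ _ (surf_den_pos s ds x y H)).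
assert (E : sum4 (fun i => surf s i x y * surf s i x y) * surf_den s x y
   = sum4 (fun i => surf_num s i x y * surf_num s i x y) * / surf_den s x y)
  by (unfold sum4, surf; field; auto).
rewrite E, Cmod2_alt; clear E.
apply Rmult_eq_reg_r with (surf_den s x y); auto.
rewrite Rmult_assoc, Rinv_l, Rmult_1_r by auto.
unfold sum4, surf_num, surf_den, re_of, im_of; ring.
Qed.

Lemma surf_zero s ds x y : section_triple s ds ->
  ((forall i, (i < 4)%nat -> surf s i x y = 0) <-> s 0%nat (x, y) = 0%C).
Proof.
intros H; split.
- intros E; apply Cmod_eq_0.
  assert (N := surf_norm s ds x y H); unfold sum4 in N; rewrite !E in N by lia.
  assert (Cmod (s 0%nat (x, y)) ^ 2 = 0) by lra.
  assert (T := Cmod_ge_0 (s 0%nat (x, y))); nra.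
- intros E i _; unfold surf.
  replace (surf_num s i x y) with 0; [ring|].
  unfold surf_num, re_of, im_of; rewrite E; destruct i as [|[|[|i]]]; simpl; ring.
Qed.

(* [s1 / s0] is determined by [f]: it is the conjugate of the first complex coordinate of
   [f / |f|^2]. *)
Lemma surf_ratio s ds x y x' y' : section_triple s ds ->
  (forall i, (i < 4)%nat -> surf s i x y = surf s i x' y') ->
  s 0%nat (x, y) <> 0%C -> s 0%nat (x', y') <> 0%C ->
  (s 1%nat (x, y) * s 0%nat (x', y') = s 1%nat (x', y') * s 0%nat (x, y))%C.
Proof.
intros H E H0 H0'.
assert (Hf : forall u v, (Cconj (s 1%nat (u, v)) * s 0%nat (u, v) =
   RtoC (surf_den s u v) * (surf s 0 u v, surf s 1 u v))%C).
{ intros u v; assert (Hd := Rgt_not_eq _ _ (surf_den_pos s ds u v H)).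
  unfold surf, surf_num, re_of, im_of.
  destruct (s 0%nat (u, v)) as [p0 q0], (s 1%nat (u, v)) as [p1 q1].
  apply injective_projections; simpl; field; auto. }
assert (Hn : forall u v, (Cconj (s 0%nat (u, v)) * s 0%nat (u, v) =
   RtoC (sum4 (fun i => surf s i u v * surf s i u v)%R * surf_den s u v)%R)%C).
{ intros u v; rewrite (surf_norm s ds u v H), Cmod2_alt.
  destruct (s 0%nat (u, v)) as [p0 q0]; apply injective_projections; simpl; ring. }
assert (F := Hf x y); assert (F' := Hf x' y'); assert (N := Hn x y); assert (N' := Hn x' y').
assert (Es : sum4 (fun i => surf s i x y * surf s i x y) = sum4 (fun i => surf s i x' y' * surf s i x' y'))
  by (unfold sum4; rewrite !E by lia; auto).
rewrite Es in N; rewrite !E in F by lia.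
assert (Ec : (Cconj (s 1%nat (x, y)) * Cconj (s 0%nat (x', y')) =
   Cconj (s 1%nat (x', y')) * Cconj (s 0%nat (x, y)))%C).
{ assert (Hm : ((Cconj (s 1%nat (x, y)) * Cconj (s 0%nat (x', y'))
     - Cconj (s 1%nat (x', y')) * Cconj (s 0%nat (x, y))) * (s 0%nat (x, y) * s 0%nat (x', y')) = 0)%C).
  { transitivity ((Cconj (s 1%nat (x, y)) * s 0%nat (x, y)) * (Cconj (s 0%nat (x', y')) * s 0%nat (x', y'))
      - (Cconj (s 1%nat (x', y')) * s 0%nat (x', y')) * (Cconj (s 0%nat (x, y)) * s 0%nat (x, y)))%C; [ring|].
    rewrite F, F', N, N', !RtoC_mult; ring. }
  destruct (classic (Cconj (s 1%nat (x, y)) * Cconj (s 0%nat (x', y'))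
     - Cconj (s 1%nat (x', y')) * Cconj (s 0%nat (x, y)) = 0)%C) as [Ez|Ez].
  - transitivity (Cconj (s 1%nat (x, y)) * Cconj (s 0%nat (x', y'))
     - Cconj (s 1%nat (x', y')) * Cconj (s 0%nat (x, y))
     + Cconj (s 1%nat (x', y')) * Cconj (s 0%nat (x, y)))%C; [ring|rewrite Ez; ring].
  - exfalso; exact (Cmult_neq_0 _ _ Ez (Cmult_neq_0 _ _ H0 H0') Hm). }
rewrite <- !Cmult_conj in Ec.
apply (f_equal Cconj) in Ec; rewrite !Cconj_conj in Ec; exact Ec.
Qed.

Lemma pt_coord a b u v : ((u + v * a)%R, (v * b)%R) = pt (a, b) u v.
Proof. unfold pt, RtoC, Cplus, Cmult; simpl; f_equal; ring. Qed.

(* [s1 / s0] has degree two and is even. *)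
Lemma sec_ratio_injective tau n x lam z z' : 0 < Im tau ->
  (sec tau n x lam 1 z * sec tau n x lam 0 z' = sec tau n x lam 1 z' * sec tau n x lam 0 z)%C ->
  sec tau n x lam 0 z <> 0%C -> sec tau n x lam 0 z' <> 0%C ->
  in_lattice tau (z + z')%C \/ in_lattice tau (z - z')%C.
Proof.
intros Ht E H0 H0'.
set (al := pt tau (1 / 4) 0); set (be := pt tau (1 / 3) 0).
assert (Ep : forall s w, (sh tau (pt tau s 0) w * sh tau (pt tau (- s) 0) w =
   D2 tau w * B2 tau (pt tau s 0) - B2 tau w * D2 tau (pt tau s 0))%C).
{ intros s w; assert (P := sh_pair tau 0 (pt tau s 0) w Ht).
  replace (0 + pt tau s 0)%C with (pt tau s 0) in P by ring.
  replace (0 - pt tau s 0)%C with (pt tau (- s) 0) in P by (unfold pt; rewrite RtoC_opp; ring).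
  replace (w + - 0)%C with w in P by ring; exact P. }
assert (E0 : forall w, sec tau n x lam 0 w =
   ((D2 tau w * B2 tau al - B2 tau w * D2 tau al) * ps tau (nodes tau n) w)%C).
{ intros w; unfold al; rewrite <- Ep; cbn [sec]; unfold zeros0; cbn [ps]; ring. }
assert (E1 : forall w, sec tau n x lam 1 w =
   ((D2 tau w * B2 tau be - B2 tau w * D2 tau be) * ps tau (nodes tau n) w)%C).
{ intros w; unfold be; rewrite <- Ep; cbn [sec]; unfold zeros1; cbn [ps]; ring. }
assert (Hp : forall w, sec tau n x lam 0 w <> 0%C -> ps tau (nodes tau n) w <> 0%C).
{ intros w Hw Hz; apply Hw; rewrite E0, Hz; ring. }
assert (Hab : (S1 tau (al + be) * S1 tau (al - be) <> 0)%C).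
{ apply Cmult_neq_0; intros H; apply (S1_lattice tau _ Ht) in H; revert H; unfold al, be.
  - rewrite pt_add; apply pt_not_lattice; auto; left; nonint_tac 7%Z 12%Z.
  - rewrite pt_minus; apply pt_not_lattice; auto; left; nonint_tac (-1)%Z 12%Z. }
(* The cross difference of the ratios is a product of two 2 by 2 determinants, one in z, z' and one
   in [al], [be]; the addition formula factors each. *)
assert (Hm : ((S1 tau (z + z') * S1 tau (z - z')) * ((S1 tau (al + be) * S1 tau (al - be))
   * (ps tau (nodes tau n) z * ps tau (nodes tau n) z')) = 0)%C).
{ rewrite (S1_addition tau z z' Ht), (S1_addition tau al be Ht).
  transitivity (sec tau n x lam 1 z' * sec tau n x lam 0 z - sec tau n x lam 1 z * sec tau n x lam 0 z')%C.
  - rewrite !E0, !E1; ring.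
  - rewrite E; ring. }
destruct (classic (S1 tau (z + z')%C = 0%C)) as [Z1|Z1]; [left; apply S1_lattice; auto|].
destruct (classic (S1 tau (z - z')%C = 0%C)) as [Z2|Z2]; [right; apply S1_lattice; auto|].
exfalso; exact (Cmult_neq_0 _ _ (Cmult_neq_0 _ _ Z1 Z2) (Cmult_neq_0 _ _ Hab
  (Cmult_neq_0 _ _ (Hp z H0) (Hp z' H0'))) Hm).
Qed.

Lemma int_between (r : R) (m : Z) : r = IZR m -> -1 < r < 1 -> r = 0.
Proof.
intros E [H1 H2]; rewrite E in *.
apply lt_IZR in H1; apply lt_IZR in H2; f_equal; lia.
Qed.

Lemma unit_square_rep tau u v u' v' : 0 < Im tau ->
  0 <= u < 1 -> 0 <= v < 1 -> 0 <= u' < 1 -> 0 <= v' < 1 ->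
  in_lattice tau (pt tau u v - pt tau u' v')%C -> (u, v) = (u', v').
Proof.
intros Ht Hu Hv Hu' Hv' H; rewrite pt_minus in H.
apply (pt_lattice tau _ _ Ht) in H; destruct H as [m [m' [E1 E2]]].
apply int_between in E1; [|lra]; apply int_between in E2; [|lra]; f_equal; lra.
Qed.

(** Representatives of the zeros of [s0] with coordinates in [0, 1): -1/4 becomes 3/4. *)
Definition pole_list (n : nat) : list (R * R) :=
  (1 / 4, 0) :: (3 / 4, 0) :: map (fun i => (INR i / INR n, 1 / 3)) (seq 0 n).

Lemma pole_list_nodup n : (1 <= n)%nat -> NoDup (pole_list n).
Proof.
intros Hn; assert (Hn' : 0 < INR n) by (apply lt_0_INR; lia).
assert (Hnot : forall s, ~ In (s, 0) (map (fun i => (INR i / INR n, 1 / 3)) (seq 0 n))).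
{ intros s H; apply in_map_iff in H; destruct H as [i [E _]]; injection E; intros; lra. }
constructor.
- intros [E|E]; [injection E; intros; lra|exact (Hnot _ E)].
- constructor; [apply Hnot|].
  apply Injective_map_NoDup; [|apply seq_NoDup].
  intros i j E; injection E; intros E1; apply INR_eq.
  apply Rmult_eq_reg_r with (/ INR n); auto; apply Rgt_not_eq, Rinv_0_lt_compat; auto.
Qed.

Lemma pole_list_spec tau n u v : 0 < Im tau -> (1 <= n)%nat ->
  (In (u, v) (pole_list n) <-> 0 <= u < 1 /\ 0 <= v < 1 /\ ps tau (zeros0 tau n) (pt tau u v) = 0%C).
Proof.
intros Ht Hn; assert (Hn' : 0 < INR n) by (apply lt_0_INR; lia).
assert (Hi : forall i, (i < n)%nat -> 0 <= INR i / INR n < 1).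
{ intros i Hi; split; [apply Rdiv_le_0_compat; auto using pos_INR|].
  apply Rlt_div_l; auto; rewrite Rmult_1_l; apply lt_INR; auto. }
split.
- intros [E|[E|E]].
  + injection E; intros; subst; split; [lra|split; [lra|]].
    apply ps_at_node; auto; left; auto.
  + injection E; intros; subst; split; [lra|split; [lra|]].
    apply ps_zero; auto; exists (pt tau (- (1 / 4)) 0); split; [right; left; auto|].
    rewrite pt_sub; exists 1%Z, 0%Z; unfold pt; do 2 f_equal; [f_equal; field|f_equal; ring].
  + apply in_map_iff in E; destruct E as [i [E Hin]]; apply in_seq in Hin.
    injection E; intros; subst; split; [apply Hi; lia|split; [lra|]].
    apply ps_at_node; auto; do 2 right; apply (in_map (node tau n)), in_seq; lia.
- intros (Hu & Hv & E); apply (ps_zero tau _ _ Ht) in E; destruct E as [p [Hp E]].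
  destruct Hp as [<-|[<-|Hp]].
  + rewrite pt_sub in E; apply (pt_lattice tau _ _ Ht) in E; destruct E as [m [m' [E1 E2]]].
    apply int_between in E1; [|lra]; apply int_between in E2; [|lra].
    left; f_equal; lra.
  + rewrite pt_sub in E; apply (pt_lattice tau _ _ Ht) in E; destruct E as [m [m' [E1 E2]]].
    assert (E3 : u - 3 / 4 = IZR (m - 1)) by (rewrite minus_IZR, <- E1; field).
    apply int_between in E3; [|lra]; apply int_between in E2; [|lra].
    right; left; f_equal; lra.
  + apply in_nodes in Hp; destruct Hp as [i [Hin ->]]; unfold node in E.
    rewrite pt_sub in E; apply (pt_lattice tau _ _ Ht) in E; destruct E as [m [m' [E1 E2]]].
    specialize (Hi i Hin).
    apply int_between in E1; [|lra]; apply int_between in E2; [|lra].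
    right; right; apply in_map_iff; exists i; split; [f_equal; lra|apply in_seq; lia].
Qed.

Theorem theorem2p3 :
  forall a b : R, in_M a b ->
  forall k : nat, (3 <= k)%nat ->
  exists f : nat -> R -> R -> R,
    smooth_map f /\ lattice_periodic f a b /\ conformal_immersion f /\
    willmore_critical f a b /\
    (exists p : nat -> R, density f a b p k /\
       forall p' : nat -> R, density f a b p' k ->
         forall i, (i < 4)%nat -> p' i = p i) /\
    willmore f a b = 4 * INR k * PI.
Proof.
intros a b (Hb & Ha & _) k Hk.
set (n := (k - 2)%nat); assert (Hn : (1 <= n)%nat) by (unfold n; lia).
assert (Ek : k = (n + 2)%nat) by (unfold n; lia).
set (tau := (a, b) : C); assert (Ht : 0 < Im tau) by exact Hb.
destruct (sections_exist tau n Ht Hn) as [x [lam Hs]].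
set (s := sec tau n x lam) in *; set (ds := secd tau n x lam) in *.
assert (Hq : quasi_periodic a b k s) by (rewrite Ek; apply sec_quasi_periodic; auto).
destruct (surf_spec a b k s ds ltac:(lra) Hb Hs Hq) as (P1 & P2 & P3 & P4 & P5).
exists (surf s); split; [auto|split; [auto|split; [auto|split; [auto|split; [|auto]]]]].
assert (Hz : forall u v, (forall i, (i < 4)%nat -> surf s i (u + v * a) (v * b) = 0)
   <-> ps tau (zeros0 tau n) (pt tau u v) = 0%C).
{ intros u v; rewrite (surf_zero s ds _ _ Hs), pt_coord; reflexivity. }
(* The origin: its preimages are the k zeros of [s0]. *)
exists (fun _ => 0); split.
- exists (pole_list n); split; [apply pole_list_nodup; auto|split].
  + unfold pole_list; simpl; rewrite length_map, length_seq; lia.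
  + intros [u v]; rewrite (pole_list_spec tau n u v Ht Hn); simpl.
    rewrite Hz; tauto.
(* Three distinct preimages are enough for a contradiction when p' is not 0, since any two are then
   equal or opposite on the torus. *)
- intros p' (l & Hnd & Hlen & Hl) i Hi.
  destruct l as [|[u1 v1] [|[u2 v2] [|[u3 v3] l]]]; simpl in Hlen; try lia.
  destruct (proj1 (Hl (u1, v1)) ltac:(simpl; auto)) as (U1 & V1 & F1).
  destruct (proj1 (Hl (u2, v2)) ltac:(simpl; auto)) as (U2 & V2 & F2).
  destruct (proj1 (Hl (u3, v3)) ltac:(simpl; auto)) as (U3 & V3 & F3).
  simpl in U1, V1, F1, U2, V2, F2, U3, V3, F3.
  destruct (classic (s 0%nat (pt tau u1 v1) = 0%C)) as [Z|Z].
  { rewrite <- (F1 i Hi); apply Hz; auto. }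
  exfalso.
  assert (NZ : forall u v, (forall i, (i < 4)%nat -> surf s i (u + v * a) (v * b) = p' i) ->
     s 0%nat (pt tau u v) <> 0%C).
  { intros u v F E; apply Z; apply (proj1 (Hz u1 v1)); intros j Hj.
    rewrite (F1 j Hj), <- (F j Hj); apply (proj2 (Hz u v) E); auto. }
  assert (Pair : forall u v u' v', (forall i, (i < 4)%nat -> surf s i (u + v * a) (v * b) = p' i) ->
     (forall i, (i < 4)%nat -> surf s i (u' + v' * a) (v' * b) = p' i) ->
     in_lattice tau (pt tau u v + pt tau u' v')%C \/ in_lattice tau (pt tau u v - pt tau u' v')%C).
  { intros u v u' v' F F'.
    apply (sec_ratio_injective tau n x lam _ _ Ht); [|apply (NZ u v F)|apply (NZ u' v' F')].
    assert (R := surf_ratio s ds (u + v * a) (v * b) (u' + v' * a) (v' * b) Hs).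
    rewrite !pt_coord in R; apply R; [|apply (NZ u v F)|apply (NZ _ _ F')].
    intros j Hj; rewrite F, F'; auto. }
  apply NoDup_cons_iff in Hnd; destruct Hnd as [N1 Hnd]; apply NoDup_cons_iff in Hnd; destruct Hnd as [N2 _].
  destruct (Pair _ _ _ _ F1 F2) as [A|A].
  (* If the second and third points are both opposite to the first, they coincide modulo the
     lattice. *)
  + destruct (Pair _ _ _ _ F1 F3) as [B|B].
    * apply N2; left; symmetry; apply (unit_square_rep tau); auto.
      destruct A as [m [m' A]], B as [q [q' B]]; exists (m - q)%Z, (m' - q')%Z.
      rewrite !minus_IZR, !RtoC_minus.
      transitivity ((pt tau u1 v1 + pt tau u2 v2) - (pt tau u1 v1 + pt tau u3 v3))%C; [ring|].
      rewrite A, B; ring.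
    * apply N1; right; left; symmetry; apply (unit_square_rep tau); auto.
  + apply N1; left; symmetry; apply (unit_square_rep tau); auto.
Qed.
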